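(* There is a tempered distribution $\varphi$ on $\mathbb{R}^2$ such that the Hankel operator $\mathbf{H}_\varphi$ extends by continuity to a bounded operator on $\mathrm{PW}(\mathbb{D})$, but $\mathbf{H}_\varphi$ does not have a bounded symbol; that is, there is no $\psi \in L^\infty(\mathbb{R}^2)$ such that $\widehat{\psi}\,\big|_{2\mathbb{D}} = \widehat{\varphi}\,\big|_{2\mathbb{D}}$ as distributions in $2\mathbb{D}$.
   Context: $\mathbb{D}$ is the open unit disc in $\mathbb{R}^2$ and $2\mathbb{D} = \{\xi \in \mathbb{R}^2 : |\xi|<2\}$. The Fourier transform is normalized as $\widehat{f}(\xi) = \int_{\mathbb{R}^2} f(x) e^{-2\pi i x\cdot \xi}\,dx$ and extended to tempered distributions in the usual way. The Paley--Wiener space $\mathrm{PW}(\mathbb{D})$ is the closed subspace of $L^2(\mathbb{R}^2)$ comprised of functions $f$ whose Fourier transforms $\widehat{f}$ are supported in $\overline{\mathbb{D}}$. For a tempered distribution $\varphi$ on $\mathbb{R}^2$ (the symbol), the Hankel operator $\mathbf{H}_\varphi$ is defined by $$\widehat{\mathbf{H}_\varphi f}(\eta) = \int_{\mathbb{D}} \widehat{f}(\xi)\, \widehat{\varphi}(\xi+\eta)\,d\xi, \qquad \eta \in \mathbb{D},$$ (the integral being understood as a distributional pairing, with $\widehat{\mathbf{H}_\varphi f} = 0$ outside $\overline{\mathbb{D}}$) on the dense subset of $\mathrm{PW}(\mathbb{D})$ comprised of functions $f$ such that $\widehat{f}$ is smooth and compactly supported in $\mathbb{D}$. The operator $\mathbf{H}_\varphi$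 depends only on the restriction of $\widehat{\varphi}$ to $2\mathbb{D}$. One says that $\mathbf{H}_\varphi$ has a bounded symbol if there is $\psi \in L^\infty(\mathbb{R}^2)$ such that the restrictions of $\widehat{\psi}$ and $\widehat{\varphi}$ to $2\mathbb{D}$ coincide as distributions in $2\mathbb{D}$. *)

(* Defs.v *)
From HB Require Import structures.
From mathcomp Require Import all_boot all_order all_algebra.
From mathcomp Require Import all_classical all_reals all_analysis.
From mathcomp Require Import complex.

Set Implicit Arguments.
Unset Strict Implicit.
Unset Printing Implicit Defensive.

Import Order.TTheory GRing.Theory Num.Theory.
Import numFieldNormedType.Exports.

Local Open Scope classical_set_scope.
Local Open Scope ring_scope.
Local Open Scope complex_scope.

Section Defs.
Variable R : realType.

Local Notation plane := (R * R)%type.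
Local Notation C := R[i].

(* The norm that the library puts on [R * R] is the maximum norm, hence a
   separate Euclidean one. *)
Definition dot (x y : plane) : R := x.1 * y.1 + x.2 * y.2.
Definition enorm (x : plane) : R := Num.sqrt (dot x x).
Definition disc (r : R) : set plane := [set x | enorm x < r].
Definition cdisc (r : R) : set plane := [set x | enorm x <= r].

Definition leb2 : {measure set (measurableTypeR R * measurableTypeR R) -> \bar R}
  := (@lebesgue_measure R \x @lebesgue_measure R)%E.

Definition cintegral (f : plane -> C) : C :=
  Rintegral leb2 setT (fun x => complex.Re (f x))
  +i* Rintegral leb2 setT (fun x => complex.Im (f x)).

Definition cmeasurable (f : plane -> C) : Prop :=
  measurable_fun [set: measurableTypeR R * measurableTypeR R]
    (fun x => complex.Re (f x) : measurableTypeR R) /\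
  measurable_fun [set: measurableTypeR R * measurableTypeR R]
    (fun x => complex.Im (f x) : measurableTypeR R).

Definition cLnorm (p : \bar R) (f : plane -> C) : \bar R :=
  Lnorm leb2 p (fun x => (Normc.normc (f x))%:E).

Definition cLp (p : \bar R) (f : plane -> C) : Prop :=
  cmeasurable f /\ (cLnorm p f < +oo)%E.

Definition axis (b : bool) : R^o * R^o := if b then (0, 1) else (1, 0).

(* [partial w f] is the iterated partial derivative of [f] along the word
   [w], the last letter of [w] being differentiated first. *)
Fixpoint partial (w : seq bool) (f : plane -> R) : plane -> R :=
  if w is b :: w' then
    fun x => derive (partial w' f : R^o * R^o -> R^o) x (axis b)
  else f.

Definition smoothR (f : plane -> R) : Prop :=
  forall w : seq bool,
    continuous (partial w f : R^o * R^o -> R^o) /\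
    (forall x b, derivable (partial w f : R^o * R^o -> R^o) x (axis b)).

Definition smooth (f : plane -> C) : Prop :=
  smoothR (fun x => complex.Re (f x)) /\ smoothR (fun x => complex.Im (f x)).

Definition cpartial (w : seq bool) (f : plane -> C) (x : plane) : C :=
  partial w (fun y => complex.Re (f y)) x
  +i* partial w (fun y => complex.Im (f y)) x.

Definition schwartz (f : plane -> C) : Prop :=
  smooth f /\
  forall (N : nat) (w : seq bool), exists M : R,
    forall x, (1 + enorm x) ^+ N * Normc.normc (cpartial w f x) <= M.

Definition schwartz_seminorm (N : nat) (f : plane -> C) : R :=
  sup [set r | exists (w : seq bool) (x : plane), (size w <= N)%N /\
         r = (1 + enorm x) ^+ N * Normc.normc (cpartial w f x)].

Definition test_function (U : set plane) (f : plane -> C) : Prop :=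
  let supp := closure [set x : plane | f x != 0] in
  [/\ smooth f, compact supp & supp `<=` U].

(* A tempered distribution is carried by a functional on all functions, of
   which only the values on Schwartz functions are relevant. *)
Definition tempered (u : (plane -> C) -> C) : Prop :=
  (forall (c : C) f g, schwartz f -> schwartz g ->
     u (fun x => c * f x + g x) = c * u f + u g) /\
  (exists (K : R) (N : nat), forall f, schwartz f ->
     Normc.normc (u f) <= K * schwartz_seminorm N f).

Definition dist_of (f g : plane -> C) : C := cintegral (fun x => f x * g x).

Definition expi (t : R) : C := cos t +i* sin t.

Definition fourier (f : plane -> C) (xi : plane) : C :=
  cintegral (fun x => f x * expi (- (2 * pi * dot x xi))).

Definition fourier_dist (u : (plane -> C) -> C) (g : plane -> C) : C :=
  u (fourier g).

(* The distributional Fourier transform of [f] is the function [F]. *)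
Definition has_fourier (f F : plane -> C) : Prop :=
  forall g, schwartz g -> fourier_dist (dist_of f) g = dist_of F g.

Definition dist_supported (K : set plane) (u : (plane -> C) -> C) : Prop :=
  forall g, test_function (~` K) g -> u g = 0.

(* Elements of L^2 are represented by functions, not classes. *)
Definition PW (f : plane -> C) : Prop :=
  cLp 2%:E f /\ dist_supported (cdisc 1) (fourier_dist (dist_of f)).

(* With [F] the Fourier transform of [f], the pairing of [F] with
   xi |-> phi^(xi + eta) is that of phi^ with zeta |-> F (zeta - eta).
   Pairings are bilinear: no conjugation. *)
Definition hankel_hat (phi : (plane -> C) -> C) (F : plane -> C)
    (eta : plane) : C :=
  if enorm eta < 1 then
    fourier_dist phi (fun zeta => F (zeta.1 - eta.1, zeta.2 - eta.2))
  else 0.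

Definition hankel_domain (f : plane -> C) : Prop :=
  PW f /\ exists F, test_function (disc 1) F /\ has_fourier f F.

(* [h] represents the image of [f] under the Hankel operator; [F] is uniquely
   determined by [f], and [h] is so up to a null set. *)
Definition hankel_image (phi : (plane -> C) -> C) (f h : plane -> C) : Prop :=
  PW h /\
  exists F, [/\ test_function (disc 1) F, has_fourier f F &
                has_fourier h (hankel_hat phi F)].

Definition bounded_operator_PW (A : (plane -> C) -> (plane -> C)) : Prop :=
  [/\ forall f, PW f -> PW (A f),
      forall (c : C) f g, PW f -> PW g ->
        {ae leb2, forall x,
           A (fun y => c * f y + g y) x = c * A f x + A g x} &
      exists K : R, forall f, PW f ->
        (cLnorm 2%:E (A f) <= K%:E * cLnorm 2%:E f)%E].

Definition hankel_extends_bounded (phi : (plane -> C) -> C) : Prop :=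
  exists A, bounded_operator_PW A /\
    forall f, hankel_domain f -> hankel_image phi f (A f).

Definition has_bounded_symbol (phi : (plane -> C) -> C) : Prop :=
  exists psi : plane -> C, cLp +oo%E psi /\
    forall g, test_function (disc 2) g ->
      fourier_dist (dist_of psi) g = fourier_dist phi g.

End Defs.

(* Main.v *)
(* Take for phi the inverse Fourier transform of
   [\sum_n (delta_(node n) - delta_(rim n))], where the [rim n] lie on the circle
   of radius 2 and the [node n] slightly inside it, both tending to (0, 2). The
   masses on the circle are invisible in the disc of radius 2 and make the series
   converge, because [node n - rim n] is summable. On the Fourier side the Hankel
   operator maps [F] to the sum over [n] of [F (node n - eta)], restricted to the
   lens of the [eta] such that [eta] and [node n - eta] are both in the unit disc.
   The nodes are so close to the circle that the lenses are pairwise disjoint, so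
   that the operator is the restriction to their union of the composition with a
   measure-preserving involution, hence a contraction. If psi were a bounded
   symbol, then [\sum_n g (node n)] would be at most the sup norm of psi times the
   L^1 norm of the Fourier transform of [g], for every test function [g] on the disc
   of radius 2; a sum of [N] equal bumps at the first [N] nodes, with disjoint
   supports, makes the former of order [N] and the latter of order [N^(1/2)]. *)

Require Import Defs.
From HB Require Import structures.
From mathcomp Require Import all_boot all_order all_algebra.
From mathcomp Require Import all_classical all_reals all_analysis.
From mathcomp Require Import measurable_realfun ess_sup_inf complex ring lra.

Set Implicit Arguments.
Unset Strict Implicit.
Unset Printing Implicit Defensive.

Import Order.TTheory GRing.Theory Num.Theory.
Import numFieldNormedType.Exports.

Local Open Scope classical_set_scope.
Local Open Scope ring_scope.
Local Open Scope complex_scope.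

Local Notation Re := complex.Re.
Local Notation Im := complex.Im.
Local Notation normc := Normc.normc.
Local Notation "z ^*" := (conjc z) : ring_scope.
Local Notation normcM := ComplexField.Normc.normcM.
Local Notation normc0 := ComplexField.Normc.normc0.
Local Notation normc1 := ComplexField.Normc.normc1.
Local Notation eq0_normc := ComplexField.Normc.eq0_normc.

(** * Complex-valued integrals *)

Section complex_modulus.
Context {R : realType}.
Implicit Types z w : R[i].

(** The curvature of the circle separates the lenses. A point of squared norm [4 - d] has a lens of
    half-length [sqrt d / 2], almost tangent to the circle; with [d = absc n ^+ 2 / 16] it is
    [absc n / 8], so depths of order [absc n ^+ 2] are compatible with abscissas that merely halve.
    The tiles around the first [N] nodes have to be exponentially small, so the L^1 bound must not
    depend on their size [r]. It comes from Cauchy-Schwarz with a weight adapted to the scale [r]: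
    the factor [r^2] in the energy of a tile cancels the [r^-2] from the weight, and disjoint
    supports leave only the number of tiles. Elements of [PW] are merely square integrable, and
    [has_fourier] is tested on Schwartz functions alone. The operator is therefore an integral
    operator on the space side; its norm, range and Fourier transform are read off from duality with
    integrable functions, using Plancherel only as an inequality, together with pointwise inversion.
    Restricting to the lenses and composing with [flip] destroys smoothness, so transported test
    functions are approximated by smooth ones. *)

Lemma cReM z w : Re (z * w) = Re z * Re w - Im z * Im w.
Proof. by case: z; case: w. Qed.
Lemma cImM z w : Im (z * w) = Re z * Im w + Im z * Re w.
Proof. by case: z; case: w. Qed.
Lemma cReD z w : Re (z + w) = Re z + Re w.
Proof. by case: z; case: w. Qed.
Lemma cImD z w : Im (z + w) = Im z + Im w.
Proof. by case: z; case: w. Qed.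
Lemma cReN z : Re (- z) = - Re z.
Proof. by case: z. Qed.
Lemma cImN z : Im (- z) = - Im z.
Proof. by case: z. Qed.

Lemma complexP z w : Re z = Re w -> Im z = Im w -> z = w.
Proof. by case: z; case: w => a b c d /= -> ->. Qed.

Lemma normc_sqr z : normc z ^+ 2 = Re z ^+ 2 + Im z ^+ 2.
Proof. by case: z => a b /=; rewrite sqr_sqrtr// addr_ge0// sqr_ge0. Qed.

Lemma normcE z : normc z = Num.sqrt (Re z ^+ 2 + Im z ^+ 2).
Proof. by case: z. Qed.

Lemma normc_ge0 z : 0 <= normc z.
Proof. by case: z => a b /=; exact: sqrtr_ge0. Qed.

Lemma Re_le_normc z : `|Re z| <= normc z.
Proof.
rewrite -(@ler_pXn2r _ 2)// ?nnegrE ?normc_ge0// normc_sqr.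
by rewrite real_normK ?num_real// lerDl sqr_ge0.
Qed.

Lemma Im_le_normc z : `|Im z| <= normc z.
Proof.
rewrite -(@ler_pXn2r _ 2)// ?nnegrE ?normc_ge0// normc_sqr.
by rewrite real_normK ?num_real// lerDr sqr_ge0.
Qed.

Lemma normc_le_ReIm z : normc z <= `|Re z| + `|Im z|.
Proof.
rewrite -(@ler_pXn2r _ 2)// ?nnegrE ?normc_ge0// ?addr_ge0// normc_sqr.
rewrite sqrrD !real_normK ?num_real//.
have := mulr_ge0 (normr_ge0 (Re z)) (normr_ge0 (Im z)); lra.
Qed.

Lemma normc_conj z : normc (z^*) = normc z.
Proof. by case: z => a b /=; rewrite sqrrN. Qed.

Lemma Re_mulconj z : Re (z * z^*) = normc z ^+ 2.
Proof. by rewrite normc_sqr; case: z => a b /=; ring. Qed.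

Lemma normc_real (a : R) : normc (a%:C) = `|a|.
Proof. by rewrite /= expr0n addr0 sqrtr_sqr. Qed.

Lemma conjcM z w : (z * w)^* = z^* * w^*.
Proof. exact: (rmorphM (@conjc R)). Qed.

End complex_modulus.

Section complex_integral.
Context d (T : measurableType d) (R : realType).
Variable mu : {measure set T -> \bar R}.
Implicit Types f g : T -> R[i].

Lemma integrable_scale (k : R) (g : T -> R) : mu.-integrable setT (EFin \o g) ->
  mu.-integrable setT (EFin \o (fun x => k * g x)).
Proof.
by move=> Ig; under [_ \o _]eq_fun do rewrite /= EFinM; exact: integrableZl.
Qed.

Definition cmeas f : Prop :=
  measurable_fun setT (fun x => Re (f x)) /\
  measurable_fun setT (fun x => Im (f x)).

Definition cinteg f : Prop :=
  mu.-integrable setT (fun x => (Re (f x))%:E) /\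
  mu.-integrable setT (fun x => (Im (f x))%:E).

Definition cI f : R[i] :=
  Rintegral mu setT (fun x => Re (f x)) +i* Rintegral mu setT (fun x => Im (f x)).

Lemma Re_cI f : Re (cI f) = Rintegral mu setT (fun x => Re (f x)).
Proof. by []. Qed.

Lemma Im_cI f : Im (cI f) = Rintegral mu setT (fun x => Im (f x)).
Proof. by []. Qed.

Lemma cmeas_cinteg f : cinteg f -> cmeas f.
Proof.
by move=> [/integrableP[+ _] /integrableP[+ _]];
  split; exact/measurable_EFinP.
Qed.

Lemma measurable_continuous_comp (h : R -> R) (u : T -> R) : continuous h ->
  measurable_fun setT u -> measurable_fun setT (fun x => h (u x)).
Proof.
move=> ch mu'; apply: (@measurableT_comp _ _ _ _ _ _ h) => //.
exact: continuous_measurable_fun.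
Qed.

Lemma cmeas_normc f : cmeas f -> measurable_fun setT (fun x => normc (f x)).
Proof.
move=> [mr mi]; under eq_fun do rewrite normcE.
apply: measurable_continuous_comp; first exact: sqrt_continuous.
by apply: measurable_funD; exact: measurable_funX.
Qed.

Lemma cmeasM f g : cmeas f -> cmeas g -> cmeas (fun x => f x * g x).
Proof.
move=> [fr fi] [gr gi]; split.
  under eq_fun do rewrite cReM.
  by apply: measurable_funB; exact: measurable_funM.
under eq_fun do rewrite cImM.
by apply: measurable_funD; exact: measurable_funM.
Qed.

Lemma cmeasD f g : cmeas f -> cmeas g -> cmeas (fun x => f x + g x).
Proof.
move=> [fr fi] [gr gi]; split.
  by under eq_fun do rewrite cReD; exact: measurable_funD.
by under eq_fun do rewrite cImD; exact: measurable_funD.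
Qed.

Lemma cmeas_cst c : cmeas (fun _ : T => c).
Proof. by split; exact: measurable_cst. Qed.

Lemma cmeas_real (u : T -> R) : measurable_fun setT u -> cmeas (fun x => (u x)%:C).
Proof. by move=> mu'; split => //=; exact: measurable_cst. Qed.

Lemma cmeas_conj f : cmeas f -> cmeas (fun x => (f x)^*).
Proof.
move=> [fr fi]; split.
  by rewrite (_ : (fun x => _) = fun x => Re (f x))//; apply/funext => x; case: (f x).
rewrite (_ : (fun x => _) = fun x => - Im (f x)); first exact: measurableT_comp.
by apply/funext => x; case: (f x).
Qed.

Lemma cmeasN f : cmeas f -> cmeas (fun x => - f x).
Proof.
move=> [fr fi]; split.
  by under eq_fun do rewrite cReN; exact: measurableT_comp.
by under eq_fun do rewrite cImN; exact: measurableT_comp.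
Qed.

Lemma cinteg_normc f :
  cinteg f -> mu.-integrable setT (fun x => (normc (f x))%:E).
Proof.
move=> [ir ii].
have := integrableD measurableT (integrable_norm ir) (integrable_norm ii).
apply: le_integrable => //.
  apply/measurable_EFinP; apply: cmeas_normc; exact: (cmeas_cinteg (conj ir ii)).
move=> x _ /=; rewrite lee_fin ger0_norm ?normc_ge0//.
rewrite ger0_norm ?addr_ge0//; exact: normc_le_ReIm.
Qed.

Lemma le_cinteg f (g : T -> R) : cmeas f ->
  mu.-integrable setT (fun x => (g x)%:E) -> (forall x, normc (f x) <= g x) ->
  cinteg f.
Proof.
move=> [mr mi] ig fg; split.
  apply: le_integrable ig => //; first exact/measurable_EFinP.
  move=> x _ /=; rewrite lee_fin (le_trans (Re_le_normc _))//.
  by rewrite (le_trans (fg x))// ler_norm.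
apply: le_integrable ig => //; first exact/measurable_EFinP.
move=> x _ /=; rewrite lee_fin (le_trans (Im_le_normc _))//.
by rewrite (le_trans (fg x))// ler_norm.
Qed.

Lemma cintegP f : cmeas f ->
  ((\int[mu]_x (normc (f x))%:E < +oo)%E) -> cinteg f.
Proof.
move=> mf fo; apply: (@le_cinteg f (fun x => normc (f x))) => //.
apply/integrableP; split; first exact/measurable_EFinP/cmeas_normc.
by under eq_integral do rewrite /= ger0_norm ?normc_ge0//.
Qed.

Lemma cinteg_lty f : cinteg f -> (\int[mu]_x (normc (f x))%:E < +oo)%E.
Proof.
move=> /cinteg_normc/integrableP[_].
by under eq_integral do rewrite /= ger0_norm ?normc_ge0//.
Qed.

Lemma cintegD f g : cinteg f -> cinteg g -> cinteg (fun x => f x + g x).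
Proof.
move=> [fr fi] [gr gi]; split.
  by under eq_fun do rewrite cReD EFinD; exact: integrableD.
by under eq_fun do rewrite cImD EFinD; exact: integrableD.
Qed.

Lemma cintegMb f g (M : R) : cinteg f -> cmeas g ->
  (forall x, normc (g x) <= M) -> cinteg (fun x => f x * g x).
Proof.
move=> cf mg gM.
apply: (@le_cinteg _ (fun x => M * normc (f x))).
- by apply: cmeasM => //; exact: cmeas_cinteg.
- exact/integrable_scale/cinteg_normc.
- by move=> x; rewrite normcM mulrC ler_wpM2r ?normc_ge0.
Qed.

Lemma cintegZ f c : cinteg f -> cinteg (fun x => c * f x).
Proof.
move=> cf; under eq_fun do rewrite mulrC.
by apply: (@cintegMb _ _ (normc c)) => //; exact: cmeas_cst.
Qed.

Lemma cintegN f : cinteg f -> cinteg (fun x => - f x).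
Proof. by move=> cf; under eq_fun do rewrite -mulN1r; exact: cintegZ. Qed.

Lemma cintegB f g : cinteg f -> cinteg g -> cinteg (fun x => f x - g x).
Proof. by move=> cf cg; apply: cintegD => //; exact: cintegN. Qed.

Lemma cinteg_conj f : cinteg f -> cinteg (fun x => (f x)^*).
Proof.
move=> cf; apply: (@le_cinteg _ (fun x => normc (f x))).
- exact/cmeas_conj/cmeas_cinteg.
- exact: cinteg_normc.
- by move=> x; rewrite normc_conj.
Qed.

Lemma eq_cI f g : f =1 g -> cI f = cI g.
Proof. by move=> fg; congr cI; exact/funext. Qed.

Lemma cID f g : cinteg f -> cinteg g -> cI (fun x => f x + g x) = cI f + cI g.
Proof.
move=> [fr fi] [gr gi]; apply: complexP; rewrite ?(cReD, cImD) /=.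
  by under eq_Rintegral do rewrite cReD; rewrite RintegralD.
by under eq_Rintegral do rewrite cImD; rewrite RintegralD.
Qed.

Lemma cIZ f c : cinteg f -> cI (fun x => c * f x) = c * cI f.
Proof.
move=> [fr fi]; apply: complexP; rewrite ?(cReM, cImM) /=.
  under eq_Rintegral do rewrite cReM.
  by rewrite RintegralB ?RintegralZl//; exact: integrable_scale.
under eq_Rintegral do rewrite cImM.
by rewrite RintegralD ?RintegralZl//; exact: integrable_scale.
Qed.

Lemma cIN f : cinteg f -> cI (fun x => - f x) = - cI f.
Proof.
by move=> cf; under eq_cI do rewrite -mulN1r; rewrite cIZ// mulN1r.
Qed.

Lemma cIB f g : cinteg f -> cinteg g -> cI (fun x => f x - g x) = cI f - cI g.
Proof. by move=> cf cg; rewrite cID ?cIN//; exact: cintegN. Qed.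

Lemma cI_conj f : cinteg f -> cI (fun x => (f x)^*) = (cI f)^*.
Proof.
move=> [fr fi]; apply: complexP => /=.
  by apply: eq_Rintegral => x _; case: (f x).
rewrite -mulN1r -RintegralZl//.
by apply: eq_Rintegral => x _; rewrite mulN1r; case: (f x).
Qed.

Lemma cI_real (u : T -> R) : cI (fun x => (u x)%:C) = (Rintegral mu setT u)%:C.
Proof.
apply: complexP => //=; rewrite Rintegral_cst//.
by rewrite mul0r.
Qed.

Lemma cI0 : cI (fun=> 0) = 0.
Proof. by rewrite cI_real Rintegral_cst// mul0r. Qed.

(** The integral is rotated by its own conjugate: [normc (cI f) ^+ 2] is the real part of the
    integral of [(cI f)^* * f], hence at most [normc (cI f)] times the integral of the modulus. *)
Lemma normc_cI_le f : cinteg f ->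
  normc (cI f) <= Rintegral mu setT (fun x => normc (f x)).
Proof.
move=> cf; have [/eqP I0|I0] := boolP (normc (cI f) == 0).
  by rewrite I0; apply: Rintegral_ge0 => x _; exact: normc_ge0.
have Ipos : 0 < normc (cI f) by rewrite lt_neqAle eq_sym I0 normc_ge0.
rewrite -(ler_pM2l Ipos) -expr2 -Re_mulconj mulrC -cIZ// Re_cI.
rewrite -RintegralZl//; last exact: cinteg_normc.
apply: le_Rintegral => //.
- by have [] := cintegZ (cI f)^* cf.
- exact/integrable_scale/cinteg_normc.
- move=> x _; rewrite (le_trans (ler_norm _))// (le_trans (Re_le_normc _))//.
  by rewrite normcM normc_conj.
Qed.

Lemma normc_cI_le_fin f : cinteg f ->
  ((normc (cI f))%:E <= \int[mu]_x (normc (f x))%:E)%E.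
Proof.
move=> cf; have := normc_cI_le cf; rewrite -lee_fin => /le_trans; apply.
rewrite fineK// ge0_fin_numE ?cinteg_lty//.
by apply: integral_ge0 => x _; rewrite lee_fin normc_ge0.
Qed.

Lemma cI_dominated (f_ : (T -> R[i])^nat) f (g : T -> R) :
  (forall n, cmeas (f_ n)) -> cmeas f ->
  mu.-integrable setT (fun x => (g x)%:E) ->
  (forall n x, normc (f_ n x) <= g x) ->
  (forall x, normc (f_ n x - f x) @[n --> \oo] --> (0 : R)) ->
  normc (cI (f_ n) - cI f) @[n --> \oo] --> (0 : R).
Proof.
move=> mf_ mf ig fg cvf.
(* The majorant passes to the pointwise limit, so [f] is integrable and [2 * g] dominates the
   differences. *)
have fle x : normc (f x) <= g x.
  have : normc (f x) <= g x + limn (fun n => normc (f_ n x - f x)).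
    rewrite -lerBlDl; apply: limr_ge; first by apply/cvg_ex; exists 0; exact: cvf.
    apply: nearW => n; rewrite lerBlDl (le_trans _ (lerD (fg n x) (lexx _)))//.
    rewrite -{1}(subrK (f_ n x) (f x)) addrC (le_trans (le_normcD _ _))//.
    by rewrite lerD2l -normcN opprB.
  by rewrite (cvg_lim _ (cvf x))// addr0.
have If n : cinteg (f_ n) by apply: le_cinteg ig _ => //.
have I : cinteg f by apply: le_cinteg ig _ => //.
have IB n : cinteg (fun x => f_ n x - f x) by exact: cintegB.
have lim0 : (Rintegral mu setT (fun x => normc (f_ n x - f x))) @[n --> \oo] --> (0 : R).
  have i2g : mu.-integrable setT (EFin \o (fun x => 2 * g x)).
    exact: integrable_scale.
  have [|||||_ _] := @dominated_convergence _ _ _ mu setT measurableT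
    (fun n x => (normc (f_ n x - f x))%:E) (cst 0%E) (EFin \o (fun x => 2 * g x)).
  - by move=> n; apply/measurable_EFinP/cmeas_normc/cmeas_cinteg.
  - exact: measurable_cst.
  - by apply: nearW => x _; apply/fine_cvgP; split; [exact: nearW|exact: cvf].
  - by [].
  - apply: nearW => x n _ /=; rewrite lee_fin ger0_norm ?normc_ge0//.
    rewrite (le_trans (le_normcD _ _))// normcN mulr2n mulrDl !mul1r.
    by rewrite lerD.
  rewrite integral0 => /fine_cvgP[_]; exact.
apply: squeeze_cvgr (cvg_cst 0) lim0; apply: nearW => n.
by apply/andP; split; [exact: normc_ge0|rewrite -cIB//; exact: normc_cI_le].
Qed.

End complex_integral.

Arguments cI : simpl never.
Arguments fourier : simpl never.

(** * Fubini's theorem and measure-preserving maps *)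

Lemma cmeas_comp d d' (T : measurableType d) (T' : measurableType d') (R : realType)
    (u : T' -> R[i]) (w : T -> T') :
  cmeas u -> measurable_fun setT w -> cmeas (fun x => u (w x)).
Proof.
by move=> [mr mi] mw; split; [exact: (measurableT_comp mr mw)|exact: (measurableT_comp mi mw)].
Qed.

Section fubini.
Context d1 d2 (T1 : measurableType d1) (T2 : measurableType d2) (R : realType).
Variables (m1 : {sigma_finite_measure set T1 -> \bar R})
  (m2 : {sigma_finite_measure set T2 -> \bar R}).

(** [Rintegral] applies [fine] to inner integrals that are finite only almost everywhere; the
    integrands with and without [fine] agree off a null set. *)
Lemma Rintegral_fubini1 (f : T1 * T2 -> R) :
  (m1 \x m2)%E.-integrable setT (EFin \o f) ->
  Rintegral m1 setT (fun x => Rintegral m2 setT (fun y => f (x, y))) =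
  Rintegral (m1 \x m2)%E setT f.
Proof.
move=> If; rewrite [RHS]/Rintegral -integral12_prod_meas1//; congr fine.
apply: ae_eq_integral => //.
- apply/measurable_EFinP; apply: measurableT_comp => //.
  exact: (measurable_fubini_F If).
- exact: (measurable_fubini_F If).
- have := integrable_ae measurableT (integrable_fubini_F If).
  by apply: filterS => x /= /(_ I) fin _; rewrite fineK.
Qed.

Lemma Rintegral_fubini2 (f : T1 * T2 -> R) :
  (m1 \x m2)%E.-integrable setT (EFin \o f) ->
  Rintegral m2 setT (fun y => Rintegral m1 setT (fun x => f (x, y))) =
  Rintegral (m1 \x m2)%E setT f.
Proof.
move=> If; rewrite [RHS]/Rintegral -integral21_prod_meas1//; congr fine.
apply: ae_eq_integral => //.
- apply/measurable_EFinP; apply: measurableT_comp => //.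
  exact: (measurable_fubini_G If).
- exact: (measurable_fubini_G If).
(* The partial integral is dominated by that of the modulus, whose own integral is finite by
   Tonelli. *)
- have : m2.-integrable setT (fubini_G m1 (EFin \o f)).
    apply/integrableP; split; first exact: (measurable_fubini_G If).
    have := (integrable21ltyP m1 m2 (measurable_int _ If)).1 If.
    apply: le_lt_trans; apply: ge0_le_integral => //.
    + by apply: measurableT_comp => //; exact: (measurable_fubini_G If).
    + apply: (measurable_fun_fubini_tonelli_G (abse \o (EFin \o f))) => //=.
      by apply: measurableT_comp => //; exact: (measurable_int _ If).
    + move=> y _; apply: le_abse_integral => //.
      have /measurable_EFinP mf := measurable_int _ If.
      by apply/measurable_EFinP; exact: (measurableT_comp mf (pair2_measurable y)).
  move=> /(integrable_ae measurableT).
  by apply: filterS => x /= /(_ I) fin _; rewrite fineK.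
Qed.

Lemma cI_fubini (K : T1 * T2 -> R[i]) : cinteg (m1 \x m2)%E K ->
  cI m1 (fun x => cI m2 (fun y => K (x, y))) =
  cI m2 (fun y => cI m1 (fun x => K (x, y))).
Proof.
move=> [Kr Ki]; apply: complexP => /=.
  by rewrite (Rintegral_fubini1 Kr) -(Rintegral_fubini2 Kr).
by rewrite (Rintegral_fubini1 Ki) -(Rintegral_fubini2 Ki).
Qed.

Lemma cmeas_fubini (K : T1 * T2 -> R[i]) : cinteg (m1 \x m2)%E K ->
  cmeas (fun x => cI m2 (fun y => K (x, y))).
Proof.
move=> [Kr Ki]; split => /=; apply: measurableT_comp => //.
- exact: (measurable_fubini_F Kr).
- exact: (measurable_fubini_F Ki).
Qed.

Lemma cinteg_fubini (K : T1 * T2 -> R[i]) : cinteg (m1 \x m2)%E K ->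
  cinteg m1 (fun x => cI m2 (fun y => K (x, y))).
Proof.
move=> IK; apply: cintegP; first exact: cmeas_fubini.
have mK : measurable_fun setT (fun z => (normc (K z))%:E).
  exact/measurable_EFinP/cmeas_normc/(cmeas_cinteg IK).
have K0 z : (0 <= (normc (K z))%:E)%E by rewrite lee_fin normc_ge0.
have := cinteg_lty IK; rewrite fubini_tonelli1//; apply: le_lt_trans.
apply: ge0_le_integral => //.
- by move=> x _; rewrite lee_fin normc_ge0.
- exact/measurable_EFinP/cmeas_normc/cmeas_fubini.
- exact: measurable_fun_fubini_tonelli_F.
- move=> x _; rewrite /fubini_F.
  (* Where the inner integral of the modulus is infinite the bound is trivial, so no null set has to
     be removed. *)
  have [fin|] := ltP (\int[m2]_y (normc (K (x, y)))%:E)%E +oo%E.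
    apply: normc_cI_le_fin; apply: cintegP => //.
    exact: (cmeas_comp (cmeas_cinteg IK) (pair1_measurable x)).
  by rewrite leye_eq => /eqP ->; rewrite leey.
Qed.

Lemma integrable_prod_mul (a : T1 -> R) (b : T2 -> R) :
  m1.-integrable setT (EFin \o a) -> m2.-integrable setT (EFin \o b) ->
  (m1 \x m2)%E.-integrable setT (EFin \o (fun z => a z.1 * b z.2)).
Proof.
move=> Ia Ib.
have ma : measurable_fun setT a by exact/measurable_EFinP/(measurable_int _ Ia).
have mb : measurable_fun setT b by exact/measurable_EFinP/(measurable_int _ Ib).
apply/integrable12ltyP.
  apply/measurable_EFinP; apply: measurable_funM.
    by apply: measurableT_comp => //; exact: measurable_fst.
  by apply: measurableT_comp => //; exact: measurable_snd.
have Eb x : (\int[m2]_y `|(a x * b y)%:E| = `|a x|%:E * \int[m2]_y `|(b y)%:E|)%E.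
  rewrite -ge0_integralZl//; last by do 2 apply: measurableT_comp => //.
  by apply: eq_integral => y _; rewrite /= normrM EFinM.
rewrite /=; under eq_integral do rewrite Eb.
rewrite ge0_integralZr//; last 2 first.
- by apply: measurableT_comp => //; exact: measurableT_comp.
- exact: integral_ge0.
apply: lte_mul_pinfty.
- exact: integral_ge0.
- rewrite ge0_fin_numE; last exact: integral_ge0.
  by case/integrableP : Ia.
- by case/integrableP : Ib.
Qed.

Lemma Rintegral_prod_mul (a : T1 -> R) (b : T2 -> R) :
  m1.-integrable setT (EFin \o a) -> m2.-integrable setT (EFin \o b) ->
  Rintegral (m1 \x m2)%E setT (fun z => a z.1 * b z.2) =
  Rintegral m1 setT a * Rintegral m2 setT b.
Proof.
move=> Ia Ib; rewrite -Rintegral_fubini1; last exact: integrable_prod_mul.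
rewrite -RintegralZr//; apply: eq_Rintegral => x _ /=.
by rewrite RintegralZl.
Qed.

Lemma cmeas_fst (u : T1 -> R[i]) : cmeas u -> cmeas (fun z : T1 * T2 => u z.1).
Proof. by move=> mu; exact: (cmeas_comp mu measurable_fst). Qed.

Lemma cmeas_snd (u : T2 -> R[i]) : cmeas u -> cmeas (fun z : T1 * T2 => u z.2).
Proof. by move=> mu; exact: (cmeas_comp mu measurable_snd). Qed.

Lemma cinteg_kernel (u : T1 -> R[i]) (v : T2 -> R[i]) (k : T1 * T2 -> R[i]) (M : R) :
  cinteg m1 u -> cinteg m2 v -> cmeas k -> (forall z, normc (k z) <= M) ->
  cinteg (m1 \x m2)%E (fun z => u z.1 * (v z.2 * k z)).
Proof.
move=> Iu Iv mk kM; apply: (@le_cinteg _ _ _ _ _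
    (fun z => M * (normc (u z.1) * normc (v z.2)))).
- apply: cmeasM; first exact/cmeas_fst/(cmeas_cinteg Iu).
  by apply: cmeasM => //; exact/cmeas_snd/(cmeas_cinteg Iv).
- apply: integrable_scale.
  apply: (@integrable_prod_mul (fun x => normc (u x)) (fun y => normc (v y))).
    exact: cinteg_normc.
  exact: cinteg_normc.
- move=> z; rewrite !normcM mulrA mulrC.
  by rewrite ler_wpM2r// mulr_ge0// normc_ge0.
Qed.

(** The form in which Fubini's theorem is applied to Fourier integrals: two integrable functions
    coupled by a bounded kernel, typically a character. *)
Lemma cI_swap (u : T1 -> R[i]) (v : T2 -> R[i]) (k : T1 * T2 -> R[i]) (M : R) :
  cinteg m1 u -> cinteg m2 v -> cmeas k -> (forall z, normc (k z) <= M) ->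
  cI m1 (fun x => u x * cI m2 (fun y => v y * k (x, y))) =
  cI m2 (fun y => v y * cI m1 (fun x => u x * k (x, y))).
Proof.
move=> Iu Iv mk kM; have IK := cinteg_kernel Iu Iv mk kM.
have mk1 x : cmeas (fun y => k (x, y)) := cmeas_comp mk (pair1_measurable x).
have mk2 y : cmeas (fun x => k (x, y)) := cmeas_comp mk (pair2_measurable y).
transitivity (cI m1 (fun x => cI m2 (fun y => u x * (v y * k (x, y))))).
  apply: eq_cI => x; rewrite cIZ//.
  by apply: (cintegMb Iv (mk1 x) (M := M)) => y; exact: kM.
rewrite (cI_fubini IK) /=; apply: eq_cI => y.
under eq_cI do rewrite mulrCA.
by rewrite cIZ//; apply: (cintegMb Iu (mk2 y) (M := M)) => x; exact: kM.
Qed.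

End fubini.

Section measure_preserving.
Context d (T : measurableType d) (R : realType).
Variable mu : {measure set T -> \bar R}.

(** Phrased through integrals of nonnegative functions rather than measures of preimages: this is
    what a change of variables uses, and it can be checked piece by piece for a map such as
    [flip]. *)
Definition measure_preserving (phi : T -> T) : Prop :=
  measurable_fun setT phi /\
  forall f : T -> \bar R, measurable_fun setT f -> (forall x, (0 <= f x)%E) ->
    (\int[mu]_x f (phi x) = \int[mu]_x f x)%E.

Lemma integral_measure_preserving phi (f : T -> \bar R) : measure_preserving phi ->
  measurable_fun setT f -> (\int[mu]_x f (phi x) = \int[mu]_x f x)%E.
Proof.
move=> [mphi fE] mf; rewrite integralE [RHS]integralE.
rewrite -(fE _ (measurable_funepos mf))// -(fE _ (measurable_funeneg mf))//.
by rewrite -[fun x0 => f (phi x0)]/(f \o phi) funepos_comp funeneg_comp.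
Qed.

Lemma cmeas_measure_preserving phi (f : T -> R[i]) : measure_preserving phi ->
  cmeas f -> cmeas (fun x => f (phi x)).
Proof. by move=> [mphi _] mf; exact: cmeas_comp mf mphi. Qed.

Lemma cI_measure_preserving phi (f : T -> R[i]) : measure_preserving phi ->
  cmeas f -> cI mu (fun x => f (phi x)) = cI mu f.
Proof.
move=> mp [mr mi]; apply: complexP => /=; congr fine.
  by rewrite (integral_measure_preserving (f := fun x => (Re (f x))%:E))//;
    exact/measurable_EFinP.
by rewrite (integral_measure_preserving (f := fun x => (Im (f x))%:E))//;
  exact/measurable_EFinP.
Qed.

End measure_preserving.

Section lebesgue_reflection.
Context {R : realType}.
Local Notation mT := (measurableTypeR R).
Local Notation lm := (@lebesgue_measure R).

Lemma measurable_reflection (a : R) : measurable_fun [set: mT] (fun t : mT => a - t : mT).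
Proof. by apply: measurable_funB. Qed.

Lemma lebesgue_measure_reflection (a : R) (A : set mT) : measurable A ->
  pushforward lm (fun t : mT => a - t : mT) A = lm A.
Proof.
have mr := measurable_reflection a.
move=> mA; apply/esym/lebesgue_measure_unique => //= _ [[b c]] _ <-.
rewrite /pushforward (_ : _ @^-1` _ = `[a - c, a - b[%classic); last first.
  apply/seteqP; split => t /=; rewrite !in_itv/= => /andP[h1 h2]; apply/andP; split; lra.
rewrite !lebesgue_measure_itv/= !lte_fin.
have -> : (a - c < a - b) = (b < c) by apply/idP/idP; lra.
by case: ifP => // _; rewrite -!EFinD; congr EFin; ring.
Qed.

Lemma reflection_preserving (a : R) :
  measure_preserving lm (fun t : mT => a - t : mT).
Proof.
split; first exact: measurable_reflection.
move=> f mf f0.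
have := @ge0_integral_pushforward _ _ mT mT R (fun t : mT => a - t : mT)
  (measurable_reflection a) lm setT f measurableT mf (fun y _ => f0 y).
rewrite preimage_setT => <-; apply: eq_measure_integral => [|mphi A mA _].
  exact: measurable_reflection.
exact: lebesgue_measure_reflection.
Qed.

(** The half-turn about [a / 2]. It serves both as the difference [a - x] in convolutions and as the
    symmetry of a lens. *)
Definition refl2 (a x : mT * mT) : mT * mT := (a.1 - x.1, a.2 - x.2).

Lemma measurable_refl2 a : measurable_fun setT (refl2 a).
Proof.
apply/measurable_fun_pairP; split.
  apply: (measurableT_comp (measurable_reflection a.1)); exact: measurable_fst.
apply: (measurableT_comp (measurable_reflection a.2)); exact: measurable_snd.
Qed.

Lemma refl2_preserving a : measure_preserving (leb2 R) (refl2 a).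
Proof.
split; first exact: measurable_refl2.
move=> f mf f0.
rewrite fubini_tonelli1//; last exact: (measurableT_comp mf (measurable_refl2 a)).
rewrite [RHS]fubini_tonelli1//= /fubini_F /refl2/=.
rewrite -((reflection_preserving a.1).2 (fun x => \int[lm]_y f (x, y))%E); last 2 first.
- exact: (measurable_fun_fubini_tonelli_F f).
- by move=> x; exact: integral_ge0.
apply: eq_integral => x _.
rewrite -((reflection_preserving a.2).2 (fun y => f (a.1 - x, y)))//.
exact: (measurableT_comp mf (pair1_measurable _)).
Qed.

End lebesgue_reflection.

(** * The Poisson kernel *)

Section calculus.
Context {R : realType}.
Implicit Types (f g : R -> R) (x a b c : R).

Lemma is_derive_add f g x a b : is_derive x 1 f a -> is_derive x 1 g b ->
  is_derive x 1 (fun t => f t + g t) (a + b).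
Proof. by move=> *; exact: is_deriveD. Qed.

Lemma is_derive_mul f g x a b : is_derive x 1 f a -> is_derive x 1 g b ->
  is_derive x 1 (fun t => f t * g t) (f x * b + g x * a).
Proof. by move=> *; exact: is_deriveM. Qed.

Lemma is_derive_val f x a b : is_derive x 1 f a -> a = b -> is_derive x 1 f b.
Proof. by move=> + <-. Qed.

Lemma is_derive_const x c : is_derive x 1 (fun=> c) 0.
Proof. exact: is_derive_cst. Qed.

Lemma is_derive_scale f x a c : is_derive x 1 f a ->
  is_derive x 1 (fun t => c * f t) (c * a).
Proof. by move=> *; exact: is_deriveZ. Qed.

Lemma is_derive_lin x c : is_derive x 1 (fun t => c * t) c.
Proof.
by rewrite -[X in is_derive _ _ _ X]mulr1; apply: is_derive_scale; exact: is_derive_id.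
Qed.

Lemma is_derive_circ (h f : R -> R) x a b : is_derive (f x) 1 h b ->
  is_derive x 1 f a -> is_derive x 1 (fun t => h (f t)) (b * a).
Proof. by move=> *; exact: is_derive1_comp. Qed.

Lemma is_derive_continuous f (f' : R -> R) :
  (forall x, is_derive x 1 f (f' x)) -> continuous f.
Proof.
move=> df x; apply: differentiable_continuous; apply/derivable1_diffP.
by have [] := df x.
Qed.

Lemma integral_pinfty_FTC (f F : R -> R) (l : R) : (forall t, 0 <= t -> 0 <= f t) ->
  continuous f -> (forall t : R, is_derive t 1 F (f t)) -> F t @[t --> +oo] --> l ->
  (\int[lebesgue_measure]_(t in `[0%R, +oo[) (f t)%:E = l%:E - (F 0)%:E)%E.
Proof.
move=> f0 cf dF Fl; apply: ge0_continuous_FTC2y => //.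
- exact: continuous_subspaceT.
- by apply: cvg_at_right_filter; exact: (is_derive_continuous dF).
- by move=> t _; rewrite derive1E; have [_ ->] := dF t.
Qed.

Lemma cvgy_expR_bounded (B : R -> R) (e M : R) : 0 < e -> (forall t, `|B t| <= M) ->
  expR (- (e * t)) * B t @[t --> +oo] --> 0.
Proof.
move=> e0 BM.
have lim : expR (- (e * t)) @[t --> +oo] --> (0 : R).
  apply: (cvg_comp (fun t => e * t) (fun t => expR (- t))); last exact: cvgr_expR.
  by apply: gt0_cvgMry => //; exact: cvg_id.
have lim1 : M * expR (- (e * t)) @[t --> +oo] --> (0 : R).
  by rewrite -(mulr0 M); exact: cvgMl_tmp.
have lim2 : - (M * expR (- (e * t))) @[t --> +oo] --> (0 : R).
  by rewrite -oppr0; exact: cvgN.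
apply: squeeze_cvgr lim2 lim1; apply: nearW => t.
rewrite -ler_norml normrM ger0_norm ?expR_ge0// mulrC.
by rewrite ler_wpM2r ?expR_ge0.
Qed.

End calculus.

Section poisson_kernel.
Context {R : realType}.
Local Notation lm := (@lebesgue_measure R).
Implicit Types e w t a : R.

(** The summand 1 keeps the integrand nonnegative, as [integral_pinfty_FTC] asks; the cosine alone
    is recovered later by subtraction. *)
Lemma poisson_halfline e w : 0 < e ->
  (\int[lm]_(t in `[0%R, +oo[) (expR (- (e * t)) * (1 + cos (w * t)))%:E =
   (e^-1 + e / (e ^+ 2 + w ^+ 2))%:E)%E.
Proof.
move=> e0.
have D0 : 0 < e ^+ 2 + w ^+ 2 by rewrite ltr_pwDl ?sqr_ge0// exprn_gt0.
(* [expR (- (e * t)) * B t] is an antiderivative: the term [- e^-1] accounts for the summand 1, the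
   quotient for the cosine. *)
pose B t := - e^-1 + (w * sin (w * t) - e * cos (w * t)) / (e ^+ 2 + w ^+ 2).
have -> : (e^-1 + e / (e ^+ 2 + w ^+ 2))%:E =
    (0%:E - (expR (- (e * 0)) * B 0)%:E)%E.
  by rewrite -EFinB /B !mulr0 oppr0 expR0 sin0 cos0; congr EFin; field; lra.
apply: (integral_pinfty_FTC (F := fun t => expR (- (e * t)) * B t)).
- move=> t t0; rewrite mulr_ge0 ?expR_ge0// -lerBlDl sub0r; exact: cos_geN1.
- move=> t; apply: cvgM.
    apply: (continuous_comp (f := fun t => - (e * t))); last exact: continuous_expR.
    by apply: cvgN; apply: cvgMl_tmp; exact: cvg_id.
  apply: cvgD; first exact: cvg_cst.
  apply: (continuous_comp (f := fun t => w * t)); last exact: continuous_cos.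
  by apply: cvgMl_tmp; exact: cvg_id.
- move=> t.
  have dE : is_derive t 1 (fun t => expR (- (e * t))) (expR (- (e * t)) * - e).
    apply: (is_derive_circ (h := expR) (f := fun t => - (e * t))).
    under eq_fun do rewrite -mulNr; exact: is_derive_lin.
  have dB : is_derive t 1 B
      ((e ^+ 2 + w ^+ 2)^-1 * (w * (cos (w * t) * w) + - e * (- sin (w * t) * w))).
    rewrite -[X in is_derive _ _ _ X]add0r /B.
    apply: (is_derive_add (f := fun=> - e^-1)).
    under eq_fun do rewrite mulrC -mulNr.
    apply: is_derive_scale; apply: is_derive_add; apply: is_derive_scale.
      by apply: (is_derive_circ (h := sin)); exact: is_derive_lin.
    by apply: (is_derive_circ (h := cos)); exact: is_derive_lin.
  apply: (is_derive_val (is_derive_mul dE dB)).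
  by rewrite /B; field; lra.
- apply: (@cvgy_expR_bounded _ B e
    (e^-1 + (`|w| + e) / (e ^+ 2 + w ^+ 2))) => // t.
  have ie0 : 0 <= e^-1 by rewrite invr_ge0 ltW.
  have iD0 : 0 <= (e ^+ 2 + w ^+ 2)^-1 by rewrite invr_ge0 (ltW D0).
  rewrite /B (le_trans (ler_normD _ _))// normrN (ger0_norm ie0) lerD2l.
  rewrite normrM (ger0_norm iD0).
  rewrite ler_wpM2r ?invr_ge0 ?(ltW D0)// (le_trans (ler_normB _ _))// !normrM.
  rewrite (ger0_norm (ltW e0)) lerD//.
    by rewrite ler_piMr// sin_max.
  by rewrite ler_piMr ?(ltW e0)// cos_max.
Qed.

Lemma continuous_expabs e : continuous (fun t => expR (- (e * `|t|))).
Proof.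
move=> t; apply: (continuous_comp (f := fun t => - (e * `|t|))); last exact: continuous_expR.
by apply: cvgN; apply: cvgMl_tmp; exact: norm_continuous.
Qed.

Lemma continuous_coslin w : continuous (fun t => cos (w * t)).
Proof.
move=> t; apply: (continuous_comp (f := fun t => w * t)); last exact: continuous_cos.
by apply: cvgMl_tmp; exact: cvg_id.
Qed.

Lemma continuous_sinlin w : continuous (fun t => sin (w * t)).
Proof.
move=> t; apply: (continuous_comp (f := fun t => w * t)); last exact: continuous_sin.
by apply: cvgMl_tmp; exact: cvg_id.
Qed.

Lemma expabs_cos1 e w : 0 < e ->
  (\int[lm]_t (expR (- (e * `|t|)) * (1 + cos (w * t)))%:E =
   (2 * (e^-1 + e / (e ^+ 2 + w ^+ 2)))%:E)%E.
Proof.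
move=> e0; rewrite ge0_symfun_integralT.
- rewrite EFinM -(poisson_halfline w e0) -set_itvcy; congr (_ * _)%E.
  apply: eq_integral => t; rewrite inE/= in_itv/= andbT => t0.
  by rewrite ger0_norm.
- move=> t; rewrite mulr_ge0 ?expR_ge0// -lerBlDl sub0r; exact: cos_geN1.
- move=> t; apply: cvgM; first exact: continuous_expabs.
  by apply: cvgD; [exact: cvg_cst|exact: continuous_coslin].
- by move=> t /=; rewrite normrN mulrN cosN.
Qed.

Lemma integrable_expabs e : 0 < e ->
  lm.-integrable setT (EFin \o (fun t => expR (- (e * `|t|)))).
Proof.
move=> e0; have := expabs_cos1 0 e0; set c := (c in c%:E) => Ec.
have : lm.-integrable setT (EFin \o (fun t => expR (- (e * `|t|)) * (1 + cos (0 * t)))).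
  apply/integrableP; split.
    apply/measurable_EFinP; apply: continuous_measurable_fun => t; apply: cvgM.
      exact: continuous_expabs.
    by apply: cvgD; [exact: cvg_cst|exact: continuous_coslin].
  under eq_integral => t _.
    rewrite /= ger0_norm; last first.
      by rewrite mulr_ge0 ?expR_ge0// -lerBlDl sub0r; exact: cos_geN1.
    over.
  by rewrite Ec ltry.
apply: le_integrable => //.
  by apply/measurable_EFinP; apply: continuous_measurable_fun; exact: continuous_expabs.
move=> t _ /=; rewrite lee_fin mul0r cos0 normrM.
by rewrite ler_peMr// ger0_norm; lra.
Qed.

Lemma integrable_expabs_bounded e (B : R -> R) : 0 < e ->
  measurable_fun setT B -> (forall t, `|B t| <= 1) ->
  lm.-integrable setT (EFin \o (fun t => expR (- (e * `|t|)) * B t)).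
Proof.
move=> e0 mB B1; apply: le_integrable (integrable_expabs e0) => //.
  apply/measurable_EFinP; apply: measurable_funM => //.
  by apply: continuous_measurable_fun; exact: continuous_expabs.
by move=> t _ /=; rewrite lee_fin normrM ler_piMr.
Qed.

Lemma integrable_expabs_cos e w : 0 < e ->
  lm.-integrable setT (EFin \o (fun t => expR (- (e * `|t|)) * cos (w * t))).
Proof.
move=> e0; apply: integrable_expabs_bounded => // [|t]; last exact: cos_max.
by apply: continuous_measurable_fun; exact: continuous_coslin.
Qed.

Lemma integrable_expabs_sin e w : 0 < e ->
  lm.-integrable setT (EFin \o (fun t => expR (- (e * `|t|)) * sin (w * t))).
Proof.
move=> e0; apply: integrable_expabs_bounded => // [|t]; last exact: sin_max.
by apply: continuous_measurable_fun; exact: continuous_sinlin.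
Qed.

(** At frequency 0 the factor [1 + cos] equals 2, which yields the integral of the exponential
    alone; subtracting it from the value at [w] leaves the cosine. *)
Lemma Rintegral_expabs_cos e w : 0 < e ->
  Rintegral lm setT (fun t => expR (- (e * `|t|)) * cos (w * t)) =
  2 * e / (e ^+ 2 + w ^+ 2).
Proof.
move=> e0.
have S (v : R) : Rintegral lm setT (fun t => expR (- (e * `|t|)) * (1 + cos (v * t))) =
    2 * (e^-1 + e / (e ^+ 2 + v ^+ 2)).
  by rewrite /Rintegral expabs_cos1.
have D0 : 0 < e ^+ 2 + w ^+ 2 by rewrite ltr_pwDl ?sqr_ge0// exprn_gt0.
have S' (v : R) : Rintegral lm setT (fun t => expR (- (e * `|t|)) * (1 + cos (v * t))) =
    Rintegral lm setT (fun t => expR (- (e * `|t|))) +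
    Rintegral lm setT (fun t => expR (- (e * `|t|)) * cos (v * t)).
  rewrite -RintegralD//; first by apply: eq_Rintegral => t _; rewrite mulrDr mulr1.
    exact: integrable_expabs.
  exact: integrable_expabs_cos.
have := S' 0; rewrite S.
have -> : Rintegral lm setT (fun t => expR (- (e * `|t|)) * cos (0 * t)) =
    Rintegral lm setT (fun t => expR (- (e * `|t|))).
  by apply: eq_Rintegral => t _; rewrite mul0r cos0 mulr1.
move=> I0; have := S' w; rewrite S => /esym/(canRL (addKr _)) ->.
have -> : Rintegral lm setT (fun t => expR (- (e * `|t|))) = 2 / e.
  apply: (@mulfI _ 2) => //; rewrite mulr_natl mulr2n -I0.
  by field; lra.
by field; lra.
Qed.

Lemma Rintegral_expabs_sin e w : 0 < e ->
  Rintegral lm setT (fun t => expR (- (e * `|t|)) * sin (w * t)) = 0.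
Proof.
move=> e0; set I := LHS.
have IN : I = - I.
  rewrite /I -mulN1r -RintegralZl//; last exact: integrable_expabs_sin.
  rewrite /Rintegral; congr fine.
  rewrite -(integral_measure_preserving (reflection_preserving 0)
    (f := fun t : measurableTypeR R => (expR (- (e * `|t|)) * sin (w * t))%:E)) /=.
    by apply: eq_integral => t _; rewrite sub0r normrN mulrN sinN; congr EFin; ring.
  exact: measurable_int (integrable_expabs_sin w e0).
lra.
Qed.

(** The Fourier transform of the two-sided exponential of rate [e], that is, the Poisson kernel of
    the half-plane at height [e / (2 * pi)]. *)
Definition poisson e t : R := 2 * e / (e ^+ 2 + (2 * pi * t) ^+ 2).

Lemma poisson_den_gt0 e t : 0 < e -> 0 < e ^+ 2 + (2 * pi * t) ^+ 2.
Proof. by move=> e0; rewrite ltr_pwDl ?sqr_ge0// exprn_gt0. Qed.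

Lemma poisson_ge0 e t : 0 < e -> 0 <= poisson e t.
Proof.
by move=> e0; rewrite divr_ge0 ?mulr_ge0 ?(ltW e0)// ltW// poisson_den_gt0.
Qed.

Lemma continuous_poisson e : 0 < e -> continuous (poisson e).
Proof.
move=> e0 t; apply: cvgM; first exact: cvg_cst.
apply: cvgV; first by rewrite gt_eqF// poisson_den_gt0.
apply: cvgD; first exact: cvg_cst.
apply: (cvg_comp (fun t => 2 * pi * t) (fun x : R => x ^+ 2)).
  by apply: cvgMl_tmp; exact: cvg_id.
exact: exprn_continuous.
Qed.

Lemma integral_poisson0 e : 0 < e -> (\int[lm]_t (poisson e t)%:E = 1%:E)%E.
Proof.
move=> e0; have pi0 : 0 < pi :> R := pi_gt0 R.
rewrite ge0_symfun_integralT; last 3 first.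
- by move=> t; exact: poisson_ge0.
- exact: continuous_poisson.
- by move=> t /=; rewrite /poisson mulrN sqrrN.
have dF t : is_derive t 1 (fun t => pi^-1 * atan (2 * pi / e * t)) (poisson e t).
  apply: (is_derive_val (is_derive_scale _ (is_derive_circ
    (is_derive1_atan _) (is_derive_lin t (2 * pi / e))))).
  have D0 := poisson_den_gt0 t e0.
  rewrite /poisson; move: (pi : R) pi0 D0 => p p0 D0.
  have -> : 1 + (2 * p / e * t) ^+ 2 = (e ^+ 2 + (2 * p * t) ^+ 2) / e ^+ 2.
    by field; lra.
  by field; rewrite !gt_eqF// mulr_gt0.
rewrite -set_itvcy (integral_pinfty_FTC _ _ dF (l := 2^-1)).
- by rewrite mulr0 atan0 mulr0 -EFinB -EFinM; congr EFin; lra.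
- by move=> t _; exact: poisson_ge0.
- exact: continuous_poisson.
- have -> : 2^-1 = pi^-1 * (pi / 2) :> R by field; lra.
  apply: cvgMl_tmp; apply: (cvg_comp (fun t => 2 * pi / e * t) atan); last exact: cvgy_atan.
  apply: gt0_cvgMry; last exact: cvg_id.
  by rewrite divr_gt0// mulr_gt0.
Qed.

Lemma integral_poisson e a : 0 < e -> (\int[lm]_t (poisson e (a - t))%:E = 1%:E)%E.
Proof.
move=> e0; rewrite -(integral_poisson0 e0).
rewrite (integral_measure_preserving (reflection_preserving a)
    (f := fun t : measurableTypeR R => (poisson e t)%:E))//.
by apply/measurable_EFinP; apply: continuous_measurable_fun; exact: continuous_poisson.
Qed.

End poisson_kernel.

(** * Plancherel's inequality and Fourier inversion *)

Section exponential.
Context {R : realType}.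
Implicit Types s t : R.

Lemma expiD s t : expi (s + t) = expi s * expi t.
Proof. by apply: complexP; rewrite ?(cReM, cImM) /= ?cosD ?sinD//; ring. Qed.

Lemma normc_expi t : normc (expi t) = 1.
Proof. by rewrite /= cos2Dsin2 sqrtr1. Qed.

Lemma conj_expi t : (expi t)^* = expi (- t).
Proof. by rewrite /expi cosN sinN. Qed.

Lemma cmeas_expi d (T : measurableType d) (u : T -> R) : measurable_fun setT u ->
  cmeas (fun x => expi (u x)).
Proof.
move=> mu; split; apply: measurable_continuous_comp => //.
  exact: continuous_cos.
exact: continuous_sin.
Qed.

End exponential.

Section plane.
Context {R : realType}.
Local Notation mT := (measurableTypeR R).
Local Notation P := (mT * mT)%type.
Local Notation lm := (@lebesgue_measure R).
Local Notation mu := (leb2 R).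
(* [leb2] is declared as a mere measure, whereas Fubini's theorem asks for a
   sigma-finite structure: hence the copy [sleb2]. *)
Let leb2_sigma_finite : sigma_finite setT mu.
Proof.
have /sigma_finiteP[F [TF ndF Foo]] := sigma_finiteT lm.
exists (fun n => F n `*` F n).
  rewrite -setXTT TF predeqE => -[x y]; split.
    move=> [/= [n _ Fnx] [k _ Gky]]; exists (maxn n k) => //; split.
    - by move: x Fnx; exact/subsetPset/ndF/leq_maxl.
    - by move: y Gky; exact/subsetPset/ndF/leq_maxr.
  by move=> [n _ []/= ? ?]; split; exists n.
move=> k; have [? ?] := Foo k.
split; first exact: measurableX.
by rewrite /leb2 /= product_measure1E// lte_mul_pinfty// ge0_fin_numE.
Qed.

Let leb2_fun : set P -> \bar R := mu.
HB.instance Definition _ := Measure.on leb2_fun.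
HB.instance Definition _ :=
  Measure_isSigmaFinite.Build _ _ _ leb2_fun leb2_sigma_finite.

Definition sleb2 : {sigma_finite_measure set P -> \bar R} := leb2_fun.

Local Notation mu2 := (sleb2 \x sleb2)%E.

Definition character (x y : P) : R[i] := expi (2 * pi * dot x y).

Lemma fourierE (f : P -> R[i]) (xi : P) :
  fourier f xi = cI mu (fun x => f x * (character x xi)^*).
Proof.
transitivity (cI mu (fun x => f x * expi (- (2 * pi * dot x xi)))) => //.
by apply: eq_cI => x; rewrite -conj_expi.
Qed.

Lemma dotC (x y : P) : dot x y = dot y x.
Proof. by rewrite /dot mulrC (mulrC x.2). Qed.

Lemma dotBl (x y z : P) : dot (refl2 x y) z = dot x z - dot y z.
Proof. by rewrite /dot /refl2 /=; ring. Qed.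

Lemma characterC (x y : P) : character x y = character y x.
Proof. by rewrite /character dotC. Qed.

Lemma character_refl2 (x y z : P) :
  character (refl2 x y) z = character x z * (character y z)^*.
Proof. by rewrite /character conj_expi -expiD dotBl mulrBr. Qed.

Lemma normc_character x y : normc (character x y) = 1.
Proof. exact: normc_expi. Qed.

Lemma normc_characterJ x y : normc (character x y)^* = 1.
Proof. by rewrite normc_conj normc_expi. Qed.

Lemma measurable_dot d (T : measurableType d) (u v : T -> P) :
  measurable_fun setT u -> measurable_fun setT v ->
  measurable_fun setT (fun x => dot (u x) (v x)).
Proof.
move=> mu' mv; apply: measurable_funD; apply: measurable_funM.
- exact: (measurableT_comp measurable_fst mu').
- exact: (measurableT_comp measurable_fst mv).
- exact: (measurableT_comp measurable_snd mu').
- exact: (measurableT_comp measurable_snd mv).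
Qed.

Lemma cmeas_character d (T : measurableType d) (u v : T -> P) :
  measurable_fun setT u -> measurable_fun setT v ->
  cmeas (fun x => character (u x) (v x)).
Proof.
move=> mu' mv; apply: cmeas_expi.
by apply: measurable_funM => //; exact: measurable_dot.
Qed.

(** A product of one-dimensional exponentials rather than a radial one, so that its transform is the
    explicit product [poisson2]. *)
Definition gauge (e : R) (x : P) : R :=
  expR (- (e * `|x.1|)) * expR (- (e * `|x.2|)).

Definition poisson2 (e : R) (y : P) : R := poisson e y.1 * poisson e y.2.

Lemma gauge_gt0 e x : 0 < gauge e x.
Proof. by rewrite mulr_gt0 ?expR_gt0. Qed.

Lemma integrable_gauge e : 0 < e -> mu.-integrable setT (EFin \o gauge e).
Proof.
move=> e0; apply: (@integrable_prod_mul _ _ mT mT R lm lm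
   (fun t => expR (- (e * `|t|))) (fun t => expR (- (e * `|t|)))).
  exact: integrable_expabs.
exact: integrable_expabs.
Qed.

Lemma measurable_gauge e : measurable_fun setT (gauge e).
Proof.
apply: measurable_funM.
  apply: (measurable_continuous_comp (@continuous_expabs R e)); exact: measurable_fst.
apply: (measurable_continuous_comp (@continuous_expabs R e)); exact: measurable_snd.
Qed.

Lemma cinteg_gauge e : 0 < e -> cinteg mu (fun x => (gauge e x)%:C).
Proof.
move=> e0; apply: (le_cinteg (g := gauge e)).
- by apply: cmeas_real; exact: measurable_gauge.
- exact: integrable_gauge.
- by move=> x; rewrite normc_real ger0_norm// ltW// gauge_gt0.
Qed.

Lemma cI_gauge_character e y : 0 < e ->
  cI mu (fun x => (gauge e x)%:C * character x y) = (poisson2 e y)%:C.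
Proof.
move=> e0.
pose w1 := 2 * pi * y.1; pose w2 := 2 * pi * y.2.
have dotE x : 2 * pi * dot x y = w1 * x.1 + w2 * x.2.
  by rewrite /dot /w1 /w2; ring.
pose c w t : R := expR (- (e * `|t|)) * cos (w * t).
pose s w t : R := expR (- (e * `|t|)) * sin (w * t).
have Ic w : lm.-integrable setT (EFin \o c w) by exact: integrable_expabs_cos.
have Is w : lm.-integrable setT (EFin \o s w) by exact: integrable_expabs_sin.
have Ec (w : R) : Rintegral lm setT (c w) = 2 * e / (e ^+ 2 + w ^+ 2).
  exact: Rintegral_expabs_cos.
have Es (w : R) : Rintegral lm setT (s w) = 0 by exact: Rintegral_expabs_sin.
apply: complexP => /=.
  transitivity (Rintegral mu setT
      (fun x => c w1 x.1 * c w2 x.2 - s w1 x.1 * s w2 x.2)).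
    apply: eq_Rintegral => x _; rewrite /character dotE cosD /gauge /c /s; ring.
  rewrite RintegralB//.
  - by rewrite !Rintegral_prod_mul// !Ec !Es mul0r subr0.
  - exact: (integrable_prod_mul (Ic w1) (Ic w2)).
  - exact: (integrable_prod_mul (Is w1) (Is w2)).
transitivity (Rintegral mu setT
    (fun x => s w1 x.1 * c w2 x.2 + c w1 x.1 * s w2 x.2)).
  apply: eq_Rintegral => x _; rewrite /character dotE sinD /gauge /c /s; ring.
rewrite RintegralD//.
- by rewrite !Rintegral_prod_mul// !Es mul0r mulr0 addr0.
- exact: (integrable_prod_mul (Is w1) (Ic w2)).
- exact: (integrable_prod_mul (Ic w1) (Is w2)).
Qed.

Lemma poisson2_ge0 e y : 0 < e -> 0 <= poisson2 e y.
Proof. by move=> e0; rewrite mulr_ge0// poisson_ge0. Qed.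

Lemma poisson2C e x y : poisson2 e (refl2 x y) = poisson2 e (refl2 y x).
Proof.
rewrite /poisson2 /refl2 /= /poisson.
by congr (_ / (_ + _) * (_ / (_ + _))); ring.
Qed.

Lemma measurable_poisson2 e d (T : measurableType d) (u : T -> P) : 0 < e ->
  measurable_fun setT u -> measurable_fun setT (fun x => poisson2 e (u x)).
Proof.
move=> e0 mu'; apply: measurable_funM.
  apply: (measurable_continuous_comp (continuous_poisson e0)).
  exact: (measurableT_comp measurable_fst mu').
apply: (measurable_continuous_comp (continuous_poisson e0)).
exact: (measurableT_comp measurable_snd mu').
Qed.

Lemma measurable_poisson_prod e e' a : 0 < e -> 0 < e' ->
  measurable_fun setT (fun y : P => poisson e (a.1 - y.1) * poisson e' (a.2 - y.2)).
Proof.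
move=> e0 e'0; apply: measurable_funM.
  apply: (measurable_continuous_comp (continuous_poisson e0)).
  exact: (measurableT_comp (measurable_reflection _) measurable_fst).
apply: (measurable_continuous_comp (continuous_poisson e'0)).
exact: (measurableT_comp (measurable_reflection _) measurable_snd).
Qed.

Lemma integral_poisson_prod e e' a : 0 < e -> 0 < e' ->
  (\int[mu]_y (poisson e (a.1 - y.1) * poisson e' (a.2 - y.2))%:E = 1%:E)%E.
Proof.
move=> e0 e'0; rewrite fubini_tonelli1; last 2 first.
- by apply/measurable_EFinP; exact: measurable_poisson_prod.
- by move=> x; rewrite lee_fin mulr_ge0 ?poisson_ge0//.
have mp b : measurable_fun setT (fun t : mT => (poisson e' (b - t))%:E).
  apply/measurable_EFinP.
  apply: (measurable_continuous_comp (continuous_poisson e'0)).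
  exact: measurable_reflection.
transitivity (\int[lm]_x (poisson e (a.1 - x))%:E)%E; last exact: integral_poisson.
apply: eq_integral => x _; rewrite /fubini_F /=.
under eq_integral do rewrite EFinM.
rewrite ge0_integralZl//.
- by rewrite integral_poisson// mule1.
- by move=> y _; rewrite lee_fin poisson_ge0.
- by rewrite lee_fin poisson_ge0.
Qed.

Lemma integral_poisson2 e a : 0 < e ->
  (\int[mu]_y (poisson2 e (refl2 a y))%:E = 1%:E)%E.
Proof. by move=> e0; exact: integral_poisson_prod. Qed.

Lemma cvg_gauge (x : P) : gauge n.+1%:R^-1 x @[n --> \oo] --> (1 : R).
Proof.
have cE (t : R) : expR (- (n.+1%:R^-1 * `|t|)) @[n --> \oo] --> (1 : R).
  have c0 : - (n.+1%:R^-1 * `|t|) @[n --> \oo] --> (0 : R).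
    rewrite -oppr0 -(mul0r `|t|); apply: cvgN; apply: cvgMr_tmp.
    exact: cvg_harmonic.
  by rewrite -[X in _ --> X]expR0; exact: (cvg_comp _ _ c0 (@continuous_expR R 0)).
by rewrite -[X in _ --> X](mulr1 1); exact: cvgM.
Qed.

Lemma cinteg_section (u : P -> R[i]) (K : P * P -> R[i]) (M : R) :
  cinteg mu u -> cmeas K ->
  (forall x, (\int[mu]_y (normc (K (x, y)))%:E <= M%:E)%E) ->
  cinteg mu2 (fun z => u z.1 * K z).
Proof.
move=> Iu mK KM; apply: cintegP.
  by apply: cmeasM => //; exact/cmeas_fst/(cmeas_cinteg Iu).
have muK : measurable_fun setT (fun z : P * P => (normc (u z.1 * K z))%:E).
  apply/measurable_EFinP/cmeas_normc/cmeasM => //.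
  exact/cmeas_fst/(cmeas_cinteg Iu).
have mK1 x : measurable_fun setT (fun y => (normc (K (x, y)))%:E).
  apply/measurable_EFinP.
  exact: (measurableT_comp (cmeas_normc mK) (pair1_measurable x)).
rewrite fubini_tonelli1//; last by move=> z; rewrite lee_fin normc_ge0.
apply: (@le_lt_trans _ _ (\int[mu]_x (M%:E * (normc (u x))%:E))%E).
  apply: ge0_le_integral => //.
  - by move=> x _; apply: integral_ge0 => y _; rewrite lee_fin normc_ge0.
  - apply: (measurable_fun_fubini_tonelli_F (fun z : P * P => (normc (u z.1 * K z))%:E)) => //.
    by move=> z; rewrite lee_fin normc_ge0.
  - apply: measurable_funeM.
    by apply/measurable_EFinP/cmeas_normc; exact: (cmeas_cinteg Iu).
  move=> x _; rewrite /fubini_F /=.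
  under eq_integral do rewrite normcM EFinM.
  rewrite ge0_integralZl//; last by rewrite lee_fin normc_ge0.
    by rewrite muleC lee_wpmul2r// lee_fin normc_ge0.
  by move=> y _; rewrite lee_fin normc_ge0.
have /integrable_lty := @integrableZl _ _ _ mu setT measurableT M _ (cinteg_normc Iu).
exact.
Qed.

Lemma cmeas_section (K : P * P -> R[i]) (M : R) : cmeas K ->
  (forall x, (\int[mu]_y (normc (K (x, y)))%:E <= M%:E)%E) ->
  cmeas (fun x => cI mu (fun y => K (x, y))).
Proof.
move=> mK KM.
have e0 : 0 < 1 :> R by [].
have IK := cinteg_section (cinteg_gauge e0) mK KM.
have Kx x : cinteg mu (fun y => K (x, y)).
  apply: cintegP; last exact: le_lt_trans (KM x) (ltry _).
  exact: (cmeas_comp mK (pair1_measurable x)).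
(* Measurability of partial integrals comes from Fubini, which wants integrability in [x] as well.
   Multiplying by [gauge 1] provides it, and [gauge (- 1)] is the reciprocal that undoes it. *)
have -> : (fun x => cI mu (fun y => K (x, y))) =
    (fun x => (gauge (- 1) x)%:C * cI mu (fun y => (gauge 1 x)%:C * K (x, y))).
  apply/funext => x; rewrite cIZ// mulrA -rmorphM/= [X in X%:C * _](_ : _ = 1) ?mul1r//.
  rewrite /gauge -!expRD [X in expR X](_ : _ = 0) ?expR0//.
  by move: `|x.1| `|x.2| => a b; ring.
apply: cmeasM; first by apply: cmeas_real; exact: measurable_gauge.
exact: (cmeas_fubini IK).
Qed.

Lemma cmeas_characterl (x : P) : cmeas (fun y : P => character y x).
Proof. by apply: cmeas_character => //; exact: measurable_cst. Qed.

Lemma cinteg_characterJ (f : P -> R[i]) y : cinteg mu f ->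
  cinteg mu (fun x => f x * (character x y)^*).
Proof.
move=> If; apply: (cintegMb If (M := 1)); first exact/cmeas_conj/cmeas_characterl.
by move=> x; rewrite normc_characterJ.
Qed.

Lemma cmeas_fourier (f : P -> R[i]) : cinteg mu f -> cmeas (fourier f).
Proof.
move=> If.
rewrite (_ : fourier f = fun x => cI mu (fun y => f y * (character y x)^*)); last first.
  by apply/funext => x; rewrite fourierE.
apply: (@cmeas_section (fun z => f z.2 * (character z.2 z.1)^*)
   (Rintegral mu setT (fun x => normc (f x)))).
  apply: cmeasM; first exact/cmeas_snd/(cmeas_cinteg If).
  by apply/cmeas_conj/cmeas_character.
move=> x /=; under eq_integral do
  rewrite normcM normc_characterJ mulr1.
rewrite fineK// ge0_fin_numE ?cinteg_lty//.
by apply: integral_ge0 => y _; rewrite lee_fin normc_ge0.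
Qed.

Lemma normc_fourier_le (f : P -> R[i]) x : cinteg mu f ->
  normc (fourier f x) <= Rintegral mu setT (fun x => normc (f x)).
Proof.
move=> If; rewrite fourierE; apply: le_trans (normc_cI_le _) _.
  exact: cinteg_characterJ.
by under eq_Rintegral do rewrite normcM normc_characterJ mulr1.
Qed.

End plane.

Section plancherel.
Context {R : realType}.
Local Notation mT := (measurableTypeR R).
Local Notation P := (mT * mT)%type.
Local Notation mu := (leb2 R).
Local Notation mu2 := (sleb2 \x sleb2)%E.

Definition sqnorm (f : P -> R[i]) : \bar R := (\int[mu]_x (normc (f x) ^+ 2)%:E)%E.

Lemma sqnorm_ge0 f : (0 <= sqnorm f)%E.
Proof. by apply: integral_ge0 => x _; rewrite lee_fin sqr_ge0. Qed.

Lemma measurable_normc_sqr (f : P -> R[i]) : cmeas f ->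
  measurable_fun setT (fun x => (normc (f x) ^+ 2)%:E).
Proof.
by move=> mf; apply/measurable_EFinP/measurable_funX; exact: cmeas_normc.
Qed.

(** The left side is the energy of [fourier h] damped by the gauge. Writing out both transforms and
    integrating the gauge against the characters first leaves a quadratic form in [h] with a Poisson
    kernel, ready for Schur's test. *)
Lemma cI_gauge_fourier e (h : P -> R[i]) : 0 < e -> cinteg mu h ->
  cI mu (fun x => ((gauge e x)%:C * (fourier h x)^*) * fourier h x) =
  cI mu (fun y => h y *
    cI mu (fun z => (h z)^* * (poisson2 e (refl2 z y))%:C)).
Proof.
move=> e0 Ih.
have Iw : cinteg mu (fun x => (gauge e x)%:C * (fourier h x)^*).
  apply: (cintegMb (M := Rintegral mu setT (fun x => normc (h x)))).
  - exact: cinteg_gauge.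
  - by apply: cmeas_conj; exact: cmeas_fourier.
  - by move=> x; rewrite normc_conj normc_fourier_le.
transitivity (cI mu (fun x => ((gauge e x)%:C * (fourier h x)^*) *
    cI mu (fun y => h y * (character y x)^*))).
  by apply: eq_cI => x; rewrite fourierE.
have mk : cmeas (fun z : P * P => (character z.2 z.1)^*).
  by apply/cmeas_conj/cmeas_character.
rewrite (@cI_swap _ _ P P R sleb2 sleb2 _ _ _ 1 Iw Ih mk); last first.
  by move=> z; rewrite normc_characterJ.
apply: eq_cI => y; congr (_ * _).
have Ig : cinteg mu (fun x => (gauge e x)%:C * (character y x)^*).
  apply: (cintegMb (M := 1)).
  - exact: cinteg_gauge.
  - by under eq_fun do rewrite characterC; exact/cmeas_conj/cmeas_characterl.
  - by move=> x; rewrite normc_characterJ.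
transitivity (cI mu (fun x => ((gauge e x)%:C * (character y x)^*) *
    cI mu (fun z => (h z)^* * character z x))).
  apply: eq_cI => x; rewrite mulrAC; congr (_ * _).
  rewrite fourierE -cI_conj.
    by apply: eq_cI => z; rewrite conjcM conjcK.
  exact: cinteg_characterJ.
rewrite (@cI_swap _ _ P P R sleb2 sleb2 _ _ (fun z => character z.2 z.1) 1 Ig
  (cinteg_conj Ih)).
- apply: eq_cI => z; congr (_ * _); rewrite -cI_gauge_character//.
  apply: eq_cI => x; rewrite -mulrA; congr (_ * _).
  by rewrite [RHS]characterC character_refl2 mulrC.
- exact: cmeas_character.
- by move=> z; rewrite normc_character.
Qed.

Lemma measurable_poisson_kernel (e : R) : 0 < e ->
  measurable_fun setT (fun z : P * P => poisson2 e (refl2 z.2 z.1)).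
Proof.
move=> e0; apply: measurable_poisson2 => //; apply/measurable_fun_pairP; split.
  by apply: measurable_funB; apply: (measurableT_comp measurable_fst).
by apply: measurable_funB; apply: (measurableT_comp measurable_snd).
Qed.

(* Schur's test: AM-GM, then both marginals of the kernel have mass 1. *)
Lemma poisson2_schur e (a : P -> R) : 0 < e -> measurable_fun setT a ->
  (forall x, 0 <= a x) ->
  (\int[mu]_y \int[mu]_z (a y * (a z * poisson2 e (refl2 z y)))%:E <=
   \int[mu]_y (a y ^+ 2)%:E)%E.
Proof.
move=> e0 ma a0.
have mP := measurable_poisson_kernel e0.
have ma1 : measurable_fun setT (fun z : P * P => a z.1).
  exact: (measurableT_comp ma measurable_fst).
have ma2 : measurable_fun setT (fun z : P * P => a z.2).
  exact: (measurableT_comp ma measurable_snd).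
pose f1 (z : P * P) := (2^-1 * a z.1 ^+ 2 * poisson2 e (refl2 z.2 z.1))%:E.
pose f2 (z : P * P) := (2^-1 * a z.2 ^+ 2 * poisson2 e (refl2 z.2 z.1))%:E.
have f10 z : (0 <= f1 z)%E.
  by rewrite lee_fin mulr_ge0 ?poisson2_ge0// mulr_ge0 ?sqr_ge0.
have f20 z : (0 <= f2 z)%E.
  by rewrite lee_fin mulr_ge0 ?poisson2_ge0// mulr_ge0 ?sqr_ge0.
have mf1 : measurable_fun setT f1.
  apply/measurable_EFinP; apply: measurable_funM => //.
  by apply: measurable_funM => //; exact: measurable_funX.
have mf2 : measurable_fun setT f2.
  apply/measurable_EFinP; apply: measurable_funM => //.
  by apply: measurable_funM => //; exact: measurable_funX.
pose f0 (z : P * P) := (a z.1 * (a z.2 * poisson2 e (refl2 z.2 z.1)))%:E.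
have f00 z : (0 <= f0 z)%E.
  by rewrite lee_fin mulr_ge0// mulr_ge0 ?poisson2_ge0.
have mf0 : measurable_fun setT f0.
  by apply/measurable_EFinP; apply: measurable_funM => //; exact: measurable_funM.
have half (b : P -> R) : measurable_fun setT b ->
    (\int[mu]_y (2^-1 * b y ^+ 2)%:E = 2^-1%:E * \int[mu]_y (b y ^+ 2)%:E)%E.
  move=> mb; under eq_integral do rewrite EFinM.
  rewrite ge0_integralZl//; first exact/measurable_EFinP/measurable_funX.
  by move=> x _; rewrite lee_fin sqr_ge0.
have E1 : (\int[mu2]_z f1 z = 2^-1%:E * \int[mu]_y (a y ^+ 2)%:E)%E.
  rewrite fubini_tonelli1// -half//; apply: eq_integral => y _.
  rewrite /fubini_F /f1 /=; under eq_integral do rewrite EFinM poisson2C.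
  rewrite ge0_integralZl ?integral_poisson2 ?mule1//.
  - apply/measurable_EFinP; apply: measurable_poisson2 => //.
    exact: measurable_refl2.
  - by move=> x _; rewrite lee_fin poisson2_ge0.
  - by rewrite lee_fin mulr_ge0 ?sqr_ge0.
have E2 : (\int[mu2]_z f2 z = 2^-1%:E * \int[mu]_y (a y ^+ 2)%:E)%E.
  rewrite fubini_tonelli2// -half//; apply: eq_integral => y _.
  rewrite /fubini_G /f2 /=; under eq_integral do rewrite EFinM.
  rewrite ge0_integralZl ?integral_poisson2 ?mule1//.
  - apply/measurable_EFinP; apply: measurable_poisson2 => //.
    exact: measurable_refl2.
  - by move=> x _; rewrite lee_fin poisson2_ge0.
  - by rewrite lee_fin mulr_ge0 ?sqr_ge0.
have -> : (\int[mu]_y (a y ^+ 2)%:E = \int[mu2]_z (f1 z + f2 z))%E.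
  rewrite ge0_integralD// E1 E2 -ge0_muleDl ?lee_fin// -EFinD.
  by rewrite (_ : 2^-1 + 2^-1 = 1 :> R) ?mul1e//; lra.
have -> : (\int[mu]_y \int[mu]_z (a y * (a z * poisson2 e (refl2 z y)))%:E =
    \int[mu2]_z f0 z)%E.
  by rewrite (fubini_tonelli1 (m1 := sleb2) (m2 := sleb2) f0 mf0 f00).
apply: ge0_le_integral => //.
- exact: emeasurable_funD.
- move=> z _; rewrite /f0 /f1 /f2 -EFinD lee_fin mulrA -mulrDl.
  rewrite ler_wpM2r ?poisson2_ge0//.
  have := sqr_ge0 (a z.1 - a z.2); nra.
Qed.

Lemma gauge_plancherel e (h : P -> R[i]) : 0 < e -> cinteg mu h ->
  (\int[mu]_x (gauge e x * normc (fourier h x) ^+ 2)%:E <= sqnorm h)%E.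
Proof.
move=> e0 Ih.
have mh : measurable_fun setT (fun x => normc (h x)).
  exact/cmeas_normc/(cmeas_cinteg Ih).
have Iw : cinteg mu (fun x => ((gauge e x)%:C * (fourier h x)^*) * fourier h x).
  apply: (cintegMb (M := Rintegral mu setT (fun x => normc (h x)))).
  - apply: (cintegMb (M := Rintegral mu setT (fun x => normc (h x)))).
    + exact: cinteg_gauge.
    + by apply: cmeas_conj; exact: cmeas_fourier.
    + by move=> x; rewrite normc_conj normc_fourier_le.
  - exact: cmeas_fourier.
  - by move=> x; rewrite normc_fourier_le.
have ReE x : Re (((gauge e x)%:C * (fourier h x)^*) * fourier h x) =
    gauge e x * normc (fourier h x) ^+ 2.
  rewrite -mulrA cReM [Im (gauge e x)%:C]/= mul0r subr0 [Re (gauge e x)%:C]/=.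
  by rewrite (mulrC (fourier h x)^*) Re_mulconj.
have Ir : mu.-integrable setT (fun x => (gauge e x * normc (fourier h x) ^+ 2)%:E).
  by case: Iw => + _; under eq_fun do rewrite ReE.
rewrite -(fineK (integrable_fin_num measurableT Ir)).
have -> : fine (\int[mu]_x (gauge e x * normc (fourier h x) ^+ 2)%:E) =
    Re (cI mu (fun x => ((gauge e x)%:C * (fourier h x)^*) * fourier h x)).
  by rewrite Re_cI /Rintegral; congr fine; apply: eq_integral => x _; rewrite ReE.
rewrite (cI_gauge_fourier e0 Ih).
set I := cI mu _.
apply: (@le_trans _ _ (normc I)%:E).
  by rewrite lee_fin (le_trans (ler_norm _))// Re_le_normc.
have mP := measurable_poisson_kernel e0.
(* This bound blows up as [e] tends to 0; it secures absolute convergence of the double integral,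
   while the estimate itself comes from [poisson2_schur]. *)
have Bp (t : R) : 0 <= poisson e t <= 2 / e.
  rewrite poisson_ge0//= ler_pdivrMr ?poisson_den_gt0//.
  rewrite (_ : 2 / e * _ = 2 * e + 2 / e * (2 * pi * t) ^+ 2); last first.
    by rewrite mulrDr; congr (_ + _); field; lra.
  by rewrite lerDl mulr_ge0 ?sqr_ge0// divr_ge0// ltW.
have P2b (x : P) : normc (poisson2 e x)%:C <= (2 / e) * (2 / e).
  rewrite normc_real ger0_norm ?poisson2_ge0//.
  have /andP[? ?] := Bp x.1; have /andP[? ?] := Bp x.2.
  exact: ler_pM.
have Ihz y : cinteg mu (fun z => (h z)^* * (poisson2 e (refl2 z y))%:C).
  apply: (cintegMb (cinteg_conj Ih) (M := (2 / e) * (2 / e))).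
    by apply: cmeas_real; exact: (measurableT_comp mP (pair1_measurable y)).
  by move=> z; exact: P2b.
have IyzK : cinteg mu2 (fun z : P * P => h z.1 * ((h z.2)^* * (poisson2 e (refl2 z.2 z.1))%:C)).
  apply: (@cinteg_kernel _ _ P P R sleb2 sleb2 h (fun z => (h z)^*)
     (fun z => (poisson2 e (refl2 z.2 z.1))%:C) ((2 / e) * (2 / e))) => //.
  - exact: cinteg_conj.
have IE : I = cI mu (fun y => cI mu (fun z =>
    h y * ((h z)^* * (poisson2 e (refl2 z y))%:C))).
  by apply: eq_cI => y; rewrite cIZ.
have II : cinteg mu (fun y => cI mu (fun z =>
    h y * ((h z)^* * (poisson2 e (refl2 z y))%:C))).
  exact: (cinteg_fubini IyzK).
rewrite IE; apply: le_trans (normc_cI_le_fin II) _.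
apply: le_trans _ (poisson2_schur e0 mh (fun x => normc_ge0 (h x))).
apply: ge0_le_integral => //.
- by move=> y _; rewrite lee_fin normc_ge0.
- exact/measurable_EFinP/cmeas_normc/(cmeas_cinteg II).
- apply: (measurable_fun_fubini_tonelli_F (m2 := sleb2) (fun z : P * P =>
    (normc (h z.1) * (normc (h z.2) * poisson2 e (refl2 z.2 z.1)))%:E)).
    apply/measurable_EFinP; apply: measurable_funM.
      exact: (measurableT_comp mh measurable_fst).
    apply: measurable_funM => //.
    exact: (measurableT_comp mh measurable_snd).
  by move=> z; rewrite lee_fin mulr_ge0 ?normc_ge0// mulr_ge0 ?normc_ge0 ?poisson2_ge0.
move=> y _; apply: le_trans (normc_cI_le_fin _) _; first exact: cintegZ.
rewrite le_eqVlt; apply/orP; left; apply/eqP; apply: eq_integral => z _.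
rewrite !normcM normc_conj normc_real ger0_norm//.
exact: poisson2_ge0.
Qed.

(** Fatou's lemma in the form that removes an approximation: the gauge in [plancherel_le], the
    truncation in [sqnorm_hankelop]. *)
Lemma sqnorm_fatou (f : nat -> P -> \bar R) (h : P -> R[i]) (s : \bar R) :
  (forall n, measurable_fun setT (f n)) -> (forall n x, (0 <= f n x)%E) ->
  (forall x, f n x @[n --> \oo] --> (normc (h x) ^+ 2)%:E) ->
  (forall n, (\int[mu]_x f n x <= s)%E) -> (sqnorm h <= s)%E.
Proof.
move=> mf f0 cvf fs; have := fatou mu measurableT mf (fun n x _ => f0 n x).
have -> : (\int[mu]_x limn_einf (f^~ x) = sqnorm h)%E.
  apply: eq_integral => x _; rewrite is_cvg_limn_einfE; last first.
    by apply/cvg_ex; eexists; exact: cvf.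
  by apply/cvg_lim => //; exact: cvf.
move=> /le_trans; apply.
rewrite limn_einf_lim; apply: lime_le; first exact: is_cvg_einfs.
apply: nearW => n; apply: le_trans (fs n).
by apply: ereal_inf_lbound; exists n => /=.
Qed.

(** The bound of [gauge_plancherel] does not depend on the rate of the gauge, which tends to 1
    pointwise as the rate tends to 0. *)
Theorem plancherel_le (h : P -> R[i]) : cinteg mu h ->
  (sqnorm (fourier h) <= sqnorm h)%E.
Proof.
move=> Ih; pose e n : R := n.+1%:R^-1.
have e0 n : 0 < e n by rewrite invr_gt0.
pose f n (x : P) := (gauge (e n) x * normc (fourier h x) ^+ 2)%:E.
have cvf x : f n x @[n --> \oo] --> ((normc (fourier h x)) ^+ 2)%:E.
  apply/fine_cvgP; split; first exact: nearW.
  by rewrite -[X in _ --> X]mul1r; apply: cvgMr_tmp; exact: cvg_gauge.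
have mf n : measurable_fun setT (f n).
  apply/measurable_EFinP; apply: measurable_funM; first exact: measurable_gauge.
  by apply/measurable_funX/cmeas_normc/cmeas_fourier.
have f0 n x : (0 <= f n x)%E.
  by rewrite lee_fin mulr_ge0 ?sqr_ge0// ltW// gauge_gt0.
exact: (sqnorm_fatou mf f0 cvf (fun n => gauge_plancherel (e0 n) Ih)).
Qed.

End plancherel.

Section inversion.
Context {R : realType}.
Local Notation mT := (measurableTypeR R).
Local Notation P := (mT * mT)%type.
Local Notation mu := (leb2 R).

(** Away from the origin the numerator carries the factor [e] while the denominator stays bounded
    below: the tail is [e] times a fixed integrable function. Taking [poisson 1] for the latter
    gives it mass 1. *)
Lemma poisson_tail e (d t : R) : 0 < e -> 0 < d -> d < `|t| ->
  poisson e t <= e * (1 + (2 * pi * d) ^- 2) * poisson 1 t.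
Proof.
move=> e0 d0 dt; have pi0 : 0 < pi :> R := pi_gt0 R.
have dd : 0 < (2 * pi * d) ^+ 2 by rewrite exprn_gt0// !mulr_gt0.
have D1 : 0 < 1 + (2 * pi * t) ^+ 2.
  by have := poisson_den_gt0 t (@ltr01 R); rewrite expr1n.
have tt : (2 * pi * d) ^+ 2 <= (2 * pi * t) ^+ 2.
  rewrite [in leRHS]exprMn -(real_normK (num_real t)) -exprMn.
  rewrite ler_pXn2r// ?nnegrE ?mulr_ge0 ?(ltW pi0) ?(ltW d0)//.
  by rewrite ler_wpM2l ?mulr_ge0 ?(ltW pi0)// ltW.
rewrite /poisson expr1n mulr1.
move: ((2 * pi * d) ^+ 2) ((2 * pi * t) ^+ 2) dd D1 tt => a b a0 D1 ab.
have b0 : 0 < b by exact: lt_le_trans ab.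
apply: (@le_trans _ _ (2 * e / b)).
  rewrite ler_wpM2l ?mulr_ge0 ?(ltW e0)// lef_pV2 ?posrE//.
    by rewrite lerDr sqr_ge0.
  by rewrite ltr_wpDl ?sqr_ge0.
rewrite ler_pdivrMr// (_ : _ * b = 2 * e * ((1 + a^-1) * b / (1 + b))); last first.
  by field; rewrite !gt_eqF.
rewrite ler_peMr ?mulr_ge0 ?(ltW e0)// ler_pdivlMr// mul1r mulrDl mul1r addrC lerD2l.
by rewrite mulrC ler_pdivlMr// mul1r.
Qed.

Definition locally_continuous (g : P -> R[i]) (xi : P) : Prop :=
  forall eta : R, 0 < eta -> exists2 d : R, 0 < d &
    forall y, `|xi.1 - y.1| <= d -> `|xi.2 - y.2| <= d -> normc (g y - g xi) <= eta.

Lemma poisson2_approx (g : P -> R[i]) (xi : P) (B eta : R) : cmeas g ->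
  0 < eta -> (forall y, normc (g y) <= B) -> locally_continuous g xi ->
  exists C : R, forall e, 0 < e ->
    normc (cI mu (fun y => g y * (poisson2 e (refl2 xi y))%:C) - g xi) <=
    eta + e * C.
Proof.
move=> mg eta0 gB /(_ _ eta0)[d d0 gd].
have B0 : 0 <= B by apply: le_trans (gB point); exact: normc_ge0.
pose c := 1 + (2 * pi * d) ^- 2 : R.
have c0 : 0 <= c by rewrite addr_ge0// invr_ge0 sqr_ge0.
(* Outside the square of half-side [d] at least one coordinate is far from [xi]; each of the two
   cases costs [2 * B * e * c] times a product kernel of mass 1. *)
exists (4 * B * c) => e e0.
pose q a b (y : P) := poisson a (xi.1 - y.1) * poisson b (xi.2 - y.2).
have q0 a b y : 0 < a -> 0 < b -> 0 <= q a b y.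
  by move=> a0 b0; rewrite mulr_ge0 ?poisson_ge0.
have Iq a b : 0 < a -> 0 < b -> mu.-integrable setT (EFin \o q a b).
  move=> a0 b0; apply/integrableP; split.
    by apply/measurable_EFinP; exact: measurable_poisson_prod.
  under eq_integral do rewrite /= ger0_norm ?q0//.
  by rewrite integral_poisson_prod// ltry.
have Rq a b : 0 < a -> 0 < b -> Rintegral mu setT (q a b) = 1.
  by move=> a0 b0; rewrite /Rintegral integral_poisson_prod.
have Cq : cinteg mu (fun y => (poisson2 e (refl2 xi y))%:C).
  apply: (le_cinteg (g := q e e)).
  - by apply: cmeas_real; exact: measurable_poisson_prod.
  - exact: Iq.
  - by move=> y; rewrite normc_real ger0_norm// q0.
have Igq : cinteg mu (fun y => g y * (poisson2 e (refl2 xi y))%:C).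
  by under eq_fun do rewrite mulrC; exact: (cintegMb Cq mg gB).
have -> : g xi = cI mu (fun y => g xi * (poisson2 e (refl2 xi y))%:C).
  by rewrite cIZ// cI_real Rq// mulr1.
rewrite -cIB//; last exact: cintegZ.
apply: le_trans (normc_cI_le _) _; first by apply: cintegB => //; exact: cintegZ.
pose bound y := eta * q e e y + 2 * B * e * c * q 1 e y + 2 * B * e * c * q e 1 y.
have e1 : 0 < 1 :> R by [].
have IZ k a b : 0 < a -> 0 < b -> mu.-integrable setT (EFin \o (fun y => k * q a b y)).
  by move=> a0 b0; apply: integrable_scale; exact: Iq.
have ID (u v : P -> R) : mu.-integrable setT (EFin \o u) ->
    mu.-integrable setT (EFin \o v) -> mu.-integrable setT (EFin \o (fun y => u y + v y)).
  move=> Iu Iv; under [_ \o _]eq_fun do rewrite /= EFinD.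
  exact: integrableD.
have -> : eta + e * (4 * B * c) = Rintegral mu setT bound.
  rewrite /bound !RintegralD ?RintegralZl ?Rq//; try exact: IZ; try exact: Iq.
    by ring.
  by apply: ID; exact: IZ.
apply: le_Rintegral => //.
- have := cinteg_normc (cintegB Igq (cintegZ (g xi) Cq)); exact.
- exact: (ID _ _ (ID _ _ (IZ eta _ _ e0 e0) (IZ (2 * B * e * c) _ _ e1 e0))
    (IZ (2 * B * e * c) _ _ e0 e1)).
move=> y _; rewrite -mulrBl normcM normc_real.
rewrite (ger0_norm (q0 e e y e0 e0)) /bound.
have g2 : normc (g y - g xi) <= 2 * B.
  rewrite (le_trans (le_normcD _ _))// normcN mulr_natl mulr2n.
  by rewrite lerD.
have bc : 0 <= 2 * B * e * c by rewrite !mulr_ge0 // ltW.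
have T1 : 0 <= eta * q e e y by rewrite mulr_ge0 ?q0// ltW.
have T2 : 0 <= 2 * B * e * c * q 1 e y by rewrite mulr_ge0 ?q0.
have T3 : 0 <= 2 * B * e * c * q e 1 y by rewrite mulr_ge0 ?q0.
have p1 := poisson_ge0 (xi.1 - y.1) e0; have p2 := poisson_ge0 (xi.2 - y.2) e0.
have main : normc (g y - g xi) * q e e y <= 2 * B * q e e y.
  by rewrite ler_wpM2r// q0.
have [h1|h1] := leP `|xi.1 - y.1| d; last first.
  have t1 := poisson_tail e0 d0 h1.
  suff : 2 * B * q e e y <= 2 * B * e * c * q 1 e y by lra.
  rewrite -!(mulrA 2) ler_wpM2l// -!(mulrA B) ler_wpM2l// /q mulrA.
  by rewrite ler_wpM2r.
have [h2|h2] := leP `|xi.2 - y.2| d; last first.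
  have t2 := poisson_tail e0 d0 h2.
  suff : 2 * B * q e e y <= 2 * B * e * c * q e 1 y by lra.
  rewrite -!(mulrA 2) ler_wpM2l// -!(mulrA B) ler_wpM2l// /q.
  by rewrite [leRHS]mulrCA ler_wpM2l.
suff : normc (g y - g xi) * q e e y <= eta * q e e y by lra.
by rewrite ler_wpM2r ?q0//; exact: gd.
Qed.

(** Abel summation: the integral damped by the gauge is a Poisson average of [g], close to [g xi] by
    [poisson2_approx]; it also tends to the undamped integral by dominated convergence. *)
Theorem fourier_inversion (g : P -> R[i]) (xi : P) (B : R) : cinteg mu g ->
  cinteg mu (fourier g) -> (forall y, normc (g y) <= B) ->
  locally_continuous g xi ->
  cI mu (fun x => fourier g x * character x xi) = g xi.
Proof.
move=> Ig Ifg gB gc; set L := LHS.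
pose e n : R := n.+1%:R^-1.
have e0 n : 0 < e n by rewrite invr_gt0.
have mch : cmeas (fun x : P => character x xi) by exact: cmeas_characterl.
have Ich n : cinteg mu (fun x => (gauge (e n) x)%:C * character x xi).
  by apply: (cintegMb (cinteg_gauge (e0 n)) mch (M := 1)) => x; rewrite normc_character.
have AE n : cI mu (fun x => (gauge (e n) x)%:C * (fourier g x * character x xi)) =
    cI mu (fun y => g y * (poisson2 (e n) (refl2 xi y))%:C).
  transitivity (cI mu (fun x => ((gauge (e n) x)%:C * character x xi) *
      cI mu (fun y => g y * (character y x)^*))).
    by apply: eq_cI => x; rewrite -fourierE -mulrA (mulrC (fourier g x)).
  rewrite (@cI_swap _ _ P P R sleb2 sleb2 _ _ (fun z => (character z.2 z.1)^*) 1
    (Ich n) Ig).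
  - apply: eq_cI => y; congr (_ * _); rewrite -cI_gauge_character//.
    apply: eq_cI => x; rewrite -mulrA; congr (_ * _).
    by rewrite [RHS]characterC character_refl2 (characterC xi).
  - by apply: cmeas_conj; exact: cmeas_character.
  - by move=> z; rewrite normc_characterJ.
have Ifc : cinteg mu (fun x => fourier g x * character x xi).
  by apply: (cintegMb Ifg mch (M := 1)) => x; rewrite normc_character.
have lim : normc (cI mu (fun x => (gauge (e n) x)%:C * (fourier g x * character x xi))
    - L) @[n --> \oo] --> (0 : R).
  apply: (@cI_dominated _ P R mu
    (fun n x => (gauge (e n) x)%:C * (fourier g x * character x xi))
    (fun x => fourier g x * character x xi) (fun x => normc (fourier g x))).
  - move=> n; apply: cmeasM; first by apply: cmeas_real; exact: measurable_gauge.
    exact: cmeas_cinteg Ifc.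
  - exact: cmeas_cinteg Ifc.
  - exact: cinteg_normc.
  - move=> n x; rewrite !normcM normc_character mulr1 normc_real.
    rewrite ger0_norm ?(ltW (gauge_gt0 _ _))// ler_piMl ?normc_ge0//.
    by rewrite /gauge mulr_ile1 ?expR_ge0// -expR0 ler_expR oppr_le0
      mulr_ge0// ltW.
  - move=> x; under eq_fun do rewrite -[X in _ - X]mul1r -mulrBl
      normcM -rmorphB normc_real.
    rewrite -(mul0r (normc (fourier g x * character x xi))); apply: cvgMr_tmp.
    have h0 : gauge (e n) x - 1 @[n --> \oo] --> (0 : R).
      rewrite -[X in _ --> X](subrr 1); apply: cvgB; first exact: cvg_gauge.
      exact: cvg_cst.
    by rewrite -[X in _ --> X](@normr0 _ R); exact: cvg_norm.
apply/eqP; rewrite -subr_eq0; apply/eqP/eq0_normc.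
apply/eqP; rewrite eq_le normc_ge0 andbT; apply/ler_addgt0Pr => eta eta0.
rewrite add0r.
have [C HC] := poisson2_approx (cmeas_cinteg Ig) eta0 gB gc.
have bnd n : normc (L - g xi) <= normc (cI mu (fun x => (gauge (e n) x)%:C *
    (fourier g x * character x xi)) - L) + (eta + e n * C).
  apply: le_trans _ (lerD (lexx _) (HC _ (e0 n))); rewrite -AE.
  set A := cI mu _; rewrite -(normcN (A - L)) opprB.
  apply: le_trans _ (le_normcD _ _).
  by rewrite addrA subrK.
have limb : normc (cI mu (fun x => (gauge (e n) x)%:C *
    (fourier g x * character x xi)) - L) + (eta + e n * C) @[n --> \oo] -->
    0 + (eta + 0 * C).
  apply: cvgD => //; apply: cvgD; first exact: cvg_cst.
  by apply: cvgMr_tmp; exact: cvg_harmonic.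
rewrite mul0r addr0 add0r in limb.
rewrite -(cvg_lim _ limb)//; apply: limr_ge; last exact: nearW.
by apply/cvg_ex; exists eta.
Qed.

End inversion.

(** * Smooth, Schwartz and test functions *)

Section smooth_closure.
Context {R : realType}.
Local Notation V := (R^o * R^o)%type.

(** Restriction to a line turns directional derivatives into ordinary ones, so the one-variable
    chain rule covers compositions and reflections. *)
Lemma is_derive_line (f : V -> R^o) (x v : V) (d : R) :
  is_derive x v f d <-> is_derive (0 : R^o) 1 (fun h : R^o => f (h *: v + x)) d.
Proof.
have E : 'D_v f x = 'D_1 (fun h : R^o => f (h *: v + x)) 0.
  rewrite /derive; set g1 := fun h => h^-1 *: _; set g2 := fun h => h^-1 *: _.
  suff -> : g1 = g2 by [].
  by rewrite funeqE /g1 /g2 => h /=; rewrite addr0 scale0r add0r [_%:A]mulr1.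
split=> -[df fE].
  by apply: DeriveDef; [exact: (derivable1P f x v).1|rewrite -E].
by apply: DeriveDef; [exact: (derivable1P f x v).2|rewrite E].
Qed.

Lemma is_derive_chain (psi : R -> R) (f : V -> R^o) (x v : V) (a b : R) :
  is_derive (f x) 1 psi b -> is_derive x v f a ->
  is_derive x v (fun y => psi (f y) : R^o) (b * a).
Proof.
move=> dpsi /is_derive_line df; apply/is_derive_line.
apply: (is_derive_circ (h := psi) (f := fun h : R => f (h *: v + x)) (x := 0)) => //.
by rewrite scale0r add0r.
Qed.

Lemma is_derive_refl (a : V) (f : V -> R^o) (x v : V) (d : R) :
  is_derive (refl2 a x : V) v f d ->
  is_derive x v (fun y => f (refl2 a y)) (- d).
Proof.
move=> /is_derive_line df; apply/is_derive_line.
have -> : (fun h : R^o => f (refl2 a (h *: v + x))) =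
    (fun h : R^o => f ((-1 * h) *: v + (refl2 a x : V))).
  apply/funext => h; congr f; rewrite mulN1r /refl2; apply/eqP; rewrite xpair_eqE /=.
  by apply/andP; split; apply/eqP; rewrite [in LHS]opprD addrCA scaleNr.
have df' : is_derive (-1 * 0 : R) 1 (fun h : R => f (h *: v + (refl2 a x : V))) d.
  by rewrite mulr0.
apply: (is_derive_val (is_derive_circ df' (is_derive_lin 0 (-1)))).
by rewrite mulrN1.
Qed.

(** [psi n] is the n-th derivative of [psi 0]; carrying the whole sequence makes [gen_comp] stable
    under differentiation, by a shift of the index. *)
Definition smooth1 (psi : nat -> R -> R) : Prop :=
  forall n (t : R), is_derive t 1 (psi n) (psi n.+1 t).

(* Closed under partial derivatives, so that [smoothR] follows by induction on
   the word. *)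
Inductive smooth_gen : (V -> R^o) -> Prop :=
| gen_cst c : smooth_gen (fun=> c)
| gen_fst : smooth_gen fst
| gen_snd : smooth_gen snd
| gen_smooth f : smoothR f -> smooth_gen f
| gen_add f g : smooth_gen f -> smooth_gen g -> smooth_gen (fun x => f x + g x)
| gen_mul f g : smooth_gen f -> smooth_gen g -> smooth_gen (fun x => f x * g x)
| gen_refl a f : smooth_gen f -> smooth_gen (fun x => f (refl2 a x))
| gen_comp psi f : smooth1 psi -> smooth_gen f -> smooth_gen (fun x => psi 0%N (f x)).

Lemma continuous_refl2 (a : V) : continuous (fun x : V => refl2 a x : V).
Proof.
move=> x.
have c1 : (a.1 - y.1 : R^o) @[y --> x] --> (a.1 - x.1 : R^o).
  by apply: cvgB; [exact: cvg_cst|exact: cvg_fst].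
have c2 : (a.2 - y.2 : R^o) @[y --> x] --> (a.2 - x.2 : R^o).
  by apply: cvgB; [exact: cvg_cst|exact: cvg_snd].
exact: (cvg_pair c1 c2).
Qed.

Lemma partial_rcons w b (f : V -> R^o) :
  partial (rcons w b) f = partial w (fun x => derive f x (axis R b)).
Proof. by elim: w => //= c w ->. Qed.

Lemma smoothR_derive (f : V -> R^o) b : smoothR f ->
  smoothR (fun x => derive f x (axis R b)).
Proof. by move=> sf w; rewrite -partial_rcons; exact: sf. Qed.

Lemma smooth_gen_continuous f : smooth_gen f -> continuous f.
Proof.
elim=> {f}.
- by move=> c x; exact: cvg_cst.
- by move=> x; exact: cvg_fst.
- by move=> x; exact: cvg_snd.
- by move=> f sf; case: (sf [::]).
- by move=> f g _ cf _ cg x; apply: cvgD; [exact: cf|exact: cg].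
- by move=> f g _ cf _ cg x; apply: cvgM; [exact: cf|exact: cg].
- move=> a f _ cf x.
  by apply: (continuous_comp (f := fun x : V => refl2 a x : V)); [exact: continuous_refl2|exact: cf].
- move=> psi f dpsi _ cf x.
  apply: (continuous_comp (f := f) (g := psi 0%N)); first exact: cf.
  exact: (is_derive_continuous (dpsi 0%N)).
Qed.

Lemma smooth_gen_derive f b : smooth_gen f ->
  exists2 g, smooth_gen g & forall x, is_derive x (axis R b) f (g x).
Proof.
elim=> {f}.
- by move=> c; exists (fun=> 0); [exact: gen_cst|move=> x; exact: is_derive_cst].
- exists (fun=> (axis R b).1); first exact: gen_cst.
  move=> x; apply/is_derive_line => /=.
  rewrite -[X in is_derive _ _ _ X]addr0.
  apply: (is_derive_add (f := fun h => h * (axis R b).1)).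
  by under eq_fun do rewrite mulrC; exact: is_derive_lin.
- exists (fun=> (axis R b).2); first exact: gen_cst.
  move=> x; apply/is_derive_line => /=.
  rewrite -[X in is_derive _ _ _ X]addr0.
  apply: (is_derive_add (f := fun h => h * (axis R b).2)).
  by under eq_fun do rewrite mulrC; exact: is_derive_lin.
- move=> f sf; exists (fun x => derive f x (axis R b)).
    by apply: gen_smooth; exact: smoothR_derive.
  by move=> x; apply: derivableP; case: (sf [::]) => _; exact.
- move=> f g gf [f' gf' df] gg [g' gg' dg]; exists (fun x => f' x + g' x).
    exact: gen_add.
  by move=> x; exact: is_deriveD.
- move=> f g gf [f' gf' df] gg [g' gg' dg].
  exists (fun x => f x * g' x + g x * f' x).
    by apply: gen_add; exact: gen_mul.
  by move=> x; exact: is_deriveM.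
- move=> a f gf [f' gf' df]; exists (fun x => -1 * f' (refl2 a x)).
    by apply: gen_mul; [exact: gen_cst|exact: gen_refl].
  by move=> x; rewrite mulN1r; apply: is_derive_refl; exact: df.
- move=> psi f dpsi gf [f' gf' df]; exists (fun x => psi 1%N (f x) * f' x).
    apply: gen_mul => //; apply: (@gen_comp (fun n => psi n.+1)) => //.
  by move=> x; exact: is_derive_chain.
Qed.

Lemma gen_sum N (f : nat -> V -> R^o) : (forall n, smooth_gen (f n)) ->
  smooth_gen (fun x => \sum_(n < N) f n x).
Proof.
move=> gf; elim: N => [|N IH].
  have -> : (fun x => \sum_(n < 0) f n x) = fun=> 0.
    by apply/funext => x; rewrite big_ord0.
  exact: gen_cst.
have -> : (fun x => \sum_(n < N.+1) f n x) = fun x => \sum_(n < N) f n x + f N x.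
  by apply/funext => x; rewrite big_ord_recr.
exact: gen_add.
Qed.

Lemma smooth_genP f : smooth_gen f -> smoothR f.
Proof.
move=> gf; suff H w : smooth_gen (partial w f).
  move=> w; split; first exact: smooth_gen_continuous.
  by move=> x b; have [g _ /(_ x)[]] := smooth_gen_derive b (H w).
elim: w => [//|b w IH] /=.
have [g gg dg] := smooth_gen_derive b IH.
suff -> : (fun x => derive (partial w f : V -> R^o) x (axis R b)) = g by [].
by apply/funext => x; have [_ ->] := dg x.
Qed.

End smooth_closure.

(** * Continuity and Borel measurability on the plane *)

Section measurable_open.
Context {R : realType}.
Local Notation mT := (measurableTypeR R).
Local Notation P := (mT * mT)%type.
Local Notation V := (R^o * R^o)%type.

(** The sigma-algebra is the product one, so the open set is written as the countable union of the
    grid squares [B t] that it contains. *)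
Lemma open_measurable2 (O : set V) : open O -> measurable (O : set P).
Proof.
move=> oO.
pose B (t : nat * int * int) : set P :=
  ball (t.1.2%:~R / t.1.1.+1%:R : R) t.1.1.+1%:R^-1 `*`
  ball (t.2%:~R / t.1.1.+1%:R : R) t.1.1.+1%:R^-1.
have mB t : measurable (B t) by apply: measurableX; exact: measurable_ball.
have -> : (O : set P) = \bigcup_t (if `[< B t `<=` O >] then B t else set0).
  apply/seteqP; split=> [p Op|p [t _]]; last first.
    by case: asboolP => [BO|//]; exact: BO.
  have [e /= e0 pe] : exists2 e : R, 0 < e & forall q : V,
      ball p.1 e q.1 -> ball p.2 e q.2 -> O q.
    have := oO p Op; rewrite /interior -nbhs_ballE => -[e /= e0 He].
    by exists e => // q q1 q2; apply: He; split.
  (* Two points of a grid square of half-side [k.+1%:R^-1] differ by less than [2 / k.+1%:R <= e] in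
     each coordinate, so the square that contains [p] lies in [O]. *)
  pose k := Num.trunc (2 / e).
  have k0 : 0 < k.+1%:R :> R by [].
  have ke : 2 / k.+1%:R <= e.
    rewrite ler_pdivrMr// mulrC -ler_pdivrMr//.
    by apply: ltW; have /andP[] := truncn_itv (divr_ge0 (ler0n R 2) (ltW e0)).
  have fl (u : R) : ball ((Num.floor (u * k.+1%:R))%:~R / k.+1%:R : R) k.+1%:R^-1 u.
    rewrite /ball/= distrC ltr_norml.
    have /andP[h1 h2] := floor_itv (u * k.+1%:R).
    set F := Num.floor _ in h1 h2 *.
    have -> : u - F%:~R / k.+1%:R = (u * k.+1%:R - F%:~R) / k.+1%:R.
      by rewrite mulrBl mulfK// gt_eqF.
    apply/andP; split.
      apply: (@lt_le_trans _ _ 0); first by rewrite oppr_lt0 invr_gt0.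
      by rewrite divr_ge0// subr_ge0.
    rewrite -[ltRHS]mul1r ltr_pM2r ?invr_gt0// ltrBlDl.
    by move: h2; rewrite intrD.
  exists (k, Num.floor (p.1 * k.+1%:R), Num.floor (p.2 * k.+1%:R)) => //.
  case: asboolP => [_|nBO]; first by split => /=; exact: fl.
  exfalso; apply: nBO => q [/= q1 q2]; apply: pe.
    rewrite /ball/= in q1 *; apply: lt_le_trans ke.
    have := fl p.1; rewrite /ball/= => q1'.
    rewrite -(subrK ((Num.floor (p.1 * k.+1%:R))%:~R / k.+1%:R) p.1) -addrA.
    rewrite (le_lt_trans (ler_normD _ _))// mulr_natl mulr2n distrC ltrD//.
  rewrite /ball/= in q2 *; apply: lt_le_trans ke.
  have := fl p.2; rewrite /ball/= => q2'.
  rewrite -(subrK ((Num.floor (p.2 * k.+1%:R))%:~R / k.+1%:R) p.2) -addrA.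
  by rewrite (le_lt_trans (ler_normD _ _))// mulr_natl mulr2n distrC ltrD.
apply: countable_bigcupT_measurable => // t.
by case: ifP => // _; exact: mB.
Qed.

Lemma continuous_measurable2 (f : V -> R^o) : continuous f ->
  measurable_fun [set: P] (f : P -> mT).
Proof.
move=> /continuousP cf; apply: (measurability _ (RGenOpens.measurableE R)).
move=> _ [_ [a [b ->] <-]]; rewrite setTI; apply: open_measurable2.
by apply: cf; exact: interval_open.
Qed.

Lemma continuous_local (f : V -> R^o) (xi : V) (eta : R) : continuous f -> 0 < eta ->
  exists2 d : R, 0 < d & forall y : V, `|xi.1 - y.1| <= d -> `|xi.2 - y.2| <= d ->
    `|f y - f xi| <= eta.
Proof.
move=> cf eta0; have := cf xi => /cvgrPdist_le /(_ _ eta0).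
rewrite -nbhs_ballE => -[d /= d0 H]; exists (d / 2); first by rewrite divr_gt0.
move=> y y1 y2; rewrite distrC; apply: H; split; rewrite /ball/=.
  by apply: le_lt_trans y1 _; lra.
by apply: le_lt_trans y2 _; lra.
Qed.

End measurable_open.

(** * A smooth function that is flat at the origin *)

Section flat_function.
Context {R : realType}.

Lemma expR_ge_lin (c s : R) : 0 < c -> 0 <= s -> s <= c^-1 * expR (c * s).
Proof.
move=> c0 s0; rewrite mulrC ler_pdivlMr// mulrC.
by apply: le_trans (expR_ge1Dx _); rewrite lerDr.
Qed.

(** Induction along Horner's scheme: half of the exponent bounds the remaining polynomial, the other
    half absorbs the factor [s]. *)
Lemma poly_le_expR (p : {poly R}) (c : R) : 0 < c ->
  exists2 C, 0 <= C & forall s, 0 <= s -> `|p.[s]| <= C * expR (c * s).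
Proof.
elim/poly_ind: p c => [|p a IH] c c0.
  by exists 0 => // s s0; rewrite horner0 normr0 mul0r.
have c20 : 0 < c / 2 by rewrite divr_gt0.
have [C C0 HC] := IH _ c20.
have c20' : 0 <= (c / 2)^-1 by rewrite invr_ge0 ltW.
exists (C * (c / 2)^-1 + `|a|); first by rewrite addr_ge0// mulr_ge0.
move=> s s0; rewrite hornerMXaddC (le_trans (ler_normD _ _))// mulrDl lerD//.
  rewrite normrM (ger0_norm s0).
  have -> : C * (c / 2)^-1 * expR (c * s) =
      (C * expR (c / 2 * s)) * ((c / 2)^-1 * expR (c / 2 * s)).
    by rewrite [RHS]mulrACA -expRD; congr (_ * expR _); lra.
  by apply: ler_pM => //; [exact: HC|exact: expR_ge_lin].
by rewrite ler_peMr// -expR0 ler_expR mulr_ge0// ltW.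
Qed.

(** A family closed under differentiation, which contains [expR (- t^-1)] extended by 0; smoothness
    of the extension thus reduces to one derivative, taken for all [q] at once. *)
Definition flat (q : {poly R}) (t : R) : R :=
  if 0 < t then q.[t^-1] * expR (- t^-1) else 0.

Lemma flat_derive (q : {poly R}) (t : R) :
  is_derive t 1 (flat q) (flat ('X^2 * (q - q^`())) t).
Proof.
have [t0|t0|<-] := ltgtP 0 t.
- have di : is_derive t 1 (fun s : R => s^-1) (- t ^- 2).
    have t1 : t != 0 by rewrite gt_eqF.
    apply: (is_derive_val (is_deriveV (f := id) t1 (is_derive_id _ _))).
    by rewrite scaler1.
  have dq : is_derive t 1 (fun s : R => q.[s^-1]) (q^`().[t^-1] * (- t ^- 2)).
    exact: (is_derive_circ (h := horner q)).
  have dN : is_derive t 1 (fun s : R => - s^-1) (t ^- 2).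
    by rewrite -[X in is_derive _ _ _ X]opprK; exact: is_deriveN.
  have de : is_derive t 1 (fun s : R => expR (- s^-1)) (expR (- t^-1) * t ^- 2).
    exact: (is_derive_circ (h := expR)).
  have dF := is_derive_mul dq de.
  have dv := is_derive_val dF.
  apply: (@near_eq_is_derive R R^o R^o (fun s : R => q.[s^-1] * expR (- s^-1))).
  + near=> s; rewrite /flat ifT//; near: s; exact: lt_nbhsr.
  + apply: dv; rewrite /flat t0 !hornerE /=.
    by field; lra.
- apply: (@near_eq_is_derive R R^o R^o (fun _ : R => 0)).
  + near=> s; rewrite /flat ifF//; apply/negbTE; rewrite -leNgt ltW//.
    by near: s; exact: lt_nbhsl.
  + by rewrite /flat ltNge (ltW t0) /=; exact: is_derive_cst.
- have flat0 q' : flat q' 0 = 0 by rewrite /flat ltxx.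
  rewrite flat0.
  (* For [h > 0] and [u = h^-1] the difference quotient at 0 is [u * q.[u] * expR (- u)]; bounding
     [u ^+ 2 * q.[u]] by [C * expR u] leaves [C * u^-1 = C * h], which tends to 0. *)
  have [C C0 HC] := poly_le_expR ('X^2 * q) (@ltr01 R).
  have lim : (fun h => h^-1 *: ((flat q \o shift 0) (h *: 1) - flat q 0)) @ (0 : R)^' -->
      (0 : R).
    have hC : C * `|h| @[h --> (0 : R)^'] --> (0 : R).
      rewrite -[X in _ --> X](mulr0 C); apply: cvgMl_tmp; apply: cvg_within_filter.
      by have := @norm_continuous _ R^o (0 : R); rewrite /continuous_at normr0.
    apply/norm_cvg0P; apply: squeeze_cvgr (cvg_cst 0) hC.
    near=> h; rewrite normr_ge0 /=; have h0 : h != 0 by near: h; exact: nbhs_dnbhs_neq.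
    rewrite addr0 [h *: 1]mulr1 /flat ltxx subr0.
    have [hp|] := ltP 0 h; last by rewrite scaler0 normr0 mulr_ge0.
    have u0 : 0 < h^-1 by rewrite invr_gt0.
    have := HC _ (ltW u0); rewrite hornerM hornerXn mul1r (gtr0_norm hp).
    have hE : C * h = C * (h^-1)^-1 by rewrite invrK.
    rewrite hE; move: (h^-1) u0 => u u0 HCu.
    have -> : `|u *: (q.[u] * expR (- u))| =
        `|u ^+ 2 * q.[u]| * expR (- u) * u^-1.
      rewrite /GRing.scale/= !normrM (gtr0_norm (expR_gt0 _)) (gtr0_norm u0).
      by move: `|q.[u]| (expR (- u)) => a b; field; lra.
    have -> : C * u^-1 = C * expR u * expR (- u) * u^-1.
      by rewrite -(mulrA C) -expRD subrr expR0 mulr1.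
    by rewrite ler_wpM2r ?invr_ge0 ?(ltW u0)// ler_wpM2r ?expR_ge0.
  apply: DeriveDef; first by apply/cvg_ex; exists 0.
  exact/cvg_lim.
Unshelve. all: by end_near. Qed.

(* The [n]-th derivative of [expR (- t^-1)] is [(flat_poly n).[t^-1] * expR (- t^-1)]. *)
Fixpoint flat_poly (n : nat) : {poly R} :=
  if n is m.+1 then 'X^2 * (flat_poly m - (flat_poly m)^`()) else 1.

Definition flat1 (t : R) : R := flat 1 t.

Lemma smooth1_flat : smooth1 (fun n => flat (flat_poly n)).
Proof. by move=> n t; exact: flat_derive. Qed.

Lemma flat1E t : flat1 t = if 0 < t then expR (- t^-1) else 0.
Proof. by rewrite /flat1 /flat hornerC mul1r. Qed.

Lemma flat1_ge0 t : 0 <= flat1 t.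
Proof. by rewrite flat1E; case: ifP => // _; exact: expR_ge0. Qed.

Lemma flat1_le1 t : flat1 t <= 1.
Proof.
rewrite flat1E; case: ifP => // t0.
by rewrite -expR0 ler_expR oppr_le0 invr_ge0 ltW.
Qed.

Lemma flat1_le0 t : t <= 0 -> flat1 t = 0.
Proof. by move=> t0; rewrite flat1E ltNge t0. Qed.

Lemma flat1_gt0 t : 0 < t -> 0 < flat1 t.
Proof. by move=> t0; rewrite flat1E t0 expR_gt0. Qed.

End flat_function.

Section line_derivative.
Context {R : realType}.
Local Notation mT := (measurableTypeR R).
Local Notation lm := (@lebesgue_measure R).

(** The fundamental theorem on growing symmetric intervals: the decay of [u] kills the boundary
    terms, and integrability of [u'] lets the integrals converge to the one over the line. *)
Lemma Rintegral_derivative (u u' : R -> R) (M : R) :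
  (forall t : R, is_derive t 1 u (u' t)) -> continuous u' ->
  lm.-integrable setT (EFin \o u') ->
  (forall t, `|u t| <= M / (1 + t ^+ 2)) ->
  Rintegral lm setT u' = 0.
Proof.
move=> du cu' Iu' uM.
pose I n : set mT := `[- n.+1%:R, n.+1%:R]%classic.
have mI n : measurable (I n) by exact: measurable_itv.
have FTC n : (\int[lm]_(t in I n) (u' t)%:E = (u n.+1%:R - u (- n.+1%:R))%:E)%E.
  rewrite EFinB; apply: continuous_FTC2.
  - by rewrite gtrN.
  - exact: continuous_subspaceT.
  - have cu := is_derive_continuous du.
    split; first by move=> t _; have [] := du t.
      by apply: cvg_at_right_filter; exact: cu.
    by apply: cvg_at_left_filter; exact: cu.
  - by move=> t _; rewrite derive1E; have [_ ->] := du t.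
have cI0 : (fun n => \int[lm]_(t in I n) (u' t)%:E)%E @ \oo --> (\int[lm]_t (u' t)%:E)%E.
  have E n : (\int[lm]_(t in I n) (u' t)%:E = \int[lm]_t ((EFin \o u') \_ (I n)) t)%E.
    by rewrite integral_mkcond.
  under eq_fun do rewrite E.
  have [] // := @dominated_convergence _ _ _ lm setT measurableT
    (fun n => (EFin \o u') \_ (I n)) (EFin \o u') (fun t => `|(u' t)%:E|%E).
  - move=> n; apply/(measurable_restrictT _ (mI n)).
    exact: measurable_funTS (measurable_int _ Iu').
  - exact: measurable_int Iu'.
  - apply: nearW => t _; apply: cvg_near_cst.
    exists (Num.trunc `|t|) => // n /= tn.
    rewrite patchE mem_set// /I /= in_itv/= -ler_norml.
    apply: le_trans (_ : (Num.trunc `|t|).+1%:R <= _).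
      by apply/ltW; have /andP[] := truncn_itv (normr_ge0 t).
    by rewrite ler_nat ltnS.
  - exact: integrable_abse.
  - apply: nearW => t n _; rewrite patchE; case: ifP => // _.
    by rewrite abse0.
have lim0 : u n.+1%:R - u (- n.+1%:R) @[n --> \oo] --> (0 : R).
  have bnd n : `|u n.+1%:R - u (- n.+1%:R)| <= (2 * M) * n.+1%:R^-1.
    have M0 : 0 <= M.
      have := le_trans (normr_ge0 _) (uM 0).
      by rewrite expr0n addr0 divr1.
    have step (t : R) : 1 <= `|t| -> `|u t| <= M * `|t|^-1.
      move=> t1; apply: le_trans (uM t) _; rewrite ler_wpM2l//.
      have t0 : 0 < `|t| by exact: lt_le_trans t1.
      rewrite lef_pV2 ?posrE// ?ltr_wpDr ?sqr_ge0//.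
      by rewrite -real_normK ?num_real//; nra.
    have n1 : 1 <= `|n.+1%:R : R| by rewrite ger0_norm// ler1n.
    rewrite (le_trans (ler_normB _ _))//.
    have := step _ n1; have := step (- n.+1%:R); rewrite normrN => /(_ n1).
    rewrite (@ger0_norm _ n.+1%:R)//; move: n.+1%:R^-1 => a h1 h2.
    by rewrite mulr_natl mulr2n mulrDl addrC lerD.
  apply/norm_cvg0P; apply: (@squeeze_cvgr _ _ _ _ (cst 0) (fun n => (2 * M) * n.+1%:R^-1)).
  - by apply: nearW => n; rewrite normr_ge0 bnd.
  - exact: cvg_cst.
  - by rewrite -[X in _ --> X](mulr0 (2 * M)); apply: cvgMl_tmp; exact: cvg_harmonic.
have cI1 : (fun n => \int[lm]_(t in I n) (u' t)%:E)%E @ \oo --> (0%:E : \bar R).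
  under eq_fun do rewrite FTC.
  by apply/fine_cvgP; split; [exact: nearW|exact: lim0].
rewrite /Rintegral.
by rewrite (cvg_unique _ cI0 cI1).
Qed.

End line_derivative.

(** * Decay of Schwartz functions and transforms of their derivatives *)

Section schwartz_functions.
Context {R : realType}.
Local Notation mT := (measurableTypeR R).
Local Notation P := (mT * mT)%type.
Local Notation V := (R^o * R^o)%type.
Local Notation mu := (leb2 R).
Local Notation lm := (@lebesgue_measure R).
Implicit Types g : P -> R[i].

Definition weight (x : P) : R := (1 + x.1 ^+ 2)^-1 * (1 + x.2 ^+ 2)^-1.

(** The factors of [weight] are Poisson kernels up to a constant, so their integrability is already
    known. *)
Lemma inv1sqr_poisson (t : R) : (1 + t ^+ 2)^-1 = pi * poisson (2 * pi) t.
Proof.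
have p0 : 0 < pi :> R := pi_gt0 R.
rewrite /poisson; move: (pi : R) p0 => p p0.
have D : 0 < 1 + t ^+ 2 by rewrite ltr_pwDl ?sqr_ge0.
have -> : (2 * p) ^+ 2 + (2 * p * t) ^+ 2 = (2 * p) ^+ 2 * (1 + t ^+ 2) by ring.
by field; rewrite !gt_eqF.
Qed.

Lemma integrable_inv1sqr : lm.-integrable setT (EFin \o (fun t : R => (1 + t ^+ 2)^-1)).
Proof.
have p0 : 0 < 2 * pi :> R by rewrite mulr_gt0// pi_gt0.
under [_ \o _]eq_fun do rewrite /= inv1sqr_poisson EFinM.
apply: integrableZl => //; apply/integrableP; split.
  by apply/measurable_EFinP; apply: continuous_measurable_fun; exact: continuous_poisson.
under eq_integral do rewrite /= ger0_norm ?poisson_ge0//.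
by rewrite integral_poisson0// ltry.
Qed.

Lemma weight_gt0 x : 0 < weight x.
Proof. by rewrite mulr_gt0 ?invr_gt0// ltr_pwDl ?sqr_ge0. Qed.

Lemma integrable_weight : mu.-integrable setT (EFin \o weight).
Proof.
apply: (@integrable_prod_mul _ _ mT mT R lm lm (fun t => (1 + t ^+ 2)^-1)
  (fun t => (1 + t ^+ 2)^-1)); exact: integrable_inv1sqr.
Qed.

Lemma weight_le1 x : weight x <= 1.
Proof.
by rewrite mulr_ile1 ?invr_ge0 ?invf_le1 ?lerDl ?addr_ge0 ?sqr_ge0// ltr_pwDl ?sqr_ge0.
Qed.

Lemma enorm_sqr (x : P) : enorm x ^+ 2 = x.1 ^+ 2 + x.2 ^+ 2.
Proof. by rewrite sqr_sqrtr /dot -!expr2// addr_ge0 ?sqr_ge0. Qed.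

Lemma enorm_ge0 (x : P) : 0 <= enorm x.
Proof. exact: sqrtr_ge0. Qed.

(** Each factor of the inverse weight is at most [(1 + enorm x) ^+ 2], whence the exponent 4. *)
Lemma weight_enorm (x : P) (a M : R) : 0 <= a ->
  (1 + enorm x) ^+ 4 * a <= M -> a <= M * weight x.
Proof.
move=> a0 H.
have D1 : 0 < 1 + x.1 ^+ 2 by rewrite ltr_pwDl ?sqr_ge0.
have D2 : 0 < 1 + x.2 ^+ 2 by rewrite ltr_pwDl ?sqr_ge0.
rewrite /weight -invfM ler_pdivlMr ?mulr_gt0//; apply: le_trans _ H.
rewrite mulrC ler_wpM2r//.
have e0 := enorm_ge0 x; have e2 := enorm_sqr x.
have h1 : 1 + x.1 ^+ 2 <= (1 + enorm x) ^+ 2.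
  by have := sqr_ge0 x.2; rewrite sqrrD expr1n mul1r e2; lra.
have h2 : 1 + x.2 ^+ 2 <= (1 + enorm x) ^+ 2.
  by have := sqr_ge0 x.1; rewrite sqrrD expr1n mul1r e2; lra.
rewrite (_ : (1 + enorm x) ^+ 4 = (1 + enorm x) ^+ 2 * (1 + enorm x) ^+ 2).
  by apply: ler_pM => //; exact: ltW.
by rewrite -exprD.
Qed.

Lemma schwartz_decay g : schwartz g ->
  exists2 M, 0 <= M & forall x, normc (g x) <= M * weight x.
Proof.
move=> [_ /(_ 4%N [::])[M HM]]; exists M.
  apply: le_trans (HM point); rewrite mulr_ge0 ?normc_ge0// exprn_ge0// addr_ge0//.
  exact: enorm_ge0.
move=> x; apply: weight_enorm; first exact: normc_ge0.
by have := HM x; rewrite /cpartial /=; case: (g x).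
Qed.

Lemma smooth_cmeas g : smooth g -> cmeas g.
Proof.
move=> [sr si]; split.
  by apply: continuous_measurable2; case: (sr [::]).
by apply: continuous_measurable2; case: (si [::]).
Qed.

Lemma smooth_locally_continuous g xi : smooth g -> locally_continuous g xi.
Proof.
move=> [sr si] eta eta0; have e2 : 0 < eta / 2 by rewrite divr_gt0.
have [cr _] := sr [::]; have [ci _] := si [::].
have [d1 d10 H1] := continuous_local xi cr e2.
have [d2 d20 H2] := continuous_local xi ci e2.
exists (Num.min d1 d2); first by rewrite lt_min d10.
move=> y; rewrite !le_min => /andP[y1 y1'] /andP[y2 y2'].
apply: le_trans (normc_le_ReIm _) _; rewrite cReD cReN cImD cImN.
have := H1 y y1 y2; have := H2 y y1' y2'; rewrite /=; lra.
Qed.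

Lemma decay_cinteg g (M : R) : cmeas g ->
  (forall x, normc (g x) <= M * weight x) -> cinteg mu g.
Proof.
move=> mg gM; apply: (le_cinteg (g := fun x => M * weight x)) => //.
by apply: integrable_scale; exact: integrable_weight.
Qed.

Lemma schwartz_cinteg g : schwartz g -> cinteg mu g.
Proof.
move=> sg; have [M _ HM] := schwartz_decay sg.
by apply: decay_cinteg HM; apply: smooth_cmeas; case: sg.
Qed.

Lemma schwartz_bounded g : schwartz g ->
  exists2 M, 0 <= M & forall x, normc (g x) <= M.
Proof.
move=> /schwartz_decay[M M0 HM]; exists M => // x; apply: le_trans (HM x) _.
by rewrite ler_piMr// weight_le1.
Qed.

Lemma cinteg_sqnorm g (B : R) : cinteg mu g -> (forall x, normc (g x) <= B) ->
  (sqnorm g < +oo)%E.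
Proof.
move=> Ig gB.
have : mu.-integrable setT (fun x => (B * normc (g x))%:E).
  exact/integrable_scale/cinteg_normc.
move=> /integrable_lty => /(_ measurableT); apply: le_lt_trans.
apply: ge0_le_integral => //.
- by move=> x _; rewrite lee_fin sqr_ge0.
- exact: measurable_normc_sqr (cmeas_cinteg Ig).
- apply/measurable_EFinP; apply: measurable_funM => //.
  exact/cmeas_normc/(cmeas_cinteg Ig).
- by move=> x _; rewrite lee_fin expr2 ler_wpM2r// normc_ge0.
Qed.

Lemma schwartz_cpartial g b : schwartz g -> schwartz (cpartial [:: b] g).
Proof.
move=> [[sr si] dec]; split; first by split; exact: smoothR_derive.
move=> N w; have [M HM] := dec N (rcons w b); exists M => x.
by have := HM x; rewrite /cpartial !partial_rcons.
Qed.

Definition slice b (x t : R) : V := if b then (x, t) else (t, x).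

Lemma is_derive_slice (U : V -> R^o) b (x t d : R) :
  is_derive (slice b x t) (axis R b) U d -> is_derive t 1 (fun y : R => U (slice b x y)) d.
Proof.
move=> /is_derive_line dU.
have dt : is_derive (t + - t : R) 1 (fun h : R => U (h *: axis R b + slice b x t)) d.
  by rewrite subrr.
have dT : is_derive t 1 (fun y : R => y + - t) (1 + 0).
  by apply: (is_derive_add (f := id) (g := fun=> - t)).
have := is_derive_val (is_derive_circ (f := fun y : R => y + - t) (x := t) dt dT).
rewrite addr0 mulr1 => /(_ _ erefl).
congr (is_derive _ _ _ _); apply/funext => y; congr U; rewrite /axis.
by apply/eqP; case: b {dt dU}; rewrite xpair_eqE /= scaler0 add0r eqxx [_ *: _]mulr1 subrK eqxx.
Qed.

Lemma continuous_slice (U : V -> R^o) b (x : R) : continuous U ->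
  continuous (fun y : R => U (slice b x y)).
Proof.
move=> cU y; have c1 : (x : R^o) @[z --> (y : R)] --> (x : R^o) by exact: cvg_cst.
have c2 : (z : R^o) @[z --> (y : R)] --> (y : R^o) by exact: cvg_id.
case: b; first exact: (cvg_comp _ _ (cvg_pair c1 c2) (cU (x, y))).
exact: (cvg_comp _ _ (cvg_pair c2 c1) (cU (y, x))).
Qed.

(** Integrating first along the lines in the direction of the derivative gives 0 on each of them;
    the bounds by [weight] supply both the decay along lines and Fubini's theorem. *)
Lemma Rintegral_partial (U U' : P -> R) (M : R) b :
  (forall x : V, is_derive x (axis R b) (U : V -> R^o) (U' x)) ->
  continuous (U' : V -> R^o) ->
  (forall x, `|U x| <= M * weight x) -> (forall x, `|U' x| <= M * weight x) ->
  Rintegral mu setT U' = 0.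
Proof.
move=> dU cU' UM U'M.
have IU' : mu.-integrable setT (EFin \o U').
  apply: le_integrable (integrable_scale M integrable_weight) => //.
    by apply/measurable_EFinP; exact: continuous_measurable2.
  move=> x _ /=; rewrite lee_fin; apply: le_trans (U'M x) _; exact: ler_norm.
have M0 : 0 <= M.
  have := le_trans (normr_ge0 _) (UM point).
  by rewrite pmulr_lge0// weight_gt0.
have inv01 (s : R) : 0 <= (1 + s ^+ 2)^-1 <= 1.
  by rewrite invr_ge0 invf_le1 ?lerDl ?addr_ge0 ?sqr_ge0// ltr_pwDl ?sqr_ge0.
have wle (x y : R) : M * weight (slice b x y) <= M / (1 + y ^+ 2).
  rewrite ler_wpM2l// /weight; have /andP[x0 x1] := inv01 x; have /andP[y0 y1] := inv01 y.
  by case: b {dU}; rewrite /= ?ler_piMl// ler_piMr.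
have line x : Rintegral lm setT (fun t : mT => U' (slice b x t)) = 0.
  have cx := continuous_slice (b := b) (x := x) cU'.
  apply: (@Rintegral_derivative _ (fun y => U (slice b x y)) _ M) => //.
  - by move=> t; apply: is_derive_slice; exact: dU.
  - apply: le_integrable (integrable_scale M integrable_inv1sqr) => //.
      by apply/measurable_EFinP; exact: continuous_measurable_fun.
    move=> t _ /=; rewrite lee_fin; apply: le_trans (U'M _) _.
    by apply: le_trans (wle _ _) _; exact: ler_norm.
  - by move=> t; apply: le_trans (UM _) _; exact: wle.
case: b line {dU wle} => line.
  rewrite -(Rintegral_fubini1 (m1 := lm) (m2 := lm) IU').
  by rewrite [X in Rintegral _ _ X](funext line) Rintegral_cst// mul0r.
rewrite -(Rintegral_fubini2 (m1 := lm) (m2 := lm) IU').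
by rewrite [X in Rintegral _ _ X](funext line) Rintegral_cst// mul0r.
Qed.

Definition coord b (x : P) : R := if b then x.2 else x.1.

(** Integration by parts: the partial derivative of [g] times the conjugate character has integral
    0. The identity is kept to moduli, which is what the squared norms see. *)
Lemma normc_fourier_cpartial g b xi : schwartz g ->
  normc (fourier (cpartial [:: b] g) xi) =
  `|2 * pi * coord b xi| * normc (fourier g xi).
Proof.
move=> sg; have sg' := schwartz_cpartial b sg.
set c := 2 * pi * coord b xi.
have [[sr si] _] := sg.
pose gr : V -> R^o := fun x => Re (g x); pose gi : V -> R^o := fun x => Im (g x).
pose gr' x := derive gr x (axis R b); pose gi' x := derive gi x (axis R b).
pose th (y : V) : R^o := 2 * pi * dot y xi.
have genth : smooth_gen th.
  rewrite /th /dot; apply: gen_mul; first exact: gen_cst.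
  by apply: gen_add; apply: gen_mul; [exact: gen_fst|exact: gen_cst
    |exact: gen_snd|exact: gen_cst].
have dth x : is_derive x (axis R b) th c.
  apply/is_derive_line.
  have -> : (fun h : R^o => th (h *: axis R b + x)) = fun h : R => c * h + th x.
    apply/funext => h; rewrite /th /dot /c /coord /axis.
    by case: (b) => /=; rewrite scaler0 add0r [h%:A]mulr1; ring.
  rewrite -[X in is_derive _ _ _ X]addr0.
  by apply: (is_derive_add (f := fun h => c * h)); exact: is_derive_lin.
have dgr x : is_derive x (axis R b) gr (gr' x).
  by apply: derivableP; case: (sr [::]) => _; exact.
have dgi x : is_derive x (axis R b) gi (gi' x).
  by apply: derivableP; case: (si [::]) => _; exact.
have dcos x : is_derive x (axis R b) (fun y => cos (th y) : R^o) (- sin (th x) * c).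
  by apply: (is_derive_chain (psi := cos)).
have dsin x : is_derive x (axis R b) (fun y => sin (th y) : R^o) (cos (th x) * c).
  by apply: (is_derive_chain (psi := sin)).
have [M M0 HM] := schwartz_decay sg; have [M' M'0 HM'] := schwartz_decay sg'.
have cgr : continuous gr by case: (sr [::]).
have cgi : continuous gi by case: (si [::]).
have cgr' : continuous gr' by case: (sr [:: b]).
have cgi' : continuous gi' by case: (si [:: b]).
have cth : continuous th := smooth_gen_continuous genth.
have ccos : continuous (fun y => cos (th y) : R^o).
  by move=> x; apply: (continuous_comp (f := th) (g := cos)); [exact: cth|exact: continuous_cos].
have csin : continuous (fun y => sin (th y) : R^o).
  by move=> x; apply: (continuous_comp (f := th) (g := sin)); [exact: cth|exact: continuous_sin].
have ReE x : Re (g x * (character x xi)^*) = gr x * cos (th x) + gi x * sin (th x).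
  by rewrite cReM /character /expi /th /=; ring.
have ImE x : Im (g x * (character x xi)^*) = gi x * cos (th x) - gr x * sin (th x).
  by rewrite cImM /character /expi /th /=; ring.
have ReE' x : Re (cpartial [:: b] g x * (character x xi)^*) =
    gr' x * cos (th x) + gi' x * sin (th x).
  by rewrite cReM /character /expi /th /= mulrN opprK.
have ImE' x : Im (cpartial [:: b] g x * (character x xi)^*) =
    gi' x * cos (th x) - gr' x * sin (th x).
  by rewrite cImM /character /expi /th /= mulrN addrC.
have Ig := cinteg_characterJ xi (schwartz_cinteg sg).
have Ig' := cinteg_characterJ xi (schwartz_cinteg sg').
have bg x : normc (g x * (character x xi)^*) <= M * weight x.
  by rewrite normcM normc_characterJ mulr1.
have bg' x : normc (cpartial [:: b] g x * (character x xi)^*) <= M' * weight x.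
  by rewrite normcM normc_characterJ mulr1.
pose B := M' + `|c| * M + M.
have BM x : M * weight x <= B * weight x.
  rewrite ler_wpM2r ?(ltW (weight_gt0 _))// /B lerDr addr_ge0// mulr_ge0//.
have BM' x : M' * weight x + `|c| * (M * weight x) <= B * weight x.
  by rewrite (mulrA `|c|) -mulrDl ler_wpM2r ?(ltW (weight_gt0 _))// /B lerDl.
have val (U : V -> R^o) x a a' : is_derive x (axis R b) U a -> a = a' ->
    is_derive x (axis R b) U a' by move=> + <-.
(* [U1] and [U2] are the real and imaginary parts of [g] times the conjugate character, [U1'] and
   [U2'] those of its derivative; differentiating the character produces the factor [- i * c], which
   mixes the two parts. *)
pose U1 (x : P) : R := Re (g x * (character x xi)^*).
pose U2 (x : P) : R := Im (g x * (character x xi)^*).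
pose U1' (x : P) : R := Re (cpartial [:: b] g x * (character x xi)^*) + c * U2 x.
pose U2' (x : P) : R := Im (cpartial [:: b] g x * (character x xi)^*) - c * U1 x.
have U1E : U1 = fun x => gr x * cos (th x) + gi x * sin (th x).
  by apply/funext => x; exact: ReE.
have U2E : U2 = fun x => gi x * cos (th x) - gr x * sin (th x).
  by apply/funext => x; exact: ImE.
have U1'E : U1' = fun x => gr' x * cos (th x) + gi' x * sin (th x) + c * U2 x.
  by apply/funext => x; rewrite /U1' ReE'.
have U2'E : U2' = fun x => gi' x * cos (th x) - gr' x * sin (th x) - c * U1 x.
  by apply/funext => x; rewrite /U2' ImE'.
have cU1 : continuous (U1 : V -> R^o).
  rewrite U1E => x; apply: cvgD; apply: cvgM;
    [exact: cgr|exact: ccos|exact: cgi|exact: csin].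
have cU2 : continuous (U2 : V -> R^o).
  rewrite U2E => x; apply: cvgB; apply: cvgM;
    [exact: cgi|exact: ccos|exact: cgr|exact: csin].
have R0 : Rintegral mu setT U1' = 0.
  have dU (x : V) : is_derive x (axis R b) (U1 : V -> R^o) (U1' x).
    rewrite U1E U1'E U2E.
    apply: (val _ _ _ _ (is_deriveD (is_deriveM (dgr x) (dcos x))
      (is_deriveM (dgi x) (dsin x)))).
    by rewrite /GRing.scale /=; ring.
  apply: (Rintegral_partial (M := B) dU).
  - rewrite U1'E => x; apply: cvgD.
      by apply: cvgD; apply: cvgM; [exact: cgr'|exact: ccos|exact: cgi'|exact: csin].
    by apply: cvgMl_tmp; exact: cU2.
  - by move=> x; rewrite (le_trans (Re_le_normc _))// (le_trans (bg x)).
  - move=> x; rewrite (le_trans (ler_normD _ _))// (le_trans _ (BM' x))// lerD//.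
      by rewrite (le_trans (Re_le_normc _)).
    by rewrite normrM ler_wpM2l// (le_trans (Im_le_normc _)).
have I0 : Rintegral mu setT U2' = 0.
  have dU (x : V) : is_derive x (axis R b) (U2 : V -> R^o) (U2' x).
    rewrite U2E U2'E U1E.
    apply: (val _ _ _ _ (is_deriveB (is_deriveM (dgi x) (dcos x))
      (is_deriveM (dgr x) (dsin x)))).
    by rewrite /GRing.scale /=; ring.
  apply: (Rintegral_partial (M := B) dU).
  - rewrite U2'E => x; apply: cvgB.
      by apply: cvgB; apply: cvgM; [exact: cgi'|exact: ccos|exact: cgr'|exact: csin].
    by apply: cvgMl_tmp; exact: cU1.
  - by move=> x; rewrite (le_trans (Im_le_normc _))// (le_trans (bg x)).
  - move=> x; rewrite (le_trans (ler_normB _ _))// (le_trans _ (BM' x))// lerD//.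
      by rewrite (le_trans (Im_le_normc _)).
    by rewrite normrM ler_wpM2l// (le_trans (Re_le_normc _)).

case: Ig => Igr Igi; case: Ig' => Igr' Igi'.
move: R0; rewrite RintegralD// ?RintegralZl//; last exact: integrable_scale.
move: I0; rewrite RintegralB// ?RintegralZl//; last exact: integrable_scale.
rewrite -!Re_cI -!Im_cI -!fourierE => /eqP; rewrite subr_eq0 => /eqP I0 /eqP.
rewrite addr_eq0 => /eqP R0.
have key (p q k : R) : Num.sqrt ((- (k * q)) ^+ 2 + (k * p) ^+ 2) =
    `|k| * Num.sqrt (p ^+ 2 + q ^+ 2).
  rewrite sqrrN !exprMn -mulrDr sqrtrM ?sqr_ge0// sqrtr_sqr.
  by rewrite [X in Num.sqrt X]addrC.
by rewrite !normcE I0 R0 key.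
Qed.

End schwartz_functions.

(** * Integrability of the Fourier transform of a Schwartz function *)

Section fourier_integrability.
Context {R : realType}.
Local Notation mT := (measurableTypeR R).
Local Notation P := (mT * mT)%type.
Local Notation mu := (leb2 R).
Implicit Types g : P -> R[i].

Lemma ge0_integralZ_EFin (f : P -> R) (k : R) : measurable_fun setT f ->
  (forall x, 0 <= f x) -> 0 <= k ->
  (\int[mu]_x (k * f x)%:E = k%:E * \int[mu]_x (f x)%:E)%E.
Proof.
move=> mf f0 k0; under eq_integral do rewrite EFinM.
rewrite ge0_integralZl//; first exact/measurable_EFinP.
by move=> x _; rewrite lee_fin.
Qed.

Lemma ge0_integralD_EFin (f g : P -> R) : measurable_fun setT f -> measurable_fun setT g ->
  (forall x, 0 <= f x) -> (forall x, 0 <= g x) ->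
  (\int[mu]_x (f x + g x)%:E = \int[mu]_x (f x)%:E + \int[mu]_x (g x)%:E)%E.
Proof.
move=> mf mg f0 g0; under eq_integral do rewrite EFinD.
rewrite ge0_integralD//.
- by move=> x _; rewrite lee_fin.
- exact/measurable_EFinP.
- by move=> x _; rewrite lee_fin.
- exact/measurable_EFinP.
Qed.

(* Cauchy-Schwarz against the weight [(1 + (2 pi r x1)^2) (1 + (2 pi r x2)^2)],
   in the additive form of AM-GM with parameter [l]. *)
Lemma fourier_L1_bound g (r l s0 s1 s2 s3 : R) : schwartz g -> 0 < r -> 0 < l ->
  (sqnorm g <= s0%:E)%E ->
  (sqnorm (cpartial [:: false] g) <= s1%:E)%E ->
  (sqnorm (cpartial [:: true] g) <= s2%:E)%E ->
  (sqnorm (cpartial [:: false] (cpartial [:: true] g)) <= s3%:E)%E ->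
  (\int[mu]_x (normc (fourier g x))%:E <=
   (2^-1 * (l / (4 * r ^+ 2) +
     l^-1 * (s0 + r ^+ 2 * s1 + r ^+ 2 * s2 + r ^+ 4 * s3)))%:E)%E.
Proof.
move=> sg r0 l0 h0 h1 h2 h3.
have sg2 := schwartz_cpartial true sg.
have sg1 := schwartz_cpartial false sg.
have sg3 := schwartz_cpartial false sg2.
pose n x := normc (fourier g x).
pose sq (u : P -> R[i]) x := normc (fourier u x) ^+ 2.
have msq u : schwartz u -> measurable_fun setT (sq u).
  by move=> su; apply/measurable_funX/cmeas_normc/cmeas_fourier/schwartz_cinteg.
have sq0 u x : 0 <= sq u x by exact: sqr_ge0.
have Isq u : schwartz u -> (\int[mu]_x (sq u x)%:E <= sqnorm u)%E.
  by move=> su; apply: plancherel_le; exact: schwartz_cinteg.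
have rV0 : 0 < r^-1 by rewrite invr_gt0.
(* The weight is [4 * r ^+ 2 / q x]; since the Poisson kernel [q] has mass 1, the inverse weight has
   integral [(4 * r ^+ 2)^-1]. *)
pose q x := poisson2 r^-1 (refl2 (0, 0) x).
have q0 x : 0 <= q x by rewrite poisson2_ge0.
have mq : measurable_fun setT q.
  by apply: measurable_poisson2 => //; exact: measurable_refl2.
pose S x := sq g x + r ^+ 2 * sq (cpartial [:: false] g) x +
  r ^+ 2 * sq (cpartial [:: true] g) x +
  r ^+ 4 * sq (cpartial [:: false] (cpartial [:: true] g)) x.
have mZ k (f : P -> R) : measurable_fun setT f -> measurable_fun setT (fun x => k * f x).
  by move=> mf; exact: measurable_funM.
have mS : measurable_fun setT S.
  apply: measurable_funD; last by apply: mZ; exact: msq.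
  apply: measurable_funD; last by apply: mZ; exact: msq.
  by apply: measurable_funD; [exact: msq|apply: mZ; exact: msq].
have r2 : 0 <= r ^+ 2 by exact: sqr_ge0.
have r4 : 0 <= r ^+ 4 by rewrite exprn_ge0 ?(ltW r0).
have S0 x : 0 <= S x by rewrite !addr_ge0// mulr_ge0.
have IS : (\int[mu]_x (S x)%:E <= (s0 + r ^+ 2 * s1 + r ^+ 2 * s2 + r ^+ 4 * s3)%:E)%E.
  pose G0 := sq g.
  pose G1 x := r ^+ 2 * sq (cpartial [:: false] g) x.
  pose G2 x := r ^+ 2 * sq (cpartial [:: true] g) x.
  pose G3 x := r ^+ 4 * sq (cpartial [:: false] (cpartial [:: true] g)) x.
  have m0 : measurable_fun setT G0 by exact: msq.
  have m1 : measurable_fun setT G1 by apply: mZ; exact: msq.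
  have m2 : measurable_fun setT G2 by apply: mZ; exact: msq.
  have m3 : measurable_fun setT G3 by apply: mZ; exact: msq.
  have p0 x : 0 <= G0 x by exact: sq0.
  have p1 x : 0 <= G1 x by rewrite mulr_ge0.
  have p2 x : 0 <= G2 x by rewrite mulr_ge0.
  have p3 x : 0 <= G3 x by rewrite mulr_ge0.
  have Z k u s : 0 <= k -> schwartz u -> (sqnorm u <= s%:E)%E ->
      (\int[mu]_x (k * sq u x)%:E <= (k * s)%:E)%E.
    move=> k0 su us; rewrite (ge0_integralZ_EFin (msq _ su) (sq0 u) k0) EFinM.
    apply: lee_wpmul2l; first by rewrite lee_fin.
    exact: le_trans (Isq _ su) us.
  have D01 : measurable_fun setT (fun x => G0 x + G1 x)
    by exact: (measurable_funD m0 m1).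
  have D012 : measurable_fun setT (fun x => G0 x + G1 x + G2 x).
    exact: (measurable_funD D01 m2).
  have q01 x : 0 <= G0 x + G1 x by exact: addr_ge0 (p0 x) (p1 x).
  have q012 x : 0 <= G0 x + G1 x + G2 x by exact: addr_ge0 (q01 x) (p2 x).
  have -> : (\int[mu]_x (S x)%:E = \int[mu]_x (G0 x)%:E + \int[mu]_x (G1 x)%:E +
      \int[mu]_x (G2 x)%:E + \int[mu]_x (G3 x)%:E)%E.
    rewrite -(ge0_integralD_EFin m0 m1 p0 p1) -(ge0_integralD_EFin D01 m2 q01 p2).
    by rewrite -(ge0_integralD_EFin D012 m3 q012 p3).
  rewrite !EFinD; apply: leeD; last exact: Z.
  apply: leeD; last exact: Z.
  by apply: leeD; [exact: le_trans (Isq _ sg) h0|exact: Z].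
have nE b (u : P -> R[i]) (x : P) : schwartz u -> normc (fourier (cpartial [:: b] u) x) =
    `|2 * pi * coord b x| * normc (fourier u x) by exact: normc_fourier_cpartial.
(* With [W] the weight and [m = n x], AM-GM reads [m <= (l / W + W * m ^+ 2 / l) / 2], and
   [S x = W * m ^+ 2] by the rule for transforms of derivatives. It is proved by completing the
   square. *)
have main x : n x <= 2^-1 * (l / (4 * r ^+ 2)) * q x + 2^-1 * l^-1 * S x.
  pose a1 := (2 * pi * x.1) ^+ 2; pose a2 := (2 * pi * x.2) ^+ 2.
  have SE : S x = (1 + r ^+ 2 * a1) * (1 + r ^+ 2 * a2) * n x ^+ 2.
    have sqE b (u : P -> R[i]) : schwartz u ->
        sq (cpartial [:: b] u) x = (2 * pi * coord b x) ^+ 2 * sq u x.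
      by move=> su; rewrite /sq (nE b u x su) exprMn real_normK ?num_real.
    rewrite /S (sqE _ _ sg) (sqE _ _ sg2) (sqE _ _ sg) -[coord false x]/(x.1)
      -[coord true x]/(x.2) -/a1 -/a2 -[sq g x]/(n x ^+ 2).
    by move: a1 a2 (n x) => b1 b2 m; ring.
  have a10 : 0 <= a1 by exact: sqr_ge0.
  have a20 : 0 <= a2 by exact: sqr_ge0.
  have n0 : 0 <= n x by exact: normc_ge0.
  have qE : q x / (4 * r ^+ 2) = ((1 + r ^+ 2 * a1) * (1 + r ^+ 2 * a2))^-1.
    rewrite /q /poisson2 /refl2 /poisson /= !sub0r !mulrN !sqrrN -/a1 -/a2.
    have d1 : 0 < 1 + r ^+ 2 * a1 by rewrite ltr_pwDl// mulr_ge0.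
    have d2 : 0 < 1 + r ^+ 2 * a2 by rewrite ltr_pwDl// mulr_ge0.
    have e1 : r^-1 ^+ 2 + a1 = (1 + r ^+ 2 * a1) / r ^+ 2 by field; lra.
    have e2 : r^-1 ^+ 2 + a2 = (1 + r ^+ 2 * a2) / r ^+ 2 by field; lra.
    rewrite e1 e2; move: (1 + r ^+ 2 * a1) (1 + r ^+ 2 * a2) d1 d2 => b1 b2 b10 b20.
    by field; lra.
  have -> : 2^-1 * (l / (4 * r ^+ 2)) * q x = 2^-1 * l * (q x / (4 * r ^+ 2)).
    by move: (q x) => qx; field; lra.
  rewrite qE SE.
  have W0 : 0 < (1 + r ^+ 2 * a1) * (1 + r ^+ 2 * a2).
    by rewrite mulr_gt0// ltr_pwDl// mulr_ge0.
  move: (_ * _) W0 (n x) n0 => W W0 m m0.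
  have -> : 2^-1 * l * W^-1 + 2^-1 * l^-1 * (W * m ^+ 2) =
      m + 2^-1 * (l * W)^-1 * (W * m - l) ^+ 2 by field; lra.
  by rewrite lerDl mulr_ge0 ?sqr_ge0// mulr_ge0// invr_ge0 mulr_ge0 ?ltW.
have c1 : 0 <= 2^-1 * (l / (4 * r ^+ 2)).
  by rewrite mulr_ge0// divr_ge0 ?(ltW l0)// mulr_ge0.
have c2 : 0 <= 2^-1 * l^-1 by rewrite mulr_ge0// invr_ge0 ltW.
have mn : measurable_fun setT n by apply/cmeas_normc/cmeas_fourier/schwartz_cinteg.
pose A x := 2^-1 * (l / (4 * r ^+ 2)) * q x.
pose B x := 2^-1 * l^-1 * S x.
have mA : measurable_fun setT A by exact: mZ.
have mB : measurable_fun setT B by exact: mZ.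
have A0 x : 0 <= A x by exact: mulr_ge0 c1 (q0 x).
have B0 x : 0 <= B x by exact: mulr_ge0 c2 (S0 x).
apply: (@le_trans _ _ (\int[mu]_x (A x + B x)%:E)%E).
  apply: ge0_le_integral => //.
  - by move=> x _; rewrite lee_fin normc_ge0.
  - exact/measurable_EFinP.
  - by apply/measurable_EFinP; exact: (measurable_funD mA mB).
  - by move=> x _; rewrite lee_fin; exact: main.
rewrite (ge0_integralD_EFin mA mB A0 B0).
rewrite (ge0_integralZ_EFin mq q0 c1) (ge0_integralZ_EFin mS S0 c2).
rewrite integral_poisson2// mule1 mulrDr EFinD leeD2l//.
rewrite [(2^-1 * (l^-1 * _))%:E](_ : _ = ((2^-1 * l^-1)%:E *
    (s0 + r ^+ 2 * s1 + r ^+ 2 * s2 + r ^+ 4 * s3)%:E)%E); last first.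
  by rewrite -EFinM mulrA.
by rewrite lee_wpmul2l// lee_fin.
Qed.

Lemma schwartz_sqnorm g : schwartz g -> (sqnorm g < +oo)%E.
Proof.
move=> sg; have [B _ HB] := schwartz_bounded sg.
exact: cinteg_sqnorm (schwartz_cinteg sg) HB.
Qed.

Lemma cinteg_fourier_schwartz g : schwartz g -> cinteg mu (fourier g).
Proof.
move=> sg; apply: cintegP; first exact/cmeas_fourier/schwartz_cinteg.
have fk (u : P -> R[i]) : schwartz u -> (sqnorm u <= (fine (sqnorm u))%:E)%E.
  move=> su; rewrite fineK// ge0_fin_numE; first exact: schwartz_sqnorm.
  exact: sqnorm_ge0.
have sg2 := schwartz_cpartial true sg.
have sg1 := schwartz_cpartial false sg.
have sg3 := schwartz_cpartial false sg2.
have := fourier_L1_bound sg (@ltr01 R) (@ltr01 R) (fk _ sg) (fk _ sg1) (fk _ sg2) (fk _ sg3).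
by move=> /le_lt_trans; apply; rewrite ltry.
Qed.

Theorem schwartz_inversion g xi : schwartz g ->
  cI mu (fun x => fourier g x * character x xi) = g xi.
Proof.
move=> sg; have [B _ HB] := schwartz_bounded sg.
apply: (fourier_inversion (schwartz_cinteg sg) (cinteg_fourier_schwartz sg) HB).
by apply: smooth_locally_continuous; case: sg.
Qed.

End fourier_integrability.

(** * Compactly supported functions *)

Section compact_support.
Context {R : realType}.
Local Notation mT := (measurableTypeR R).
Local Notation P := (mT * mT)%type.
Local Notation V := (R^o * R^o)%type.

Lemma partial_eq0 (f : V -> R^o) (O : set V) w : open O ->
  (forall x, O x -> f x = 0) -> forall x, O x -> partial w f x = 0.
Proof.
move=> oO f0; elim: w => [//|b w IH] x Ox /=.
have -> : derive (partial w f : V -> R^o) x (axis R b) =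
    derive (fun _ : V => (0 : R^o)) x (axis R b).
  apply: near_eq_derive; have := oO x Ox.
  by rewrite /interior; apply: filterS => y; exact: IH.
exact: derive_cst.
Qed.

Definition box (r : R) : set V := [set x | `|x.1| <= r /\ `|x.2| <= r].

Lemma compact_box r : compact (box r).
Proof.
have -> : box r = `[- r, r]%classic `*` `[- r, r]%classic.
  by apply/seteqP; split => x; rewrite /box /= !in_itv /= -!ler_norml => -[].
by apply: compact_setX; exact: segment_compact.
Qed.

Lemma open_box_compl r : open (~` box r).
Proof.
apply: closed_openC; apply: compact_closed; last exact: compact_box.
exact: norm_hausdorff.
Qed.

Lemma continuous_box_bounded (f : V -> R^o) r : continuous f ->
  exists M : R, forall x, box r x -> `|f x| <= M.
Proof.
move=> cf.
have : compact (f @` box r).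
  by apply: continuous_compact (@compact_box r); exact: continuous_subspaceT.
move=> /compact_bounded [M [Mr HM]]; exists (M + 1) => x bx.
by apply: (HM (M + 1)); [rewrite ltrDl|exists x].
Qed.

Lemma enorm_le (x : P) : enorm x <= `|x.1| + `|x.2|.
Proof.
rewrite -(@ler_pXn2r _ 2)// ?nnegrE ?enorm_ge0 ?addr_ge0// enorm_sqr sqrrD.
rewrite !real_normK ?num_real//.
have := mulr_ge0 (normr_ge0 x.1) (normr_ge0 x.2); lra.
Qed.

Lemma bounded_support_schwartz (g : P -> R[i]) (r : R) : smooth g ->
  (forall x, ~ box r x -> g x = 0) -> schwartz g.
Proof.
move=> [sr si] g0; split=> // N w.
have [cr _] := sr w; have [ci _] := si w.
have [M1 H1] := continuous_box_bounded r cr.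
have [M2 H2] := continuous_box_bounded r ci.
exists ((1 + (`|r| + `|r|)) ^+ N * (`|M1| + `|M2|)) => x.
have e0 : 0 <= 1 + enorm x by rewrite addr_ge0// enorm_ge0.
have [bx|nbx] := pselect (box r x).
  apply: ler_pM.
  - exact: exprn_ge0.
  - exact: normc_ge0.
  - have le1 : 1 + enorm x <= 1 + (`|r| + `|r|).
      case: bx => b1 b2; rewrite lerD2l; apply: le_trans (enorm_le x) _.
      by rewrite lerD// (le_trans _ (ler_norm r)).
    by apply: lerXn2r => //; rewrite nnegrE ?addr_ge0.
  - apply: le_trans (normc_le_ReIm _) _; rewrite lerD//.
      by apply: le_trans (H1 _ bx) _; exact: ler_norm.
    by apply: le_trans (H2 _ bx) _; exact: ler_norm.
rewrite /cpartial.
rewrite (partial_eq0 (O := ~` box r) w (@open_box_compl r) _ nbx); last first.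
  by move=> y ny; rewrite g0.
rewrite (partial_eq0 (O := ~` box r) w (@open_box_compl r) _ nbx); last first.
  by move=> y ny; rewrite g0.
rewrite (_ : 0 +i* 0 = 0 :> R[i])// normc0 mulr0.
by rewrite mulr_ge0 ?exprn_ge0 ?addr_ge0.
Qed.

Lemma test_function_box (U : set P) (g : P -> R[i]) : test_function U g ->
  exists r : R, forall x, ~ box r x -> g x = 0.
Proof.
move=> [_ cK _]; set K := closure _ in cK.
have bnd (p : V -> R^o) : continuous p -> exists M : R, forall x, K x -> `|p x| <= M.
  move=> cp; have : compact (p @` (K : set V)).
    by apply: continuous_compact cK; exact: continuous_subspaceT.
  move=> /compact_bounded [M [Mr HM]]; exists (M + 1) => x Kx.
  by apply: (HM (M + 1)); [rewrite ltrDl|exists x].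
have [M1 H1] := bnd fst (fun x => @cvg_fst _ _ _ _ _).
have [M2 H2] := bnd snd (fun x => @cvg_snd _ _ _ _ _).
exists (`|M1| + `|M2|) => x nbx; apply/eqP; apply: contrapT => /negP gx; apply: nbx.
have Kx : K x by apply: subset_closure.
split.
  by apply: le_trans (H1 _ Kx) _; rewrite (le_trans (ler_norm _))// lerDl.
by apply: le_trans (H2 _ Kx) _; rewrite (le_trans (ler_norm _))// lerDr.
Qed.

Lemma test_function_schwartz (U : set P) (g : P -> R[i]) : test_function U g -> schwartz g.
Proof.
move=> tg; have [r Hr] := test_function_box tg.
by apply: bounded_support_schwartz Hr; case: tg.
Qed.

Lemma test_function_eq0 (U : set P) (g : P -> R[i]) x : test_function U g -> ~ U x ->
  g x = 0.
Proof.
move=> [_ _ sU] nUx; apply/eqP; apply: contrapT => /negP gx; apply: nUx.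
by apply: sU; apply: subset_closure.
Qed.

Lemma smooth_refl2 (a : P) (g : P -> R[i]) : smooth g -> smooth (fun x => g (refl2 a x)).
Proof.
move=> [sr si]; split; apply: smooth_genP.
  by apply: (gen_refl a (f := fun x => Re (g x) : R^o)); exact: gen_smooth.
by apply: (gen_refl a (f := fun x => Im (g x) : R^o)); exact: gen_smooth.
Qed.

Lemma continuous_dot_self : continuous (fun x : V => dot x x : R^o).
Proof.
move=> x; apply: cvgD; apply: cvgM;
  [exact: cvg_fst|exact: cvg_fst|exact: cvg_snd|exact: cvg_snd].
Qed.

Lemma compact_cdisc (r : R) : compact (@cdisc R r : set V).
Proof.
apply: (@subclosed_compact _ _ (box r)); last 2 first.
- exact: compact_box.
- move=> x; rewrite /cdisc /box /= => xr.
  have h (u : R) : u ^+ 2 <= enorm x ^+ 2 -> `|u| <= r.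
    move=> ux; apply: le_trans _ xr.
    by rewrite -(@ler_pXn2r _ 2)// ?nnegrE ?enorm_ge0// real_normK ?num_real.
  by split; apply: h; rewrite enorm_sqr ?lerDl ?lerDr sqr_ge0.
have -> : (@cdisc R r : set V) = (fun x : V => (enorm x : R^o)) @^-1` [set y : R^o | y <= r] by [].
apply: preimage_closed; last exact: closed_le.
move=> x _; apply: (continuous_comp (f := fun x : V => dot x x : R^o) (g := @Num.sqrt R)).
  exact: continuous_dot_self.
exact: sqrt_continuous.
Qed.

Lemma test_function_disc (r rho : R) (g : P -> R[i]) : smooth g -> rho < r ->
  (forall x, g x != 0 -> enorm x <= rho) -> test_function (disc r) g.
Proof.
move=> sg rr gx.
have cl : closed (@cdisc R rho : set V).
  by apply: compact_closed; [exact: norm_hausdorff|exact: compact_cdisc].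
have sub : closure [set x : R * R | g x != 0] `<=` @cdisc R rho.
  move=> x; move/closure_id : cl => ->.
  by apply: closure_subset => y /=; exact: gx.
split=> //.
- by apply: subclosed_compact sub; [exact: closed_closure|exact: compact_cdisc].
- by move=> x /sub; rewrite /cdisc /disc /= => /le_lt_trans; exact.
Qed.

End compact_support.

(** * Lenses and the Hankel operator *)

Section lenses.
Context {R : realType}.
Local Notation mT := (measurableTypeR R).
Local Notation P := (mT * mT)%type.
Local Notation mu := (leb2 R).

Definition absc (n : nat) : R := 2^-1 ^+ n.
(* [dot (rim n) (rim n) = 4], so that a Dirac mass at [rim n] is invisible on
   the open disc of radius 2, while [dot (node n) (node n)] is slightly smaller
   than 4: the lens of the [eta] with both [eta] and [node n - eta] in the unit
   disc is then non-empty but so thin that distinct lenses are disjoint. *)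
Definition node (n : nat) : P := (absc n, Num.sqrt (4 - 17 / 16 * absc n ^+ 2)).
Definition rim (n : nat) : P := (absc n, Num.sqrt (4 - absc n ^+ 2)).

Definition lens (n : nat) : set P :=
  [set x | dot x x < 1 /\ dot (refl2 (node n) x) (refl2 (node n) x) < 1].
Definition lenses : set P := \bigcup_n lens n.

Definition flip (x : P) : P :=
  if pselect (exists n, lens n x) is left h then refl2 (node (projT1 (cid h))) x else x.

Lemma absc_gt0 n : 0 < absc n.
Proof. by rewrite exprn_gt0// invr_gt0. Qed.

Lemma absc_le1 n : absc n <= 1.
Proof. by rewrite exprn_ile1 ?invr_ge0// invf_le1// ler1n. Qed.

Lemma abscS n : absc n.+1 = 2^-1 * absc n.
Proof. by rewrite /absc exprS. Qed.

Lemma absc_lt m n : (m < n)%N -> absc n <= 2^-1 * absc m.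
Proof.
move=> mn; rewrite -abscS /absc ler_wiXn2l// ?invr_ge0// invf_le1// ler1n//.
Qed.

Lemma absc_le m n : (m <= n)%N -> absc n <= absc m.
Proof.
rewrite leq_eqVlt => /predU1P[->//|mn]; apply: le_trans (absc_lt mn) _.
by rewrite ler_piMl ?(ltW (absc_gt0 _))// invf_le1// ler1n.
Qed.

Lemma absc_sqr_le1 n : absc n ^+ 2 <= 1.
Proof. by rewrite exprn_ile1 ?absc_le1// ltW// absc_gt0. Qed.

Lemma dot_node n : dot (node n) (node n) = 4 - absc n ^+ 2 / 16.
Proof.
have h := absc_sqr_le1 n.
rewrite /dot /= -!expr2 sqr_sqrtr; last by lra.
by field.
Qed.

Lemma dot_rim n : dot (rim n) (rim n) = 4.
Proof.
have h := absc_sqr_le1 n.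
rewrite /dot /= -!expr2 sqr_sqrtr; last by lra.
by ring.
Qed.

(** The squares of the two ordinates differ by [absc n ^+ 2 / 16], and their sum is at least 1. As
    the abscissas agree, this bounds the distance between node and rim point and makes the symbol
    summable. *)
Lemma node_rim n : `|(rim n).2 - (node n).2| <= absc n ^+ 2.
Proof.
have h := absc_sqr_le1 n; have h0 := sqr_ge0 (absc n).
rewrite /=; set a := Num.sqrt _; set b := Num.sqrt (4 - _ * _).
have a0 : 0 <= a by exact: sqrtr_ge0.
have b0 : 0 <= b by exact: sqrtr_ge0.
have aE : a ^+ 2 = 4 - absc n ^+ 2 by rewrite sqr_sqrtr//; lra.
have bE : b ^+ 2 = 4 - 17 / 16 * absc n ^+ 2 by rewrite sqr_sqrtr//; lra.
have ab : b <= a by rewrite -(@ler_pXn2r _ 2)// aE bE; lra.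
have a1 : 1 <= a by rewrite -(@ler_pXn2r _ 2)// ?nnegrE// aE expr1n; lra.
rewrite ger0_norm ?subr_ge0//.
by move: (absc n ^+ 2) h h0 aE bE => s h h0 aE bE; nra.
Qed.

(** By the parallelogram law a point of the lens is within [absc n / 8], the square root of
    [1 - dot (node n) (node n) / 4], of the midpoint [node n / 2], whose abscissa is
    [absc n / 2]. *)
Lemma lens_strip n x : lens n x -> 3 / 8 * absc n < x.1 < 5 / 8 * absc n.
Proof.
move=> [x1 x2]; have := dot_node n; move: x1 x2.
have s0 := absc_gt0 n.
rewrite /dot /refl2 /=; set t := Num.sqrt _; move: (absc n) s0 t => s s0 t.
move=> x1 x2 E.
have H : (x.1 - s / 2) ^+ 2 < (s / 8) ^+ 2.
  have := sqr_ge0 (x.2 - t / 2); nra.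
have : `|x.1 - s / 2| < s / 8.
  rewrite -(@ltr_pXn2r _ 2)// ?nnegrE//; last by lra.
  by rewrite real_normK ?num_real.
by rewrite ltr_norml => /andP[h1 h2]; apply/andP; split; lra.
Qed.

(** Halving the abscissa moves the upper end of the strip from [5 / 8] to [5 / 16], below the lower
    end [3 / 8] of the previous strip. *)
Lemma lens_inj m n x : lens m x -> lens n x -> m = n.
Proof.
wlog mn : m n / (m <= n)%N => [wl lm ln|].
  by case/orP: (leq_total m n) => h; [exact: wl|apply/esym; exact: wl].
move=> /lens_strip/andP[m1 m2] /lens_strip/andP[n1 n2].
move: mn; rewrite leq_eqVlt => /predU1P[//|/absc_lt mn]; exfalso.
by have := absc_gt0 m; lra.
Qed.

Lemma refl2K (a x : P) : refl2 a (refl2 a x) = x.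
Proof. by case: x => x y; rewrite /refl2 /= !subKr. Qed.

Lemma lens_refl n x : lens n (refl2 (node n) x) <-> lens n x.
Proof. by rewrite /lens /= refl2K; split=> -[]. Qed.

Lemma flipE n x : lens n x -> flip x = refl2 (node n) x.
Proof.
move=> lx; rewrite /flip; case: pselect => [h|[]]; last by exists n.
by case: cid => m lm /=; rewrite (lens_inj lm lx).
Qed.

Lemma flip_id x : ~ lenses x -> flip x = x.
Proof.
by move=> nl; rewrite /flip; case: pselect => // -[n ln]; exfalso; apply: nl; exists n.
Qed.

Lemma lenses_flip x : lenses (flip x) <-> lenses x.
Proof.
split=> [|[n _ ln]]; last by rewrite (flipE ln); exists n => //; exact/lens_refl.
have [|nl] := pselect (lenses x); first by [].
by rewrite flip_id.
Qed.

Lemma flipK x : flip (flip x) = x.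
Proof.
have [[n _ ln]|nl] := pselect (lenses x); last by rewrite !flip_id.
by rewrite (flipE ln) (flipE (n := n)) ?refl2K//; exact/lens_refl.
Qed.

Lemma measurable_dot_lt (u : P -> P) : measurable_fun setT u ->
  measurable [set x | dot (u x) (u x) < 1].
Proof.
move=> mu'; rewrite -[X in measurable X]setTI.
have := measurable_fun_ltr (measurable_dot mu' mu') (measurable_cst (1 : R)).
move=> /(_ measurableT [set true] I); rewrite setTI.
by rewrite (_ : _ @^-1` _ = [set x | dot (u x) (u x) < 1])//; apply/seteqP; split.
Qed.

Lemma measurable_lens n : measurable (lens n).
Proof.
have -> : lens n = [set x | dot x x < 1] `&`
    [set x | dot (refl2 (node n) x) (refl2 (node n) x) < 1] by [].
apply: measurableI; first exact: (measurable_dot_lt (u := id)).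
by apply: measurable_dot_lt; exact: measurable_refl2.
Qed.

Lemma measurable_lenses : measurable lenses.
Proof. by apply: bigcupT_measurable; exact: measurable_lens. Qed.

Lemma trivIset_lens : trivIset setT lens.
Proof.
apply/trivIsetP => m n _ _ mn; apply/seteqP; split=> // x [lm ln].
by move: mn; rewrite (lens_inj lm ln) eqxx.
Qed.

Lemma measurable_flip : measurable_fun setT flip.
Proof.
move=> _ Y mY; rewrite setTI.
have -> : flip @^-1` Y = (\bigcup_n (lens n `&` refl2 (node n) @^-1` Y)) `|`
    (~` lenses `&` Y).
  apply/seteqP; split=> x /=.
    have [[n _ ln]|nl] := pselect (lenses x).
      by rewrite (flipE ln) => Yx; left; exists n.
    by rewrite flip_id// => Yx; right.
  move=> [[n _ [ln]]|[nl Yx]]; first by rewrite /= (flipE ln).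
  by rewrite flip_id.
apply: measurableU; last first.
  by apply: measurableI => //; apply: measurableC; exact: measurable_lenses.
apply: bigcupT_measurable => n; apply: measurableI; first exact: measurable_lens.
by rewrite -[X in measurable X]setTI; exact: measurable_refl2.
Qed.

(** Each lens is invariant under its own half-turn, which preserves the measure, and [flip] is the
    identity elsewhere; countable additivity puts the pieces together. *)
Lemma flip_preserving : measure_preserving mu flip.
Proof.
split=> [|f mf f0]; first exact: measurable_flip.
have mff : measurable_fun setT (f \o flip).
  exact: (measurableT_comp mf measurable_flip).
have split (h : P -> \bar R) : measurable_fun setT h -> (forall x, (0 <= h x)%E) ->
    (\int[mu]_x h x = \int[mu]_(x in lenses) h x + \int[mu]_(x in ~` lenses) h x)%E.
  move=> mh h0.
  have E := @ge0_integral_setU _ _ _ mu lenses (~` lenses) measurable_lenses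
    (measurableC measurable_lenses) h.
  rewrite setUv in E; apply: E => //.
  exact/disj_setPCl.
rewrite (split _ mf f0); apply: etrans (split _ mff (fun x => f0 (flip x))) _.
congr (_ + _)%E; last first.
  by apply: eq_integral => x; rewrite inE => nl; rewrite /= flip_id.
rewrite /lenses !ge0_integral_bigcup//; try exact: measurable_lens;
  try exact: trivIset_lens; try exact: measurable_funTS.
apply: eq_eseriesr => n _.
rewrite integral_mkcond [RHS]integral_mkcond.
rewrite -[RHS]((refl2_preserving (node n)).2).
- apply: eq_integral => x _; rewrite !patchE.
  have [ln|nln] := pselect (lens n x).
    rewrite (mem_set ln) (mem_set (proj2 (lens_refl n x) ln)).
    by rewrite /comp (flipE ln).
  by rewrite (memNset nln) (memNset (fun l => nln (proj1 (lens_refl n x) l))).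
- apply/(measurable_restrictT _ (measurable_lens n)).
  exact: measurable_funTS.
- by move=> x; rewrite patchE; case: ifP.
by move=> x _; exact: f0.
Qed.

End lenses.

(** * Pairings of square-integrable functions *)

Section square_integrable.
Context {R : realType}.
Local Notation mT := (measurableTypeR R).
Local Notation P := (mT * mT)%type.
Local Notation mu := (leb2 R).
Implicit Types f g h : P -> R[i].

(** AM-GM in place of Cauchy-Schwarz: no roots appear, and [l] can be made small once the second
    norm is known to tend to 0. *)
Lemma normc_mul_le f g (l : R) : cmeas f -> cmeas g -> 0 < l ->
  (\int[mu]_x (normc (f x * g x))%:E <=
   (2^-1 * l)%:E * sqnorm f + (2^-1 * l^-1)%:E * sqnorm g)%E.
Proof.
move=> mf mg l0.
pose A x := normc (f x) ^+ 2; pose B x := normc (g x) ^+ 2.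
have mA : measurable_fun setT A by apply/measurable_funX/cmeas_normc.
have mB : measurable_fun setT B by apply/measurable_funX/cmeas_normc.
have A0 x : 0 <= A x by exact: sqr_ge0.
have B0 x : 0 <= B x by exact: sqr_ge0.
have c1 : 0 <= 2^-1 * l by rewrite mulr_ge0// ltW.
have c2 : 0 <= 2^-1 * l^-1 by rewrite mulr_ge0// invr_ge0 ltW.
rewrite -(ge0_integralZ_EFin mA A0 c1) -(ge0_integralZ_EFin mB B0 c2).
have mcA : measurable_fun setT (fun x => 2^-1 * l * A x) by exact: measurable_funM.
have mcB : measurable_fun setT (fun x => 2^-1 * l^-1 * B x) by exact: measurable_funM.
rewrite -(ge0_integralD_EFin mcA mcB (fun x => mulr_ge0 c1 (A0 x)) (fun x => mulr_ge0 c2 (B0 x))).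
apply: ge0_le_integral => //.
- by move=> x _; rewrite lee_fin normc_ge0.
- by apply/measurable_EFinP/cmeas_normc; exact: cmeasM.
- by apply/measurable_EFinP; exact: (measurable_funD mcA mcB).
- move=> x _; rewrite lee_fin normcM /A /B.
  move: (normc (f x)) (normc (g x)) => a b.
  have -> : 2^-1 * l * a ^+ 2 + 2^-1 * l^-1 * b ^+ 2 =
    a * b + 2^-1 * l^-1 * (l * a - b) ^+ 2 by field; lra.
  by rewrite lerDl mulr_ge0// sqr_ge0.
Qed.

Definition L2 f : Prop := cmeas f /\ (sqnorm f < +oo)%E.

Lemma L2_mul f g : L2 f -> L2 g -> cinteg mu (fun x => f x * g x).
Proof.
move=> [mf sf] [mg sg]; apply: cintegP; first exact: cmeasM.
apply: le_lt_trans (normc_mul_le mf mg (@ltr01 R)) _.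
by apply: lte_add_pinfty; apply: lte_mul_pinfty; rewrite ?lee_fin//;
  rewrite mulr_ge0// invr_ge0.
Qed.

Lemma sqnorm_conj f : sqnorm (fun x => (f x)^*) = sqnorm f.
Proof. by apply: eq_integral => x _; rewrite normc_conj. Qed.

Lemma le_sqnorm f (u : P -> R) : cmeas f -> mu.-integrable setT (EFin \o u) ->
  (forall x, normc (f x) ^+ 2 <= u x) -> (sqnorm f <= (Rintegral mu setT u)%:E)%E.
Proof.
move=> mf Iu fu; rewrite fineK ?integrable_fin_num//.
apply: ge0_le_integral => //.
- by move=> x _; rewrite lee_fin sqr_ge0.
- exact: measurable_normc_sqr.
- exact: measurable_int Iu.
- by move=> x _; rewrite lee_fin; exact: fu.
Qed.

Lemma cmeas_param d (T : measurableType d) (K : T * P -> R[i]) (g : P -> R) :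
  cmeas K -> mu.-integrable setT (EFin \o g) ->
  (forall z x, normc (K (z, x)) <= g x) ->
  cmeas (fun z => cI mu (fun x => K (z, x))).
Proof.
move=> [mr mi] Ig Kg.
have mg0 : measurable_fun setT g by apply/measurable_EFinP; exact: measurable_int Ig.
have mg : measurable_fun setT (fun z : T * P => g z.2).
  exact: (measurableT_comp mg0 measurable_snd).
have H (k : T * P -> R) : measurable_fun setT k -> (forall z x, `|k (z, x)| <= g x) ->
    measurable_fun setT (fun z => Rintegral mu setT (fun x => k (z, x))).
  move=> mk kg.
  have Ik z : mu.-integrable setT (EFin \o (fun x => k (z, x))).
    apply: le_integrable Ig => //.
      by apply/measurable_EFinP; exact: (measurableT_comp mk (pair1_measurable z)).
    by move=> x _ /=; rewrite lee_fin (le_trans (kg z x))// ler_norm.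
  (* Adding the majorant makes the integrand nonnegative, as the measurability part of Tonelli's
     theorem asks. *)
  have -> : (fun z => Rintegral mu setT (fun x => k (z, x))) =
      (fun z => Rintegral mu setT (fun x => k (z, x) + g x) - Rintegral mu setT g).
    by apply/funext => z; rewrite RintegralD// addrK.
  apply: measurable_funB; last exact: measurable_cst.
  have m1 : measurable_fun setT (fun z : T * P => (k z + g z.2)%:E).
    by apply/measurable_EFinP; exact: (measurable_funD mk mg).
  have m0 (z : T * P) : (0 <= (k z + g z.2)%:E)%E.
    case: z => z x; rewrite lee_fin -lerBlDr sub0r.
    by have := kg z x; rewrite ler_norml => /andP[].
  have ms : measurable_fun setT (fun z => (\int[mu]_x (k (z, x) + g x)%:E)%E).
    exact: (measurable_fun_fubini_tonelli_F (m2 := sleb2) _ m1 m0).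
  exact: measurableT_comp ms.
split.
  exact: (H _ mr (fun z x => le_trans (Re_le_normc _) (Kg z x))).
exact: (H _ mi (fun z x => le_trans (Im_le_normc _) (Kg z x))).
Qed.

End square_integrable.

(** * The operator on the space side *)

Section hankel_operator.
Context {R : realType}.
Local Notation mT := (measurableTypeR R).
Local Notation P := (mT * mT)%type.
Local Notation mu := (leb2 R).
Implicit Types f g h : P -> R[i].

Definition ift h (xi : P) : R[i] := cI mu (fun x => h x * character x xi).

Lemma cinteg_character h xi : cinteg mu h -> cinteg mu (fun x => h x * character x xi).
Proof.
move=> Ih; apply: (cintegMb Ih (cmeas_characterl xi) (M := 1)) => x.
by rewrite normc_character.
Qed.

Lemma iftE h xi : cinteg mu h -> ift h xi = (fourier (fun x => (h x)^*) xi)^*.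
Proof.
move=> Ih; rewrite /ift fourierE -cI_conj.
  by apply: eq_cI => x; rewrite conjcM !conjcK.
exact/cinteg_characterJ/cinteg_conj.
Qed.

Lemma cmeas_ift h : cinteg mu h -> cmeas (ift h).
Proof.
move=> Ih; rewrite (_ : ift h = fun xi => (fourier (fun x => (h x)^*) xi)^*).
  exact/cmeas_conj/cmeas_fourier/cinteg_conj.
by apply/funext => xi; exact: iftE.
Qed.

Lemma sqnorm_ift_le h : cinteg mu h -> (sqnorm (ift h) <= sqnorm h)%E.
Proof.
move=> Ih; rewrite (_ : ift h = fun xi => (fourier (fun x => (h x)^*) xi)^*); last first.
  by apply/funext => xi; exact: iftE.
rewrite sqnorm_conj -(sqnorm_conj h); apply: plancherel_le; exact: cinteg_conj.
Qed.

Lemma normc_ift_le h xi : cinteg mu h ->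
  normc (ift h xi) <= Rintegral mu setT (fun x => normc (h x)).
Proof.
move=> Ih; apply: le_trans (normc_cI_le (cinteg_character xi Ih)) _.
by under eq_Rintegral do rewrite normcM normc_character mulr1.
Qed.

Definition ind (xi : P) : R[i] := ((\1_(@lenses R) xi : R))%:C.

Lemma cmeas_ind : cmeas ind.
Proof. by apply: cmeas_real; apply: measurable_indic; exact: measurable_lenses. Qed.

Lemma ind1 xi : lenses xi -> ind xi = 1.
Proof. by move=> l; rewrite /ind indicE mem_set. Qed.

Lemma ind0 xi : ~ lenses xi -> ind xi = 0.
Proof. by move=> l; rewrite /ind indicE memNset. Qed.

Lemma ind_flip xi : ind (flip xi) = ind xi.
Proof.
have [l|nl] := pselect (lenses xi); last by rewrite flip_id.
by rewrite !ind1//; exact/lenses_flip.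
Qed.

Lemma normc_ind_le1 xi : normc (ind xi) <= 1.
Proof.
by rewrite /ind normc_real indicE; case: (_ \in _); rewrite ?normr1 ?normr0.
Qed.

Lemma lenses_box xi : lenses xi -> box 1 (xi : R^o * R^o).
Proof.
move=> [n _ [l _]]; have h (u : R) : u ^+ 2 < 1 -> `|u| <= 1.
  move=> u1; rewrite -(@ler_pXn2r _ 2)// ?nnegrE// real_normK ?num_real// expr1n.
  exact: ltW.
move: l; rewrite /dot -!expr2 => l; have := sqr_ge0 xi.1; have := sqr_ge0 xi.2.
by move=> p2 p1; split; apply: h; lra.
Qed.

(** The lenses lie in the square of half-side 1, where both factors of the inverse weight are at
    most 2. This gives one integrable majorant for all integrals over the lenses. *)
Lemma normc_ind_weight xi : normc (ind xi) <= 4 * weight xi.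
Proof.
have [l|nl] := pselect (lenses xi); last first.
  by rewrite ind0// normc0 mulr_ge0// ltW// weight_gt0.
rewrite ind1// normc1 /weight -invfM ler_pdivlMr; last first.
  by rewrite mulr_gt0// ltr_pwDl ?sqr_ge0.
have [b1 b2] := lenses_box l.
have h (u : R) : `|u| <= 1 -> 0 <= 1 + u ^+ 2 <= 2.
  move=> u1; rewrite addr_ge0 ?sqr_ge0//=.
  have : u ^+ 2 <= 1 by rewrite -real_normK ?num_real// exprn_ile1.
  lra.
have /andP[h1 h1'] := h _ b1; have /andP[h2 h2'] := h _ b2.
rewrite mul1r (_ : 4 = 2 * 2 :> R); last by ring.
exact: ler_pM.
Qed.

Lemma integrable_4weight : mu.-integrable setT (EFin \o (fun x : P => 4 * weight x)).
Proof. by apply: integrable_scale; exact: integrable_weight. Qed.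

(** Formally the operator is the inverse transform at [x] of [ind * (fourier f \o flip)]. Changing
    variables by [flip] moves the reflection to the character, which is [symb x]; exchanging
    integrals then makes [fourier (symb x) y] the coefficient of [f y]. *)
Definition symb (x xi : P) : R[i] := ind xi * character x (flip xi).

Lemma normc_symb x xi : normc (symb x xi) = normc (ind xi).
Proof. by rewrite normcM normc_character mulr1. Qed.

Lemma cmeas_symb x : cmeas (symb x).
Proof.
apply: cmeasM; first exact: cmeas_ind.
apply: cmeas_character; [exact: measurable_cst|exact: measurable_flip].
Qed.

Lemma cinteg_symb x : cinteg mu (symb x).
Proof.
apply: (le_cinteg (cmeas_symb x) integrable_4weight) => xi.
by rewrite normc_symb normc_ind_weight.
Qed.

Definition hkernel (x y : P) : R[i] := fourier (symb x) y.

Definition hmass : R := Rintegral mu setT (fun x : P => 4 * weight x).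

(** Uniformity in [x] is the point: it makes [hankelop f] a bounded function for every [f] in
    [L2]. *)
Lemma sqnorm_hkernel x : (sqnorm (hkernel x) <= hmass%:E)%E.
Proof.
apply: le_trans (plancherel_le (cinteg_symb x)) _.
apply: le_sqnorm; [exact: cmeas_symb|exact: integrable_4weight|move=> xi].
rewrite normc_symb (le_trans _ (normc_ind_weight xi))// expr2.
by rewrite ler_piMl ?normc_ge0// normc_ind_le1.
Qed.

Lemma cmeas_hkernel : cmeas (fun z : P * P => hkernel z.1 z.2).
Proof.
have -> : (fun z : P * P => hkernel z.1 z.2) = fun z => cI mu (fun xi =>
    symb z.1 xi * (character xi z.2)^*).
  by apply/funext => z; rewrite /hkernel fourierE.
apply: (@cmeas_param _ _ _ (fun w : (P * P) * P => symb w.1.1 w.2 * (character w.2 w.1.2)^*)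
   (fun x : P => 4 * weight x)).
- have m2 : measurable_fun setT (fun w : (P * P) * P => w.2) by exact: measurable_snd.
  have m11 : measurable_fun setT (fun w : (P * P) * P => w.1.1).
    exact: (measurableT_comp measurable_fst measurable_fst).
  have m12 : measurable_fun setT (fun w : (P * P) * P => w.1.2).
    exact: (measurableT_comp measurable_snd measurable_fst).
  apply: cmeasM.
    apply: cmeasM; first exact: (cmeas_comp cmeas_ind m2).
    by apply: cmeas_character => //; exact: (measurableT_comp measurable_flip m2).
  by apply: cmeas_conj; exact: cmeas_character.
- exact: integrable_4weight.
- move=> z x; rewrite normcM normc_characterJ mulr1 normc_symb.
  exact: normc_ind_weight.
Qed.

(* On the Fourier side this is [F |-> ind * (F \o flip)], written as an
   absolutely convergent integral on the space side. *)
Definition hankelop f (x : P) : R[i] := cI mu (fun y => f y * hkernel x y).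

Lemma L2_hkernel x : L2 (hkernel x).
Proof.
split; last by apply: le_lt_trans (sqnorm_hkernel x) _; rewrite ltry.
exact/cmeas_fourier/cinteg_symb.
Qed.

Definition hbound f : R := 2^-1 * fine (sqnorm f) + 2^-1 * hmass.

Lemma hankelop_integrand f x : L2 f ->
  (\int[mu]_y (normc (f y * hkernel x y))%:E <= (hbound f)%:E)%E.
Proof.
move=> [mf sf]; have [mk _] := L2_hkernel x.
apply: le_trans (normc_mul_le mf mk (@ltr01 R)) _.
have Ef : sqnorm f = (fine (sqnorm f))%:E.
  by rewrite fineK// ge0_fin_numE//; exact: sqnorm_ge0.
rewrite invr1 !mulr1 /hbound EFinD !EFinM {1}Ef leeD//.
by apply: lee_wpmul2l; [rewrite lee_fin|exact: sqnorm_hkernel].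
Qed.

Lemma cinteg_hankelop f x : L2 f -> cinteg mu (fun y => f y * hkernel x y).
Proof. by move=> Lf; apply: L2_mul => //; exact: L2_hkernel. Qed.

Lemma cmeas_hankel_integrand f : L2 f ->
  cmeas (fun z : P * P => f z.2 * hkernel z.1 z.2).
Proof.
by move=> [mf _]; apply: cmeasM; [exact: cmeas_snd|exact: cmeas_hkernel].
Qed.

Lemma cmeas_hankelop f : L2 f -> cmeas (hankelop f).
Proof.
move=> Lf; apply: (@cmeas_section _ (fun z => f z.2 * hkernel z.1 z.2) (hbound f)).
  exact: cmeas_hankel_integrand.
by move=> x; exact: hankelop_integrand.
Qed.

Lemma normc_hankelop f x : L2 f -> normc (hankelop f x) <= hbound f.
Proof.
move=> Lf; rewrite -lee_fin; apply: le_trans (normc_cI_le_fin (cinteg_hankelop x Lf)) _.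
exact: hankelop_integrand.
Qed.

(* [fourier (adjoint h)] is the transpose of [hankelop] applied to [h]. *)
Definition adjoint h (xi : P) : R[i] := ind xi * ift h (flip xi).

Lemma cmeas_adjoint h : cinteg mu h -> cmeas (adjoint h).
Proof.
move=> Ih; apply: cmeasM; first exact: cmeas_ind.
by apply: (cmeas_measure_preserving flip_preserving); exact: cmeas_ift.
Qed.

Lemma cinteg_ind : cinteg mu ind.
Proof.
by apply: (le_cinteg cmeas_ind integrable_4weight) => xi; exact: normc_ind_weight.
Qed.

Lemma cinteg_adjoint h : cinteg mu h -> cinteg mu (adjoint h).
Proof.
move=> Ih; apply: (cintegMb cinteg_ind (M := Rintegral mu setT (fun x => normc (h x)))).
  by apply: (cmeas_measure_preserving flip_preserving); exact: cmeas_ift.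
by move=> xi; exact: normc_ift_le.
Qed.

Lemma sqnorm_adjoint h : cinteg mu h -> (sqnorm (adjoint h) <= sqnorm h)%E.
Proof.
move=> Ih; apply: le_trans (sqnorm_ift_le Ih).
have mi := cmeas_ift Ih.
have <- : sqnorm (fun xi => ift h (flip xi)) = sqnorm (ift h).
  rewrite /sqnorm (flip_preserving.2 (fun xi => (normc (ift h xi) ^+ 2)%:E))//.
    exact: measurable_normc_sqr.
  by move=> x; rewrite lee_fin sqr_ge0.
apply: ge0_le_integral => //.
- by move=> x _; rewrite lee_fin sqr_ge0.
- by apply: measurable_normc_sqr; exact: cmeas_adjoint.
- by apply: measurable_normc_sqr; exact: (cmeas_measure_preserving flip_preserving).
- move=> x _; rewrite lee_fin normcM exprMn ler_piMl ?sqr_ge0//.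
  by rewrite exprn_ile1 ?normc_ge0 ?normc_ind_le1.
Qed.

(** Transposition by exchange of integrals. Only the integrable functions [h] and [adjoint h] are
    transformed, so the identity makes sense for every [f] in [L2], without a pointwise transform of
    [f]. *)
Lemma hankelop_duality f h : L2 f -> cinteg mu h ->
  cI mu (fun x => h x * hankelop f x) =
  cI mu (fun y => f y * fourier (adjoint h) y).
Proof.
move=> Lf Ih.
have IK := cinteg_section Ih (cmeas_hankel_integrand Lf)
  (fun x => hankelop_integrand x Lf).
transitivity (cI mu (fun x => cI mu (fun y => h x * (f y * hkernel x y)))).
  by apply: eq_cI => x; rewrite cIZ//; exact: cinteg_hankelop.
rewrite (@cI_fubini _ _ P P R sleb2 sleb2 _ IK) /=.
have Ihk y : cinteg mu (fun x => h x * hkernel x y).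
  apply: (cintegMb Ih (M := hmass)).
    exact: (cmeas_comp cmeas_hkernel (pair2_measurable y)).
  move=> x; apply: le_trans (normc_fourier_le _ (cinteg_symb x)) _.
  apply: le_Rintegral => //.
  - exact/cinteg_normc/cinteg_symb.
  - exact: integrable_4weight.
  - by move=> xi _; rewrite normc_symb normc_ind_weight.
apply: eq_cI => y; under eq_cI do rewrite mulrCA.
rewrite cIZ//; congr (_ * _).
have Ic := cinteg_characterJ y cinteg_ind.
transitivity (cI mu (fun x => h x * cI mu (fun xi =>
    (ind xi * (character xi y)^*) * character x (flip xi)))).
  by apply: eq_cI => x; rewrite /hkernel fourierE; congr (_ * _); apply: eq_cI => xi;
    rewrite /symb mulrAC.
rewrite (@cI_swap _ _ P P R sleb2 sleb2 _ _ (fun z => character z.1 (flip z.2)) 1 Ih Ic).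
- rewrite fourierE; apply: eq_cI => xi; rewrite /adjoint mulrAC.
  by rewrite -/(ift h (flip xi)).
- apply: cmeas_character; first exact: measurable_fst.
  exact: (measurableT_comp measurable_flip measurable_snd).
- by move=> z; rewrite normc_character.
Qed.

Definition cutoff (n : nat) (x : P) : R[i] := ((\1_(@box R n%:R : set P) x : R))%:C.

Lemma measurable_box r : measurable (@box R r : set P).
Proof.
have -> : (@box R r : set P) = `[- r, r]%classic `*` `[- r, r]%classic.
  by apply/seteqP; split => x; rewrite /box /= !in_itv /= -!ler_norml => -[].
by apply: measurableX; exact: measurable_itv.
Qed.

(** Testing against the truncated conjugate [h n] of the function itself, duality and AM-GM bound
    [sqnorm (h n)] by half of [sqnorm f] plus half of [sqnorm (h n)]. The truncation makes the last
    term finite, hence absorbable; Fatou's lemma then removes it. *)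
Lemma sqnorm_hankelop f : L2 f -> (sqnorm (hankelop f) <= sqnorm f)%E.
Proof.
move=> Lf; have mA := cmeas_hankelop Lf; have [mf sf] := Lf.
have B0 : 0 <= hbound f by exact: le_trans (normc_ge0 _) (normc_hankelop point Lf).
have mc n : cmeas (cutoff n).
  by apply: cmeas_real; apply: measurable_indic; exact: measurable_box.
pose h n x := cutoff n x * (hankelop f x)^*.
have mh n : cmeas (h n) by apply: cmeasM => //; exact: cmeas_conj.
have c01 n x : cutoff n x = 1 \/ cutoff n x = 0.
  by rewrite /cutoff indicE; case: (_ \in _); [left|right].
have cutw n x : normc (cutoff n x) <= (1 + n%:R ^+ 2) ^+ 2 * weight x.
  have [bx|nbx] := pselect (@box R n%:R x); last first.
    rewrite /cutoff indicE memNset// normc0.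
    by rewrite mulr_ge0 ?sqr_ge0// ltW// weight_gt0.
  rewrite /cutoff indicE mem_set// normc1 /weight -invfM.
  rewrite ler_pdivlMr ?mul1r; last by rewrite mulr_gt0// ltr_pwDl ?sqr_ge0.
  have hu (u : R) : `|u| <= n%:R -> 1 + u ^+ 2 <= 1 + n%:R ^+ 2.
    move=> un; rewrite lerD2l -(real_normK (num_real u)).
    by rewrite ler_pXn2r// nnegrE.
  case: bx => /hu b1 /hu b2; rewrite expr2.
  by apply: ler_pM => //; rewrite addr_ge0 ?sqr_ge0.
have Ih n : cinteg mu (h n).
  apply: (le_cinteg (g := fun x => hbound f * (1 + n%:R ^+ 2) ^+ 2 * weight x)) => //.
    by apply: integrable_scale; exact: integrable_weight.
  move=> x; rewrite normcM normc_conj mulrC -mulrA.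
  by apply: ler_pM; rewrite ?normc_ge0 ?normc_hankelop.
have hB n x : normc (h n x) <= hbound f.
  rewrite /h normcM normc_conj.
  case: (c01 n x) => ->; rewrite ?normc1 ?normc0.
    by rewrite mul1r normc_hankelop.
  by rewrite mul0r.
have sh n : (sqnorm (h n) < +oo)%E by exact: cinteg_sqnorm (Ih n) (hB n).
have hAE n x : Re (h n x * hankelop f x) = normc (h n x) ^+ 2.
  rewrite /h; case: (c01 n x) => ->; last first.
    by rewrite !mul0r normc0 expr0n.
  by rewrite !mul1r mulrC Re_mulconj normc_conj.
have IhA n : cinteg mu (fun x => h n x * hankelop f x).
  by apply: (cintegMb (Ih n) mA (M := hbound f)) => x; exact: normc_hankelop.
have fF (u : \bar R) : (0 <= u)%E -> (u < +oo)%E -> u = (fine u)%:E.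
  by move=> u0 u1; rewrite fineK// ge0_fin_numE.
have step n : (sqnorm (h n) <= sqnorm f)%E.
  have sE : sqnorm (h n) = (Re (cI mu (fun x => h n x * hankelop f x)))%:E.
    rewrite (fF _ (sqnorm_ge0 _) (sh n)) Re_cI; congr EFin; congr fine.
    by apply: eq_integral => x _; rewrite hAE.
  have L : (sqnorm (h n) <= (2^-1 * 1)%:E * sqnorm f + (2^-1 * 1^-1)%:E * sqnorm (h n))%E.
    rewrite {1}sE (hankelop_duality Lf (Ih n)).
    have Lad : L2 (fourier (adjoint (h n))).
      split; first exact/cmeas_fourier/cinteg_adjoint.
      apply: le_lt_trans (plancherel_le (cinteg_adjoint (Ih n))) _.
      exact: le_lt_trans (sqnorm_adjoint (Ih n)) (sh n).
    set J := cI mu _; apply: (@le_trans _ _ (normc J)%:E).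
      by rewrite lee_fin (le_trans (ler_norm _))// Re_le_normc.
    apply: le_trans (normc_cI_le_fin (L2_mul Lf Lad)) _.
    apply: le_trans (normc_mul_le mf Lad.1 (@ltr01 R)) _.
    apply: leeD2l; apply: lee_wpmul2l.
      by rewrite lee_fin mulr_ge0// invr_ge0.
    apply: le_trans (plancherel_le (cinteg_adjoint (Ih n))) _.
    exact: sqnorm_adjoint (Ih n).
  move: L; rewrite (fF _ (sqnorm_ge0 _) (sh n)) (fF _ (sqnorm_ge0 _) sf).
  by rewrite -!EFinM -EFinD !lee_fin invr1; lra.
pose F n (x : P) := (normc (h n x) ^+ 2)%:E.
have mF n : measurable_fun setT (F n) by exact: measurable_normc_sqr.
have F0 n x : (0 <= F n x)%E by rewrite lee_fin sqr_ge0.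
have cvF x : F n x @[n --> \oo] --> ((normc (hankelop f x)) ^+ 2)%:E.
  apply: cvg_near_cst; near=> n.
  rewrite /F /h /cutoff indicE mem_set ?mul1r ?normc_conj//.
  have : `|x.1| + `|x.2| <= n%:R by near: n; exact: nbhs_infty_ger.
  by move=> xn; split; apply: le_trans xn; rewrite ?lerDl ?lerDr normr_ge0.
exact: (sqnorm_fatou mF F0 cvF step).
Unshelve. all: by end_near. Qed.

End hankel_operator.

(** * The symbol *)

Section abs_summable.
Context {R : realType}.
Implicit Types J : nat -> R[i].

(** [limn] has a default value on divergent series, so that [phi] is a total functional; its values
    are meaningful on Schwartz functions, where the series converges. *)
Definition csum J : R[i] :=
  limn (series (fun n => Re (J n))) +i* limn (series (fun n => Im (J n))).

Definition summable J : Prop :=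
  cvgn (series (fun n => Re (J n))) /\ cvgn (series (fun n => Im (J n))).

Lemma series_absc (u : nat -> R) (C : R) : (forall n, `|u n| <= C * absc n) ->
  cvgn (series u) /\ `|limn (series u)| <= C * 2.
Proof.
move=> uC.
have h1 : `|2^-1 : R| < 1 by rewrite ger0_norm ?invr_ge0// invf_lt1// ltr1n.
have cg : cvgn (series (geometric C 2^-1)) by exact: is_cvg_geometric_series.
have cn : cvgn [normed series u].
  apply: (series_le_cvg (v_ := geometric C 2^-1)) => // n; first exact: normr_ge0.
  exact: le_trans (normr_ge0 _) (uC n).
split; first exact: normed_cvg.
apply: le_trans (lim_series_norm cn) _.
have -> : C * 2 = limn (series (geometric C 2^-1)).
  rewrite (cvg_lim _ (cvg_geometric_series h1))//; congr (_ * _).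
  by field.
exact: lim_series_le.
Qed.

Lemma absc_summable J (C : R) : (forall n, normc (J n) <= C * absc n) ->
  summable J /\ normc (csum J) <= 4 * C.
Proof.
move=> JC.
have [cr lr] := series_absc (fun n => le_trans (Re_le_normc (J n)) (JC n)).
have [ci li] := series_absc (fun n => le_trans (Im_le_normc (J n)) (JC n)).
split; first by split.
apply: le_trans (normc_le_ReIm _) _; rewrite /=; lra.
Qed.

Lemma csum_linear (c : R[i]) J K : summable J -> summable K ->
  csum (fun n => c * J n + K n) = c * csum J + csum K.
Proof.
move=> [jr ji] [kr ki].
apply: complexP; rewrite ?(cReD, cImD, cReM, cImM) /=.
  apply/cvg_lim => //; have -> : series (fun n => Re (c * J n + K n)) =
     fun N => Re c * series (fun n => Re (J n)) N - Im c * series (fun n => Im (J n)) N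
       + series (fun n => Re (K n)) N.
    apply/funext => N; rewrite /series /= !mulr_sumr -sumrB -big_split /=.
    by apply: eq_bigr => n _; rewrite cReD cReM.
  by apply: cvgD => //; apply: cvgB; apply: cvgMl_tmp.
apply/cvg_lim => //; have -> : series (fun n => Im (c * J n + K n)) =
     fun N => Re c * series (fun n => Im (J n)) N + Im c * series (fun n => Re (J n)) N
       + series (fun n => Im (K n)) N.
  apply/funext => N; rewrite /series /= !mulr_sumr -!big_split /=.
  by apply: eq_bigr => n _; rewrite cImD cImM.
by apply: cvgD => //; apply: cvgD; apply: cvgMl_tmp.
Qed.

Lemma csum_finite J N : (forall n, (N <= n)%N -> J n = 0) ->
  csum J = \sum_(n < N) J n.
Proof.
move=> J0.
have h (p : R[i] -> R) : {morph p : z w / z + w} -> p 0 = 0 ->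
    limn (series (fun n => p (J n))) = p (\sum_(n < N) J n).
  move=> pD p0; apply/cvg_lim => //; apply: cvg_near_cst; near=> m.
  rewrite /series /= (big_morph p pD p0) -(big_mkord xpredT (fun n => p (J n))).
  have Nm : (N <= m)%N by near: m; exact: nbhs_infty_ge.
  rewrite (big_cat_nat _ (n := N))//= [X in _ + X]big_nat_cond.
  rewrite [X in _ + X]big1 ?addr0// => n.
  by rewrite andbT => /andP[Nn _]; rewrite J0.
apply: complexP; first exact: (h (@complex.Re R) (@cReD R) erefl).
exact: (h (@complex.Im R) (@cImD R) erefl).
Unshelve. all: by end_near. Qed.

End abs_summable.

Section symbol.
Context {R : realType}.
Local Notation mT := (measurableTypeR R).
Local Notation P := (mT * mT)%type.
Local Notation mu := (leb2 R).
Implicit Types u g : P -> R[i].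

Lemma MVT_lipschitz (f f' : R -> R) s t : (forall x : R, is_derive x 1 f (f' x)) ->
  (forall x, `|f' x| <= 1) -> `|f s - f t| <= `|s - t|.
Proof.
move=> df f1; wlog st : s t / t <= s.
  move=> wl; have [/wl//|/ltW/wl] := leP t s.
  by rewrite distrC [X in _ <= X]distrC.
have cf : {within `[t, s], continuous f}.
  by apply: continuous_subspaceT; exact: is_derive_continuous df.
have [c _ ->] := MVT_segment st (fun x _ => df x) cf.
by rewrite normrM ler_piMl.
Qed.

Lemma expi_lipschitz (s t : R) : normc (expi s - expi t) <= 2 * `|s - t|.
Proof.
apply: le_trans (normc_le_ReIm _) _; rewrite cReD cReN cImD cImN /= mulr2n mulrDl mul1r.
apply: lerD.
  apply: (@MVT_lipschitz (@cos R) (fun x => - sin x) s t (@is_derive_cos R)) => x.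
  by rewrite normrN ler_norml sin_geN1 sin_le1.
apply: (@MVT_lipschitz (@sin R) (@cos R) s t (@is_derive_sin R)) => x.
by rewrite ler_norml cos_geN1 cos_le1.
Qed.

(** A common bound over all words of bounded length is what makes the supremum in
    [schwartz_seminorm] a genuine upper bound. The induction peels off the letter that is
    differentiated first. *)
Lemma schwartz_words_bounded (N n : nat) g : schwartz g ->
  exists M : R, forall w x, (size w <= n)%N ->
    (1 + enorm x) ^+ N * normc (cpartial w g x) <= M.
Proof.
elim: n g => [|n IH] g sg.
  by have [M HM] := sg.2 N [::]; exists M => -[|//] x _; exact: HM.
have [M0 H0] := sg.2 N [::].
have [M1 H1] := IH _ (schwartz_cpartial false sg).
have [M2 H2] := IH _ (schwartz_cpartial true sg).
exists (Num.max M0 (Num.max M1 M2)) => w x; case/lastP: w => [_|w b].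
  by rewrite le_max H0.
rewrite size_rcons ltnS => wn; rewrite !le_max; apply/orP; right; apply/orP.
have E : cpartial (rcons w b) g x = cpartial w (cpartial [:: b] g) x.
  by rewrite /cpartial !partial_rcons.
by rewrite E; case: b {E}; [right; exact: H2|left; exact: H1].
Qed.

Lemma le_schwartz_seminorm N g x : schwartz g ->
  (1 + enorm x) ^+ N * normc (g x) <= schwartz_seminorm N g.
Proof.
move=> sg; have [M HM] := schwartz_words_bounded N N sg.
apply: sup_ubound; last by exists [::], x; split; rewrite // /cpartial /partial; case: (g x).
by exists M => _ [w [y [wN ->]]]; exact: HM.
Qed.

(* The symbol has Fourier transform [\sum_n (delta_(node n) - delta_(rim n))];
   the inverse transform occurs because [fourier_dist phi g = phi (fourier g)]. *)
Definition jump u n : R[i] := ift u (node n) - ift u (rim n).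

Definition phi u : R[i] := csum (jump u).

(** The characters at [node n] and [rim n] differ by at most [4 * pi] times the modulus of [x.2]
    times the gap of [node_rim]. The factor [x.2] costs one power beyond the four spent on [weight],
    hence the order 5; one factor [absc n] of the gap is kept for the summation. *)
Lemma jump_le u n : schwartz u ->
  normc (jump u n) <=
  4 * pi * Rintegral mu setT weight * schwartz_seminorm 5 u * absc n.
Proof.
move=> su; have Iu := schwartz_cinteg su.
rewrite /jump /ift -cIB; try exact: cinteg_character.
have pi0 : 0 < pi :> R := pi_gt0 R.
have s0 : 0 < absc n :> R := absc_gt0 n.
pose K : R := 4 * pi * schwartz_seminorm 5 u * absc n.
have b x : normc (u x * character x (node n) - u x * character x (rim n)) <= K * weight x.
  rewrite -mulrBr normcM.
  have h1 := expi_lipschitz (2 * pi * dot x (node n)) (2 * pi * dot x (rim n)).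
  have h2 : `|2 * pi * dot x (node n) - 2 * pi * dot x (rim n)| <=
      2 * pi * (`|x.2| * absc n).
    have -> : 2 * pi * dot x (node n) - 2 * pi * dot x (rim n) =
      (2 * pi) * (x.2 * ((node n).2 - (rim n).2)).
      by rewrite /dot; move: (pi : R) (node n).2 (rim n).2 => p a c /=; ring.
    rewrite normrM ger0_norm ?mulr_ge0 ?(ltW pi0)// ler_wpM2l ?mulr_ge0 ?(ltW pi0)//.
    rewrite normrM ler_wpM2l// distrC (le_trans (node_rim n))// expr2.
    by rewrite ler_piMl ?absc_le1// ltW.
  have h3 : `|x.2| * normc (u x) <= schwartz_seminorm 5 u * weight x.
    apply: weight_enorm; first by rewrite mulr_ge0 ?normc_ge0.
    apply: le_trans (le_schwartz_seminorm 5 x su).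
    rewrite mulrA ler_wpM2r ?normc_ge0// [X in _ <= X]exprSr.
    have e0 := enorm_ge0 x.
    rewrite ler_wpM2l ?exprn_ge0 ?addr_ge0//.
    apply: (@le_trans _ _ (enorm x)); last by rewrite lerDr.
    rewrite -(@ler_pXn2r _ 2)// ?nnegrE// enorm_sqr real_normK ?num_real//.
    by rewrite lerDr sqr_ge0.
  apply: le_trans (ler_wpM2l (normc_ge0 _) (le_trans h1 (ler_wpM2l _ h2))) _ => //.
  have -> : normc (u x) * (2 * (2 * pi * (`|x.2| * absc n))) =
    4 * pi * absc n * (`|x.2| * normc (u x)) by ring.
  have -> : K * weight x = 4 * pi * absc n * (schwartz_seminorm 5 u * weight x).
    by rewrite /K; ring.
  by rewrite ler_wpM2l// !mulr_ge0 ?(ltW pi0) ?(ltW s0).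
have IK := integrable_scale K integrable_weight.
apply: le_trans (normc_cI_le _) _.
  by apply: cintegB; exact: cinteg_character.
have -> : 4 * pi * Rintegral mu setT weight * schwartz_seminorm 5 u * absc n =
    Rintegral mu setT (fun x => K * weight x).
  by rewrite RintegralZl//; [rewrite /K; ring|exact: integrable_weight].
apply: le_Rintegral => //.
by apply: cinteg_normc; apply: cintegB; exact: cinteg_character.
Qed.

Lemma phi_tempered : tempered phi.
Proof.
split=> [c f g sf sg|].
  rewrite /phi -csum_linear.
  - congr csum; apply/funext => n; rewrite /jump.
    have H xi : ift (fun x => c * f x + g x) xi = c * ift f xi + ift g xi.
      have If := cinteg_character xi (schwartz_cinteg sf).
      have Ig := cinteg_character xi (schwartz_cinteg sg).
      rewrite /ift -cIZ// -cID//; last exact: cintegZ.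
      by apply: eq_cI => x; rewrite mulrDl mulrA.
    by rewrite !H; ring.
  - exact: (absc_summable (fun n => jump_le n sf)).1.
  - exact: (absc_summable (fun n => jump_le n sg)).1.
exists (4 * (4 * pi * Rintegral mu setT weight)), 5 => f sf.
apply: le_trans (absc_summable (fun n => jump_le n sf)).2 _.
by rewrite !mulrA.
Qed.

(** Inversion turns the terms into point evaluations, and the hypothesis makes the series a finite
    sum. *)
Lemma phi_fourier g (N : nat) : schwartz g ->
  (forall n, (N <= n)%N -> g (node n) = g (rim n)) ->
  phi (fourier g) = \sum_(n < N) (g (node n) - g (rim n)).
Proof.
move=> sg g0.
have E n : jump (fourier g) n = g (node n) - g (rim n).
  by rewrite /jump /ift !schwartz_inversion.
rewrite /phi (csum_finite (N := N)); last by move=> n /g0; rewrite E => ->; rewrite subrr.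
by apply: eq_bigr => n _; rewrite E.
Qed.

End symbol.

(** * The operator extends the Hankel form *)

Section hankel_extension.
Context {R : realType}.
Local Notation mT := (measurableTypeR R).
Local Notation P := (mT * mT)%type.
Local Notation V := (R^o * R^o)%type.
Implicit Types f g h F : P -> R[i].

Lemma disc1P (x : P) : disc 1 x <-> dot x x < 1.
Proof.
by rewrite /disc /= /enorm -[X in _ < X]sqrtr1 ltr_sqrt.
Qed.

Lemma flip_disc (x : P) : lenses x -> disc 1 (flip x).
Proof. by move=> [n _ ln]; rewrite (flipE ln); apply/disc1P; case: ln. Qed.

Lemma lenses_disc (x : P) : lenses x -> disc 1 x.
Proof. by move=> lx; rewrite -(flipK x); apply: flip_disc; exact/lenses_flip. Qed.

(** The sum of two points of the open unit disc has norm below 2, by the parallelogram law, whereas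
    [rim n] has norm 2. *)
Lemma rim_far n (x : P) : dot x x < 1 -> ~ dot (refl2 (rim n) x) (refl2 (rim n) x) < 1.
Proof.
move=> x1 y1; have := @dot_rim R n; move: x1 y1.
rewrite /dot /refl2; case: (rim n) => a b /=.
move=> x1 y1 E.
have := sqr_ge0 (a - 2 * x.1); have := sqr_ge0 (b - 2 * x.2); nra.
Qed.

(** For [x] in the disc the pairing evaluates [F] at all [node n - x] and [rim n - x]. The latter
    lie off the disc, and the former lie in it only if [x] belongs to [lens n], which singles out at
    most one term. *)
Lemma hankel_hat_phi F : test_function (disc 1) F ->
  hankel_hat phi F = fun x => ind x * F (flip x).
Proof.
move=> tF; apply/funext => x; rewrite /hankel_hat /fourier_dist.
have [/disc1P x1|nx] := boolP (enorm x < 1); last first.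
  rewrite ind0 ?mul0r// => /lenses_disc; exact/negP.
set G := fun zeta => _.
have GE y : G y = F (refl2 y x) by [].
have sG : schwartz G.
  have [r Hr] := test_function_box tF.
  apply: (@bounded_support_schwartz _ _ (r + (`|x.1| + `|x.2|))).
    (* A translation is the product of two half-turns, so closure of smooth functions under [refl2]
       suffices. *)
    have -> : G = fun y => F (refl2 (0, 0) (refl2 x y)).
      by apply/funext => y; rewrite /G /refl2 /= !sub0r !opprB.
    have [sF _ _] := tF.
    exact: (smooth_refl2 x (smooth_refl2 (0, 0) sF)).
  move=> y yb; apply: Hr => -[/= b1 b2]; apply: yb; split.
    have := ler_normD (y.1 - x.1) x.1; rewrite subrK; have := normr_ge0 x.2.
    by move: b1; lra.
  have := ler_normD (y.2 - x.2) x.2; rewrite subrK; have := normr_ge0 x.1.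
  by move: b2; lra.
have F0 y : ~ dot y y < 1 -> F y = 0.
  by move=> y1; apply: (test_function_eq0 tF) => /disc1P.
have Grim n : G (rim n) = 0 by rewrite GE F0//; exact: rim_far.
have Gnode n : ~ lens n x -> G (node n) = 0.
  by move=> nl; rewrite GE F0// => y1; apply: nl; split.
have [[m _ lm]|nl] := pselect (lenses x); last first.
  have Gn0 n : G (node n) = 0 by apply: Gnode => ln; apply: nl; exists n.
  by rewrite ind0// mul0r (@phi_fourier _ G 0)// ?big_ord0// => n _; rewrite Gn0 Grim.
have Gn0 n : n != m -> G (node n) = 0.
  by move=> nm; apply: Gnode => ln; move: nm; rewrite (lens_inj ln lm) eqxx.
rewrite (@phi_fourier _ G m.+1)//; last first.
  by move=> n mn; rewrite Grim Gn0// gtn_eqF.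
rewrite big_ord_recr big1 /=; last first.
  by move=> i _; rewrite Grim Gn0 ?subr0// ltn_eqF.
rewrite Grim subr0 add0r ind1; last by exists m.
by rewrite mul1r (flipE lm) GE.
Qed.

(* [window m] is a smooth approximation from below of the indicator of the
   first [m] lenses, vanishing off the lenses. *)
Definition bump m n (x : P) : R :=
  flat1 (m.+1%:R * (1 - dot x x)) *
  flat1 (m.+1%:R * (1 - dot (refl2 (node n) x) (refl2 (node n) x))).

Definition window m (x : P) : R := \sum_(n < m) bump m n x.

Lemma bump_ge0 m n x : 0 <= bump m n x.
Proof. by rewrite mulr_ge0// flat1_ge0. Qed.

Lemma bump_le1 m n x : bump m n x <= 1.
Proof. by rewrite mulr_ile1 ?flat1_ge0 ?flat1_le1. Qed.

Lemma bump_eq0 m n x : ~ lens n x -> bump m n x = 0.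
Proof.
move=> nl; have [x1|x1] := ltP (dot x x) 1; last first.
  by rewrite /bump flat1_le0 ?mul0r// pmulr_rle0// subr_le0.
have [y1|y1] := ltP (dot (refl2 (node n) x) (refl2 (node n) x)) 1; first by exfalso; exact: nl.
by rewrite /bump [X in _ * X]flat1_le0 ?mulr0// pmulr_rle0// subr_le0.
Qed.

Lemma window_lens m k x : lens k x -> (k < m)%N -> window m x = bump m k x.
Proof.
move=> lk km; rewrite /window (bigD1 (Ordinal km))//= big1 ?addr0// => i ik.
apply: bump_eq0 => li; move/eqP: ik; apply; apply: val_inj => /=.
exact: lens_inj li lk.
Qed.

Lemma window_ge0 m x : 0 <= window m x.
Proof. by apply: sumr_ge0 => n _; exact: bump_ge0. Qed.

Lemma window_le1 m x : window m x <= 1.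
Proof.
have [[k _ lk]|nl] := pselect (lenses x); last first.
  by rewrite /window big1// => n _; apply: bump_eq0 => ln; apply: nl; exists n.
have [km|mk] := ltnP k m; first by rewrite (window_lens lk km) bump_le1.
rewrite /window big1// => n _; apply: bump_eq0 => ln.
by have := leq_trans (ltn_ord n) mk; rewrite (lens_inj ln lk) ltnn.
Qed.

Lemma cvg_flat1 (c : R) : 0 < c -> flat1 (m.+1%:R * c) @[m --> \oo] --> (1 : R).
Proof.
move=> c0.
have E m : flat1 (m.+1%:R * c) = expR (- (m.+1%:R^-1 * c^-1)).
  by rewrite flat1E mulr_gt0// invfM.
rewrite (funext E).
have h0 : - (m.+1%:R^-1 * c^-1) @[m --> \oo] --> (0 : R).
  rewrite -oppr0 -(mul0r c^-1); apply: cvgN; apply: cvgMr_tmp.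
  exact: cvg_harmonic.
by rewrite -[X in _ --> X]expR0; exact: (cvg_comp _ _ h0 (@continuous_expR R 0)).
Qed.

Lemma cvg_window x : lenses x -> window m x @[m --> \oo] --> (1 : R).
Proof.
move=> [k _ lk].
have cb : bump m k x @[m --> \oo] --> (1 : R).
  rewrite -[X in _ --> X]mulr1; have [x1 y1] := lk.
  by apply: cvgM; apply: cvg_flat1; rewrite subr_gt0.
apply: cvg_trans cb; apply: near_eq_cvg; near=> m.
by rewrite (window_lens lk)//; near: m; exact: nbhs_infty_gt.
Unshelve. all: by end_near. Qed.

Lemma smooth_realM (a : P -> R) g : smooth_gen (a : V -> R^o) -> smooth g ->
  smooth (fun x => (a x)%:C * g x).
Proof.
move=> sa [sr si]; split; apply: smooth_genP.
  have -> : (fun x => Re ((a x)%:C * g x)) = fun x => a x * Re (g x).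
    by apply/funext => x; rewrite cReM mul0r subr0.
  exact: (gen_mul sa (gen_smooth sr)).
have -> : (fun x => Im ((a x)%:C * g x)) = fun x => a x * Im (g x).
  by apply/funext => x; rewrite cImM mul0r addr0.
exact: (gen_mul sa (gen_smooth si)).
Qed.

Lemma smoothD f g : smooth f -> smooth g -> smooth (fun x => f x + g x).
Proof.
move=> [fr fi] [gr gi]; split; apply: smooth_genP.
  have -> : (fun x => Re (f x + g x)) = fun x => Re (f x) + Re (g x).
    by apply/funext => x; exact: cReD.
  exact: (gen_add (gen_smooth fr) (gen_smooth gr)).
have -> : (fun x => Im (f x + g x)) = fun x => Im (f x) + Im (g x).
  by apply/funext => x; exact: cImD.
exact: (gen_add (gen_smooth fi) (gen_smooth gi)).
Qed.

Lemma smooth_sum N (f : nat -> P -> R[i]) : (forall n, smooth (f n)) ->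
  smooth (fun x => \sum_(n < N) f n x).
Proof.
move=> sf; elim: N => [|N IH].
  under eq_fun do rewrite big_ord0.
  by split; apply: smooth_genP; exact: gen_cst.
have -> : (fun x => \sum_(n < N.+1) f n x) = fun x => \sum_(n < N) f n x + f N x.
  by apply/funext => x; rewrite big_ord_recr.
exact: (smoothD IH (sf N)).
Qed.

Lemma gen_dot_self : smooth_gen (fun x : V => dot x x : R^o).
Proof. by apply: gen_add; apply: gen_mul; (exact: gen_fst || exact: gen_snd). Qed.

Lemma gen_bump m n : smooth_gen (bump m n : V -> R^o).
Proof.
have H (f : V -> R^o) : smooth_gen f ->
    smooth_gen (fun x => flat1 (m.+1%:R * (1 - f x)) : R^o).
  move=> sf; apply: (gen_comp (@smooth1_flat R) (f := fun x => m.+1%:R * (1 - f x))).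
  apply: gen_mul; first exact: gen_cst.
  have -> : (fun x => 1 - f x : R^o) = fun x => 1 + (-1) * f x.
    by apply/funext => x; rewrite mulN1r.
  by apply: gen_add; [exact: gen_cst|apply: gen_mul => //; exact: gen_cst].
apply: gen_mul; apply: H; first exact: gen_dot_self.
exact: (gen_refl (node n) gen_dot_self).
Qed.

(** The Fourier side of the operator, applied to a test function. It may jump across the boundary of
    a lens, so [has_fourier] does not apply to it directly. *)
Definition transfer g (x : P) : R[i] := ind x * g (flip x).

Definition transfer_approx g m (x : P) : R[i] := (window m x)%:C * transfer g x.

(** On the support of each bump [flip] is a fixed half-turn. This exhibits a finite sum of smooth
    functions, although [flip] itself is not continuous. *)
Lemma transfer_approxE g m :
  transfer_approx g m = fun x => \sum_(n < m) (bump m n x)%:C * g (refl2 (node n) x).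
Proof.
apply/funext => x; rewrite /transfer_approx /window rmorph_sum mulr_suml.
apply: eq_bigr => n _; have [ln|nl] := pselect (lens n x); last first.
  by rewrite bump_eq0// !mul0r.
by rewrite /transfer ind1; [rewrite (flipE ln) mul1r|exists n].
Qed.

Lemma schwartz_transfer_approx g m : smooth g -> schwartz (transfer_approx g m).
Proof.
move=> sg; apply: (@bounded_support_schwartz _ _ 1).
  rewrite transfer_approxE.
  apply: (@smooth_sum m (fun n x => (bump m n x)%:C * g (refl2 (node n) x))) => n.
  by apply: smooth_realM; [exact: gen_bump|exact: smooth_refl2].
move=> x nb; rewrite /transfer_approx /transfer ind0 ?mul0r ?mulr0//.
by move=> /lenses_box.
Qed.

Lemma cmeas_transfer g : cmeas g -> cmeas (transfer g).
Proof.
move=> mg; apply: cmeasM; first exact: cmeas_ind.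
exact: (cmeas_measure_preserving flip_preserving).
Qed.

Lemma normc_transfer g (B : R) x : (forall x, normc (g x) <= B) ->
  normc (transfer g x) <= B * (4 * weight x).
Proof.
move=> gB; rewrite normcM mulrC.
by apply: ler_pM; rewrite ?normc_ge0 ?normc_ind_weight.
Qed.

Lemma normc_transfer_approx g m x : normc (transfer_approx g m x) <= normc (transfer g x).
Proof.
rewrite normcM normc_real ger0_norm ?window_ge0//.
by rewrite ler_piMl ?normc_ge0// window_le1.
Qed.

Lemma normc_transfer_approxB g m x :
  normc (transfer_approx g m x - transfer g x) = (1 - window m x) * normc (transfer g x).
Proof.
rewrite /transfer_approx -{2}(mul1r (transfer g x)) -mulrBl -opprB mulNr normcN.
rewrite (_ : 1 - (window m x)%:C = (1 - window m x)%:C); last by rewrite rmorphB.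
by rewrite normcM normc_real ger0_norm// subr_ge0 window_le1.
Qed.

Lemma cvg_transfer_approx g x :
  normc (transfer_approx g m x - transfer g x) @[m --> \oo] --> (0 : R).
Proof.
rewrite (funext (fun m => normc_transfer_approxB g m x)).
have [lx|nl] := pselect (lenses x); last first.
  rewrite /transfer ind0// mul0r normc0.
  by rewrite (funext (fun m => mulr0 (1 - window m x))); exact: cvg_cst.
rewrite -[X in _ --> X](mul0r (normc (transfer g x))); apply: cvgMr_tmp.
rewrite -(subrr 1); apply: cvgB; first exact: cvg_cst.
exact: cvg_window.
Qed.

End hankel_extension.

Section hankel_bounded.
Context {R : realType}.
Local Notation mT := (measurableTypeR R).
Local Notation P := (mT * mT)%type.
Local Notation mu := (leb2 R).
Implicit Types f g h F : P -> R[i].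

Lemma cmeas_transfer_approx m g : cmeas g -> cmeas (transfer_approx g m).
Proof.
move=> mg; apply: cmeasM (cmeas_transfer mg); apply: cmeas_real.
apply: measurable_sum => n; apply: continuous_measurable2.
exact: (smooth_gen_continuous (gen_bump m n)).
Qed.

Lemma cvg_cI_transfer_approx F g (M B : R) : cmeas F -> cmeas g ->
  (forall x, normc (F x) <= M) -> (forall x, normc (g x) <= B) ->
  normc (cI mu (fun x => F x * transfer_approx g m x) -
         cI mu (fun x => F x * transfer g x)) @[m --> \oo] --> (0 : R).
Proof.
move=> mF mg FM gB.
have mt := cmeas_transfer mg.
have ma m := cmeas_transfer_approx m mg.
apply: (cI_dominated (g := fun x => M * B * (4 * weight x))
  (f_ := fun m (x : P) => F x * transfer_approx g m x)
  (f := fun x : P => F x * transfer g x)).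
- by move=> m; exact: cmeasM.
- exact: cmeasM.
- exact/integrable_scale/integrable_4weight.
- move=> m x; rewrite normcM -mulrA.
  apply: ler_pM; rewrite ?normc_ge0//.
  exact: le_trans (normc_transfer_approx g m x) (normc_transfer x gB).
- move=> x; have E m : normc (F x * transfer_approx g m x - F x * transfer g x) =
      normc (F x) * normc (transfer_approx g m x - transfer g x).
    by rewrite -mulrBr normcM.
  rewrite (funext E) -[X in _ --> X](mulr0 (normc (F x))); apply: cvgMl_tmp.
  exact: cvg_transfer_approx.
Qed.

(** Mean-square convergence is what controls a pairing with an [f] that is only in [L2]; it is
    dominated convergence for the squares. *)
Lemma cvg_sqnorm_transfer_approx g (B : R) : cmeas g -> (forall x, normc (g x) <= B) ->
  exists2 d : nat -> R, d m @[m --> \oo] --> (0 : R) &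
    forall m, (sqnorm (fun x => transfer_approx g m x - transfer g x)%R <= (d m)%:E)%E.
Proof.
move=> mg gB; have mt := cmeas_transfer mg.
pose D m x := transfer_approx g m x - transfer g x.
have ma m := cmeas_transfer_approx m mg.
have mD m : cmeas (D m) by apply: cmeasD => //; exact: cmeasN.
have B0 : 0 <= B by exact: le_trans (normc_ge0 _) (gB point).
have Dt m x : normc (D m x) <= normc (transfer g x).
  rewrite /D normc_transfer_approxB ler_piMl ?normc_ge0//.
  by rewrite lerBlDr lerDl window_ge0.
have tB x : normc (transfer g x) <= B.
  rewrite normcM -[X in _ <= X]mul1r.
  by apply: ler_pM; rewrite ?normc_ge0 ?normc_ind_le1.
have D2 m x : normc (D m x) ^+ 2 <= B * (B * (4 * weight x)).
  rewrite expr2; apply: ler_pM; rewrite ?normc_ge0//.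
    exact: le_trans (Dt m x) (tB x).
  exact: le_trans (Dt m x) (normc_transfer x gB).
have IB := integrable_scale B (integrable_scale B (@integrable_4weight R)).
have mD2 m : measurable_fun setT (fun x => normc (D m x) ^+ 2).
  by apply: measurable_funX; exact: cmeas_normc.
have I2 m : mu.-integrable setT (EFin \o (fun x => normc (D m x) ^+ 2)).
  apply: le_integrable IB => //; first exact/measurable_EFinP.
  move=> x _ /=; rewrite lee_fin ger0_norm ?sqr_ge0//.
  by rewrite (le_trans (D2 m x))// ler_norm.
exists (fun m => Rintegral mu setT (fun x => normc (D m x) ^+ 2)); last first.
  by move=> m; exact: (le_sqnorm (mD m) (I2 m)).
have := cI_dominated (f_ := fun m (x : P) => ((normc (D m x)) ^+ 2)%:C)
  (f := fun _ : P => 0 : R[i]) (g := fun x => B * (B * (4 * weight x))) (mu := mu)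
  (fun m => cmeas_real (mD2 m)) (@cmeas_cst _ _ _ 0) IB.
have N2 m x : normc ((normc (D m x) ^+ 2)%:C - 0) = normc (D m x) ^+ 2.
  by rewrite subr0 normc_real ger0_norm// sqr_ge0.
have h1 m x : normc ((normc (D m x) ^+ 2)%:C) <= B * (B * (4 * weight x)).
  by rewrite normc_real ger0_norm ?sqr_ge0.
move=> /(_ h1) H.
have h2 x : normc ((normc (D m x) ^+ 2)%:C - 0) @[m --> \oo] --> (0 : R).
  rewrite (funext (fun m => N2 m x)) -[X in _ --> X](mulr0 (0 : R)).
  have c := @cvg_transfer_approx R g x.
  by apply: (cvgM c c).
have E m : normc (cI mu (fun x => (normc (D m x) ^+ 2)%:C) - cI mu (fun=> 0)) =
    Rintegral mu setT (fun x => normc (D m x) ^+ 2).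
  rewrite cI0 subr0 cI_real normc_real ger0_norm//.
  by apply: Rintegral_ge0 => x _; exact: sqr_ge0.
by have := H h2; rewrite (funext E).
Qed.

(** The defining identity of [has_fourier] is extended from Schwartz functions to [transfer g]: the
    approximations converge in mean square, Plancherel's inequality carries this over to their
    transforms, and these pair continuously with [f]. *)
Lemma has_fourier_transfer f F g : L2 f -> has_fourier f F ->
  test_function (disc 1) F -> schwartz g ->
  cI mu (fun x => f x * fourier (transfer g) x) = cI mu (fun x => F x * transfer g x).
Proof.
move=> Lf fF tF sg; have [mf sf] := Lf.
have sF := test_function_schwartz tF.
have mF := cmeas_cinteg (schwartz_cinteg sF).
have mg := cmeas_cinteg (schwartz_cinteg sg).
have [M M0 FM] := schwartz_bounded sF; have [B B0 gB] := schwartz_bounded sg.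
have [d d0 Hd] := cvg_sqnorm_transfer_approx mg gB.
have e0 := cvg_cI_transfer_approx mF mg FM gB.
set X := cI mu _; set Y := cI mu _ in e0 *.
set e := fun m => _ in e0.
have It : cinteg mu (transfer g).
  apply: (le_cinteg (g := fun x => B * (4 * weight x))).
  - exact: cmeas_transfer.
  - exact/integrable_scale/integrable_4weight.
  - by move=> x; exact: normc_transfer.
have sT m : schwartz (transfer_approx g m) by apply: schwartz_transfer_approx; case: sg.
have ITm m := schwartz_cinteg (sT m).
pose D m x := transfer_approx g m x - transfer g x.
have ID m : cinteg mu (D m) by exact: cintegB.
have LF (v : P -> R[i]) : cinteg mu v -> (sqnorm v < +oo)%E -> L2 (fourier v).
  move=> Iv sv; split; first exact: cmeas_fourier.
  exact: le_lt_trans (plancherel_le Iv) sv.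
have tB x : normc (transfer g x) <= B.
  rewrite normcM -[X in _ <= X]mul1r.
  by apply: ler_pM; rewrite ?normc_ge0 ?normc_ind_le1.
have Lt : L2 (fourier (transfer g)) by apply: LF => //; exact: cinteg_sqnorm It tB.
have LT m : L2 (fourier (transfer_approx g m)).
  by apply: LF => //; exact: schwartz_sqnorm.
have LD m : L2 (fourier (D m)).
  by apply: LF => //; exact: le_lt_trans (Hd m) (ltry _).
have fourierB m y : fourier (D m) y = fourier (transfer_approx g m) y - fourier (transfer g) y.
  rewrite !fourierE -cIB; try exact: cinteg_characterJ.
  by apply: eq_cI => x; rewrite /D mulrBl.
pose S := fine (sqnorm f).
have SE : sqnorm f = S%:E by rewrite fineK// ge0_fin_numE// sqnorm_ge0.
(* The error is the pairing of [f] with the transform of [D m], estimated by AM-GM, plus [e m].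
   First [m] tends to infinity with [l] fixed, then [l] tends to 0. *)
have key (l : R) m : 0 < l -> normc (X - Y) <= 2^-1 * l * S + 2^-1 * l^-1 * d m + e m.
  move=> l0.
  have -> : X - Y = - cI mu (fun x => f x * fourier (D m) x) +
      (cI mu (fun x => F x * transfer_approx g m x) - Y).
    have <- : cI mu (fun x => f x * fourier (transfer_approx g m) x) =
        cI mu (fun x => F x * transfer_approx g m x) by exact: (fF _ (sT m)).
    have -> : cI mu (fun x => f x * fourier (D m) x) =
        cI mu (fun x => f x * fourier (transfer_approx g m) x) - X.
      apply: etrans (cIB (L2_mul Lf (LT m)) (L2_mul Lf Lt)).
      by apply: eq_cI => x; rewrite fourierB mulrBr.
    by ring.
  apply: le_trans (le_normcD _ _) _; rewrite lerD2r normcN -lee_fin.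
  apply: le_trans (normc_cI_le_fin (L2_mul Lf (LD m))) _.
  apply: le_trans (normc_mul_le mf (LD m).1 l0) _.
  rewrite EFinD !EFinM SE -EFinM; apply: leeD => //.
  apply: lee_wpmul2l; first by rewrite lee_fin mulr_ge0// invr_ge0// ltW.
  exact: le_trans (plancherel_le (ID m)) (Hd m).
have key2 (l : R) : 0 < l -> normc (X - Y) <= 2^-1 * l * S.
  move=> l0.
  have c : 2^-1 * l * S + 2^-1 * l^-1 * d m + e m @[m --> \oo] -->
      (2^-1 * l * S + 2^-1 * l^-1 * 0 + 0 : R).
    apply: cvgD => //; apply: cvgD; first exact: cvg_cst.
    exact: cvgMl_tmp.
  rewrite mulr0 !addr0 in c; rewrite -(cvg_lim _ c)//.
  apply: limr_ge; first by apply/cvg_ex; eexists; exact: c.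
  by apply: nearW => m; exact: key.
have S0 : 0 <= S by rewrite fine_ge0// sqnorm_ge0.
have XY0 : normc (X - Y) = 0.
  apply/eqP; rewrite eq_le normc_ge0 andbT; apply/ler_addgt0Pl => eps eps0; rewrite addr0.
  have l0 : 0 < eps / (S + 1) by rewrite divr_gt0// ltr_wpDl.
  apply: le_trans (key2 _ l0) _.
  have : eps / (S + 1) * S <= eps.
    by rewrite mulrAC ler_pdivrMr ?ltr_wpDl// ler_wpM2l ?(ltW eps0)// lerDl.
  rewrite -mulrA; move: (eps / (S + 1) * S) => a ha; lra.
by move/eq0_normc: XY0 => /eqP; rewrite subr_eq0 => /eqP.
Qed.

Lemma cLnorm2 f : cLnorm 2%:E f = (sqnorm f `^ 2^-1)%E.
Proof.
rewrite /cLnorm unlock; congr poweR; apply: eq_integral => x _.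
by rewrite poweR_EFin /= ger0_norm ?normc_ge0// powR_mulrn// normc_ge0.
Qed.

Lemma cLp2_L2 f : cLp 2%:E f <-> L2 f.
Proof.
rewrite /cLp cLnorm2; split=> -[mf nf]; split => //.
  by apply: lty_poweRy nf; rewrite invr_neq0// pnatr_eq0.
exact: poweR_lty.
Qed.

Lemma adjoint_fourier g : schwartz g -> adjoint (fourier g) = transfer g.
Proof.
by move=> sg; apply/funext => x; rewrite /adjoint /ift schwartz_inversion.
Qed.

Lemma pairing_hankelop f g : L2 f -> schwartz g ->
  cI mu (fun x => hankelop f x * fourier g x) = cI mu (fun x => f x * fourier (transfer g) x).
Proof.
move=> Lf sg; rewrite -(adjoint_fourier sg).
apply: etrans (hankelop_duality Lf (cinteg_fourier_schwartz sg)).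
by apply: eq_cI => x; rewrite mulrC.
Qed.

(** [flip] maps the lenses into the open disc, where a test function supported off the closed disc
    vanishes; its transfer is therefore 0. *)
Lemma hankelop_PW f : L2 f -> PW (hankelop f).
Proof.
move=> Lf; split.
  apply/cLp2_L2; split; first exact: cmeas_hankelop.
  by apply: le_lt_trans (sqnorm_hankelop Lf) _; case: Lf.
move=> g tg; have sg := test_function_schwartz tg.
transitivity (cI mu (fun x => hankelop f x * fourier g x)) => //.
rewrite (pairing_hankelop Lf sg).
have -> : transfer g = fun=> 0.
  apply/funext => x; have [lx|nl] := pselect (lenses x); last first.
    by rewrite /transfer ind0// mul0r.
  rewrite /transfer (test_function_eq0 tg) ?mulr0//; apply.
  by apply: ltW; exact: flip_disc.
have F0 x : fourier (fun _ : P => 0 : R[i]) x = 0.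
  rewrite fourierE -[RHS](@cI0 _ _ _ mu); apply: eq_cI => y; exact: mul0r.
by rewrite -[RHS](@cI0 _ _ _ mu); apply: eq_cI => x; rewrite F0 mulr0.
Qed.

(** On the Fourier side the operator is its own transpose, because [flip] is a measure-preserving
    involution that leaves [ind] invariant. *)
Lemma has_fourier_hankelop f F : L2 f -> has_fourier f F -> test_function (disc 1) F ->
  has_fourier (hankelop f) (hankel_hat phi F).
Proof.
move=> Lf fF tF g sg; rewrite hankel_hat_phi//.
transitivity (cI mu (fun x => hankelop f x * fourier g x)) => //.
rewrite (pairing_hankelop Lf sg) (has_fourier_transfer Lf fF tF sg).
have mF := cmeas_cinteg (schwartz_cinteg (test_function_schwartz tF)).
have mg := cmeas_cinteg (schwartz_cinteg sg).
have mh : cmeas (fun x => ind x * F (flip x) * g x).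
  apply: cmeasM => //; apply: cmeasM; first exact: cmeas_ind.
  exact: (cmeas_measure_preserving flip_preserving).
transitivity (cI mu (fun x => ind x * F (flip x) * g x)) => //.
rewrite -(cI_measure_preserving flip_preserving mh).
by apply: eq_cI => x; rewrite ind_flip flipK /transfer mulrCA mulrA.
Qed.

Theorem phi_extends : hankel_extends_bounded (@phi R).
Proof.
exists (@hankelop R); split; last first.
  move=> f [[/cLp2_L2 Lf _] [F [tF fF]]]; split; first exact: hankelop_PW.
  by exists F; split => //; exact: has_fourier_hankelop.
split.
- by move=> f [/cLp2_L2 Lf _]; exact: hankelop_PW.
- move=> c f g [/cLp2_L2 Lf _] [/cLp2_L2 Lg _]; apply/nearW => x.
  have If := cinteg_hankelop x Lf; have Ig := cinteg_hankelop x Lg.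
  rewrite /hankelop -cIZ// -cID//; last exact: cintegZ.
  by apply: eq_cI => y; rewrite mulrDl mulrA.
- exists 1 => f [/cLp2_L2 Lf _]; rewrite mul1e !cLnorm2.
  by apply: gt0_ler_poweR; rewrite ?invr_ge0 ?in_itv /= ?sqnorm_ge0 ?leey ?sqnorm_hankelop.
Qed.

End hankel_bounded.

(** * Absence of a bounded symbol *)

Section tiles.
Context {R : realType}.
Local Notation mT := (measurableTypeR R).
Local Notation P := (mT * mT)%type.
Local Notation V := (R^o * R^o)%type.
Local Notation mu := (leb2 R).
Implicit Types u v : R -> R.

Definition cup (t : R) : R := flat1 (1 - t ^+ 2).
Definition dcup (t : R) : R := flat (@flat_poly R 1) (1 - t ^+ 2) * - (2 * t).

Lemma flat_bounded (q : {poly R}) : exists2 C, 0 <= C & forall t, `|flat q t| <= C.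
Proof.
have [C C0 H] := poly_le_expR q (@ltr01 R); exists C => // t.
rewrite /flat; case: ifP => [t0|_]; last by rewrite normr0.
rewrite normrM (ger0_norm (expR_ge0 _)) expRN ler_pdivrMr ?expR_gt0//.
by rewrite -[X in expR X]mul1r; apply: H; rewrite invr_ge0 ltW.
Qed.

Lemma cup_outside (t : R) : 1 <= `|t| -> 1 - t ^+ 2 <= 0.
Proof.
by move=> t1; rewrite subr_le0 -real_normK ?num_real// exprn_ege1.
Qed.

Lemma cup_eq0 (t : R) : 1 <= `|t| -> cup t = 0.
Proof. by move=> t1; rewrite /cup flat1_le0// cup_outside. Qed.

Lemma dcup_eq0 (t : R) : 1 <= `|t| -> dcup t = 0.
Proof. by move=> /cup_outside t1; rewrite /dcup /flat ltNge t1 mul0r. Qed.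

Lemma cup_dcup_bounded : exists K, [/\ 0 <= K, forall t, `|cup t| <= K &
  forall t, `|dcup t| <= K].
Proof.
have [C C0 H] := flat_bounded (@flat_poly R 1).
exists (1 + 2 * C); split; first by lra.
  by move=> t; rewrite /cup ger0_norm ?flat1_ge0//; have := flat1_le1 (1 - t ^+ 2); lra.
move=> t; have [t1|/ltW t1] := leP 1 `|t|; first by rewrite dcup_eq0// normr0; lra.
rewrite /dcup normrM normrN normrM (ger0_norm (ler0n R 2)).
apply: (@le_trans _ _ (C * 2)); last by lra.
apply: (ler_pM (normr_ge0 _) _ (H _)); first by rewrite mulr_ge0.
by rewrite ler_piMr.
Qed.

Lemma is_derive_affine (k c x : R) : is_derive x 1 (fun h : R => k * (h + c)) k.
Proof.
have d := is_derive_scale k (is_derive_add (is_derive_id x 1) (is_derive_const x c)).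
by apply: (is_derive_val d); rewrite addr0 mulr1.
Qed.

Lemma is_derive_comp_affine u u' (k c x : R) : (forall t : R, is_derive t 1 u (u' t)) ->
  is_derive x 1 (fun h : R => u (k * (h + c))) (k * u' (k * (x + c))).
Proof.
move=> du; rewrite mulrC.
exact: (@is_derive1_comp _ u (fun h => k * (h + c)) x _ _ (du _) (is_derive_affine k c x)).
Qed.

Lemma is_derive_cup (t : R) : is_derive t 1 cup (dcup t).
Proof.
have d2 : is_derive t 1 (fun s : R => 1 - s ^+ 2) (- (2 * t)).
  have d := is_derive_add (is_derive_const t 1)
    (is_derive_scale (-1) (is_derive_mul (is_derive_id t 1) (is_derive_id t 1))).
  have -> : (fun s : R => 1 - s ^+ 2) = fun s => 1 + -1 * (s * s).
    by apply/funext => s; rewrite mulN1r expr2.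
  by apply: (is_derive_val d); ring.
exact: (is_derive1_comp (smooth1_flat 0 _) d2).
Qed.

Variable r : R.

(** With both profiles as parameters, partial derivatives of tiles are tiles: [cup] becomes [dcup]
    and a factor [r^-1] comes out. One norm estimate then serves the tiling and its three
    derivatives in [fourier_L1_bound]. *)
Definition tile u v n (x : P) : R :=
  u (r^-1 * (x.1 - (node n).1)) * v (r^-1 * (x.2 - (node n).2)).

Lemma is_derive_tile1 u u' v n (x : V) : (forall t : R, is_derive t 1 u (u' t)) ->
  is_derive x (axis R false) (tile u v n : V -> R^o) (r^-1 * tile u' v n x).
Proof.
move=> du; apply/is_derive_line.
have -> : (fun h : R^o => tile u v n (h *: axis R false + x)) =
    fun h => v (r^-1 * (x.2 - (node n).2)) * u (r^-1 * (h + (x.1 - (node n).1))).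
  by apply/funext => h; rewrite /tile /= !scaler0 add0r mulrC /GRing.scale /= mulr1 addrA.
have d := is_derive_scale (v (r^-1 * (x.2 - (node n).2)))
  (is_derive_comp_affine r^-1 (x.1 - (node n).1) 0 du).
by apply: (is_derive_val d); rewrite /tile add0r; ring.
Qed.

Lemma is_derive_tile2 u v v' n (x : V) : (forall t : R, is_derive t 1 v (v' t)) ->
  is_derive x (axis R true) (tile u v n : V -> R^o) (r^-1 * tile u v' n x).
Proof.
move=> dv; apply/is_derive_line.
have -> : (fun h : R^o => tile u v n (h *: axis R true + x)) =
    fun h => u (r^-1 * (x.1 - (node n).1)) * v (r^-1 * (h + (x.2 - (node n).2))).
  by apply/funext => h; rewrite /tile /= !scaler0 add0r /GRing.scale /= mulr1 addrA.
have d := is_derive_scale (u (r^-1 * (x.1 - (node n).1)))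
  (is_derive_comp_affine r^-1 (x.2 - (node n).2) 0 dv).
by apply: (is_derive_val d); rewrite /tile add0r; ring.
Qed.

Definition tiles N (c : R) u v (x : P) : R := c * \sum_(n < N) tile u v n x.

Lemma is_derive_tiles N c (f f' : nat -> V -> R^o) (x w : V) :
  (forall n, is_derive x w (f n) (r^-1 * f' n x)) ->
  is_derive x w (fun y => c * \sum_(n < N) f n y : R^o) (c * r^-1 * \sum_(n < N) f' n x).
Proof.
move=> df; rewrite -mulrA mulr_sumr.
have ds : is_derive x w (fun y => \sum_(n < N) f n y : R^o) (\sum_(n < N) r^-1 * f' n x).
  elim: N => [|N IH].
    have -> : (fun y => \sum_(n < 0) f n y : R^o) = fun=> 0.
      by apply/funext => y; rewrite big_ord0.
    by rewrite big_ord0; exact: is_derive_cst.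
  have -> : (fun y => \sum_(n < N.+1) f n y : R^o) = fun y => \sum_(n < N) f n y + f N y.
    by apply/funext => y; rewrite big_ord_recr.
  by rewrite big_ord_recr; exact: is_deriveD.
exact: is_deriveZ.
Qed.

Lemma cpartial_real b (h h' : V -> R^o) : (forall x, is_derive x (axis R b) h (h' x)) ->
  cpartial [:: b] (fun x : P => (h x)%:C) = fun x => (h' x)%:C.
Proof.
move=> dh; apply/funext => x; apply: complexP => /=; first by case: (dh x).
exact: (derive_cst (0 : R^o)).
Qed.

Lemma cpartial_tiles1 N c u u' v : (forall t : R, is_derive t 1 u (u' t)) ->
  cpartial [:: false] (fun x => (tiles N c u v x)%:C) =
  fun x => (tiles N (c * r^-1) u' v x)%:C.
Proof.
move=> du; apply: cpartial_real => x.
by apply: (@is_derive_tiles N c (tile u v) (tile u' v)) => n; exact: is_derive_tile1.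
Qed.

Lemma cpartial_tiles2 N c u v v' : (forall t : R, is_derive t 1 v (v' t)) ->
  cpartial [:: true] (fun x => (tiles N c u v x)%:C) =
  fun x => (tiles N (c * r^-1) u v' x)%:C.
Proof.
move=> dv; apply: cpartial_real => x.
by apply: (@is_derive_tiles N c (tile u v) (tile u v')) => n; exact: is_derive_tile2.
Qed.

Hypothesis r0 : 0 < r.

Definition localized u := forall t, 1 <= `|t| -> u t = 0.

Lemma tile_eq0 u v n x : localized u -> localized v ->
  r <= `|x.1 - (node n).1| \/ r <= `|x.2 - (node n).2| -> tile u v n x = 0.
Proof.
have h (t : R) : r <= `|t| -> 1 <= `|r^-1 * t|.
  by move=> rt; rewrite normrM gtr0_norm ?invr_gt0// ler_pdivlMl// mulr1.
move=> lu lv [/h xr|/h xr]; first by rewrite /tile lu// mul0r.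
by rewrite /tile lv// mulr0.
Qed.

Lemma tile_support u v n x : localized u -> localized v -> tile u v n x != 0 ->
  `|x.1 - (node n).1| < r /\ `|x.2 - (node n).2| < r.
Proof.
move=> lu lv /eqP t0; split; rewrite ltNge; apply/negP => xr; apply: t0;
  apply: tile_eq0 => //; first [by left|by right].
Qed.

(** On the support, a square of half-side [r], the Poisson kernel of rate [2 * pi * r] is at least
    [(2 * pi * r)^-1] in each variable. It replaces the indicator of the square by a majorant of
    known mass. *)
Lemma tile_sqr_le u v K n x : localized u -> localized v ->
  (forall t, `|u t| <= K) -> (forall t, `|v t| <= K) ->
  tile u v n x ^+ 2 <= (2 * pi * r * K ^+ 2) ^+ 2 * poisson2 (2 * pi * r) (refl2 (node n) x).
Proof.
move=> lu lv uK vK; have p0 : 0 < pi :> R := pi_gt0 R.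
have e0 : 0 < 2 * pi * r by rewrite !mulr_gt0.
have [->|t0] := eqVneq (tile u v n x) 0.
  by rewrite expr0n mulr_ge0 ?sqr_ge0 ?poisson2_ge0.
have [x1 x2] := tile_support lu lv t0.
have Q (t : R) : `|t| < r -> 1 <= 2 * pi * r * poisson (2 * pi * r) t.
  move=> tr; rewrite /poisson mulrA ler_pdivlMr ?poisson_den_gt0// mul1r.
  have : t ^+ 2 <= r ^+ 2.
    by rewrite -real_normK ?num_real// ler_pXn2r ?nnegrE// ltW.
  move=> t2; have := ler_wpM2l (sqr_ge0 (2 * pi)) t2.
  by move: (pi : R) => p; nra.
have Q1 := Q _ x1; have Q2 := Q _ x2.
have K0 : 0 <= K by exact: le_trans (normr_ge0 _) (uK 0).
have T : tile u v n x ^+ 2 <= (K ^+ 2) ^+ 2.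
  rewrite -real_normK ?num_real// ler_pXn2r ?nnegrE ?exprn_ge0//.
  by rewrite /tile normrM expr2; apply: ler_pM.
apply: le_trans T _; rewrite [X in _ <= X * _]exprMn mulrAC ler_peMl ?exprn_ge0//.
have -> : poisson2 (2 * pi * r) (refl2 (node n) x) =
    poisson (2 * pi * r) (x.1 - (node n).1) * poisson (2 * pi * r) (x.2 - (node n).2).
  by rewrite poisson2C.
by rewrite expr2 mulrACA -[X in X <= _]mulr1; apply: ler_pM.
Qed.

Variable N : nat.
Hypothesis rN : 2 * r <= absc N.

Lemma node_sep m n : (m < n <= N)%N -> 2 * r <= absc m - absc n.
Proof.
move=> /andP[mn nN]; have h1 := @absc_lt R _ _ mn; have h2 := @absc_le R _ _ nN.
have h3 := rN; lra.
Qed.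

Lemma tile_disjoint u v m n x : localized u -> localized v -> (m <= N)%N -> (n <= N)%N ->
  tile u v m x != 0 -> tile u v n x != 0 -> m = n.
Proof.
move=> lu lv; wlog mn : m n / (m <= n)%N => [wl mN nN tm tn|].
  by case/orP: (leq_total m n) => h; [exact: wl|apply/esym; exact: wl].
move=> mN nN tm tn; move: mn; rewrite leq_eqVlt => /predU1P[//|mn]; exfalso.
have [h1 _] := tile_support lu lv tm; have [h2 _] := tile_support lu lv tn.
have := @node_sep m n; rewrite mn nN => /(_ isT) s.
move: h1 h2; rewrite !ltr_norml /= => /andP[a1 a2] /andP[b1 b2].
by move: (absc m) (absc n) s a1 a2 b1 b2 => p q s a1 a2 b1 b2; lra.
Qed.

(** Supports are disjoint, so the cross terms vanish; this keeps the energy of a tiling linear in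
    the number of tiles. *)
Lemma sqr_sum_tile u v x : localized u -> localized v ->
  (\sum_(n < N) tile u v n x) ^+ 2 = \sum_(n < N) tile u v n x ^+ 2.
Proof.
move=> lu lv; have [[m tm]|nt] := pselect (exists m : 'I_N, tile u v m x != 0); last first.
  have t0 (n : 'I_N) : tile u v n x = 0.
    by apply/eqP; apply: contrapT => /negP tn; apply: nt; exists n.
  by rewrite !big1 ?expr0n// => n _; rewrite t0// expr0n.
have t0 (n : 'I_N) : n != m -> tile u v n x = 0.
  move=> nm; apply/eqP; apply: contrapT => /negP tn; move/eqP: nm; apply; apply: val_inj.
  exact: (tile_disjoint lu lv (ltnW (ltn_ord n)) (ltnW (ltn_ord m)) tn tm).
rewrite (bigD1 m)//= [in RHS](bigD1 m)//= !big1 ?addr0// => n nm; rewrite t0//.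
by rewrite expr0n.
Qed.

Lemma sqnorm_tiles (c K : R) u v : cmeas (fun x : P => (tiles N c u v x)%:C) ->
  localized u -> localized v -> (forall t, `|u t| <= K) -> (forall t, `|v t| <= K) ->
  (sqnorm (fun x : P => (tiles N c u v x)%:C) <=
   (N%:R * (c * (2 * pi * r * K ^+ 2)) ^+ 2)%:E)%E.
Proof.
move=> mt lu lv uK vK; have p0 : 0 < pi :> R := pi_gt0 R.
have e0 : 0 < 2 * pi * r by rewrite !mulr_gt0.
pose D := (c * (2 * pi * r * K ^+ 2)) ^+ 2.
pose p (n : nat) (x : P) := poisson2 (2 * pi * r) (refl2 (node n) x).
have D0 : 0 <= D by exact: sqr_ge0.
have pge0 n x : 0 <= p n x by exact: poisson2_ge0.
have mp n : measurable_fun setT (p n).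
  by apply: measurable_poisson2 => //; exact: measurable_refl2.
have mDp n : measurable_fun setT (fun x => (D * p n x)%:E).
  by apply/measurable_EFinP; exact: measurable_funM.
have -> : ((N%:R * D)%:E = \int[mu]_x (\sum_(n < N) (D * p n x)%:E))%E.
  rewrite ge0_integral_sum//; last first.
    by move=> n x _; rewrite lee_fin mulr_ge0.
  rewrite (eq_bigr (fun=> D%:E)); last first.
    move=> n _; rewrite (ge0_integralZ_EFin (mp n) (pge0 n) D0).
    by rewrite (integral_poisson2 (node n) e0) mule1.
  by rewrite sumEFin sumr_const card_ord mulr_natl.
apply: ge0_le_integral => //.
- by move=> x _; rewrite lee_fin sqr_ge0.
- exact: measurable_normc_sqr.
- exact: emeasurable_sum.
move=> x _; rewrite sumEFin lee_fin normc_real real_normK ?num_real//.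
rewrite /tiles exprMn sqr_sum_tile// mulr_sumr; apply: ler_sum => n _.
have -> : D * p n x = c ^+ 2 * ((2 * pi * r * K ^+ 2) ^+ 2 * p n x).
  by rewrite /D (exprMn _ c) mulrA.
apply: ler_wpM2l; first exact: sqr_ge0.
exact: tile_sqr_le.
Qed.

End tiles.

(** * Testing a bounded symbol on tilings *)

Section no_bounded_symbol.
Context {R : realType}.
Local Notation mT := (measurableTypeR R).
Local Notation P := (mT * mT)%type.
Local Notation V := (R^o * R^o)%type.
Local Notation mu := (leb2 R).

Lemma cLpy_pairing (psi : P -> R[i]) : cLp +oo%E psi -> exists2 M, 0 <= M &
  forall g : P -> R[i], cinteg mu g ->
    ((normc (cI mu (fun x => psi x * g x)))%:E <= M%:E * \int[mu]_x (normc (g x))%:E)%E.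
Proof.
move=> [mpsi npsi].
have [M M0 HM] : exists2 M, 0 <= M & {ae mu, forall x, normc (psi x) <= M}.
  (* [Lnorm] at [+oo] is an essential supremum only on a space of positive measure; on a null space
     any bound holds almost everywhere. *)
  have [mu0|mu0] := ltP 0%E (mu setT); last first.
    exists 0 => //; exists setT; split => //.
    by apply/eqP; rewrite eq_le mu0 measure_ge0.
  move: npsi; rewrite /cLnorm unlock mu0.
  set e := ess_sup _ _ => ey; exists (Num.max 0 (fine e)); first by rewrite le_max lexx.
  have := ess_sup_ge mu (abse \o (fun x => (normc (psi x))%:E)); apply: filterS => x.
  rewrite -/e /= ger0_norm ?normc_ge0//; case: e ey => [s| |] // _.
  by rewrite lee_fin le_max => ->; rewrite orbT.
exists M => // g Ig; have mg := cmeas_cinteg Ig.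
have B : (\int[mu]_x (normc (psi x * g x))%:E <= M%:E * \int[mu]_x (normc (g x))%:E)%E.
  have mng := cmeas_normc mg.
  rewrite -(ge0_integralZ_EFin mng (fun x => normc_ge0 (g x)) M0).
  apply: ae_ge0_le_integral => //.
  - by move=> x _; rewrite lee_fin normc_ge0.
  - by apply/measurable_EFinP/cmeas_normc; exact: cmeasM.
  - by move=> x _; rewrite lee_fin mulr_ge0 ?normc_ge0.
  - by apply/measurable_EFinP; exact: measurable_funM.
  apply: filterS HM => x psiM _; rewrite lee_fin normcM.
  by rewrite ler_wpM2r ?normc_ge0.
apply: (le_trans _ B); apply: normc_cI_le_fin; apply: cintegP; first exact: cmeasM.
apply: le_lt_trans B _; apply: lte_mul_pinfty => //; exact: cinteg_lty.
Qed.

(* Small enough for the tiles around [node n], [n < N], to be disjoint and to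
   stay inside the disc of radius 2, whose boundary is at distance about
   [absc N ^+ 2 / 64] from [node N]. *)
Definition tile_radius N : R := absc N ^+ 2 / 256.

Definition tiling N (x : P) : R[i] := (tiles (tile_radius N) N 1 cup cup x)%:C.

Lemma tile_radius_gt0 N : 0 < tile_radius N.
Proof. by rewrite divr_gt0// exprn_gt0// absc_gt0. Qed.

Lemma tile_radius_le N : 2 * tile_radius N <= absc N.
Proof.
have s0 : 0 < absc N :> R := absc_gt0 N; have s1 : absc N <= 1 :> R := @absc_le1 R N.
rewrite /tile_radius; nra.
Qed.

Lemma localized_cup : localized (@cup R).
Proof. by move=> t; exact: cup_eq0. Qed.

Lemma localized_dcup : localized (@dcup R).
Proof. by move=> t; exact: dcup_eq0. Qed.

Lemma smooth_tiling N : smooth (tiling N).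
Proof.
have g1 (f : V -> R^o) (s : R) : smooth_gen f ->
    smooth_gen (fun x => cup ((tile_radius N)^-1 * (f x - s)) : R^o).
  move=> gf; pose q x := (tile_radius N)^-1 * (f x - s).
  have gq : smooth_gen (q : V -> R^o).
    exact: (gen_mul (gen_cst _) (gen_add gf (gen_cst _))).
  have -> : (fun x => cup ((tile_radius N)^-1 * (f x - s)) : R^o) =
      fun x => flat1 (1 + -1 * (q x * q x)).
    by apply/funext => x; rewrite /cup mulN1r expr2.
  apply: (gen_comp (@smooth1_flat R) (f := fun x => 1 + -1 * (q x * q x))).
  exact: (gen_add (gen_cst _) (gen_mul (gen_cst _) (gen_mul gq gq))).
have gt n : smooth_gen (tile (tile_radius N) cup cup n : V -> R^o).
  exact: (gen_mul (g1 _ _ gen_fst) (g1 _ _ gen_snd)).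
split; apply: smooth_genP; last exact: gen_cst.
exact: (gen_mul (gen_cst 1) (gen_sum N gt)).
Qed.

(** With [r = tile_radius N], moving by less than [r] in each coordinate from a node, whose
    coordinates are at most 1 and 2, raises the squared norm by at most [6 * r] plus small quadratic
    terms. That of the node is at most [4 - 16 * r], so a margin of [8 * r = absc N ^+ 2 / 32]
    remains. *)
Lemma tiling_support N x : tiling N x != 0 -> dot x x <= 4 - absc N ^+ 2 / 32.
Proof.
move=> gx; have [[n tn]|nt] := pselect (exists n : 'I_N,
    tile (tile_radius N) cup cup n x != 0); last first.
  move: gx; rewrite /tiling /tiles big1 ?mulr0 ?eqxx// => n _.
  by apply/eqP; apply: contrapT => /negP tn; apply: nt; exists n.
have [] := tile_support (tile_radius_gt0 N) localized_cup localized_cup tn.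
have E := @dot_node R n; have ss := @absc_le R _ _ (ltnW (ltn_ord n)).
have r0 := tile_radius_gt0 N; have s'1 := @absc_le1 R n.
have s1 := @absc_le1 R N; have s0 := @absc_gt0 R N; have s'0 := @absc_gt0 R n.
have rE : tile_radius N = absc N ^+ 2 / 256 by [].
have b0 : 0 <= (node n).2 :> R by exact: sqrtr_ge0.
have aE : (node n).1 = absc n :> R by [].
move: E b0 aE rE r0; rewrite /dot; move: (tile_radius N) (node n).1 (node n).2 => r a b.
move: (absc N) (absc n) s0 s1 s'0 s'1 ss => s s' s0 s1 s'0 s'1 ss E b0 aE rE r0 xa xb.
have s2 : s ^+ 2 <= s' ^+ 2 by rewrite ler_pXn2r// nnegrE ltW.
have b2 : b <= 2.
  by rewrite -(@ler_pXn2r _ 2)// ?nnegrE//; have := sqr_ge0 s'; have := sqr_ge0 a; nra.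
have r1 : r <= 1 / 256 by rewrite rE; nra.
have sq (u : R) : `|u| < r -> u ^+ 2 <= r / 256.
  move=> ur; rewrite -real_normK ?num_real//; have := normr_ge0 u; nra.
have A1 := sq _ xa; have A2 := sq _ xb.
have P1 : a * (x.1 - a) <= r.
  have a0 : 0 <= a by rewrite aE ltW.
  have a1 : a <= 1 by rewrite aE.
  apply: le_trans (ler_norm _) _; rewrite normrM (ger0_norm a0).
  by rewrite -[X in _ <= X]mul1r; exact: (ler_pM a0 (normr_ge0 _) a1 (ltW xa)).
have P2 : b * (x.2 - b) <= 2 * r.
  apply: le_trans (ler_norm _) _; rewrite normrM (ger0_norm b0).
  exact: (ler_pM b0 (normr_ge0 _) b2 (ltW xb)).
have -> : x.1 * x.1 + x.2 * x.2 = (a * a + b * b) + 2 * (a * (x.1 - a)) + 2 * (b * (x.2 - b)) +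
   (x.1 - a) ^+ 2 + (x.2 - b) ^+ 2 by ring.
by rewrite E; lra.
Qed.

Lemma tiling_test N : test_function (disc 2) (tiling N).
Proof.
have s0 : 0 < absc N ^+ 2 :> R by rewrite exprn_gt0// absc_gt0.
have s1 := @absc_sqr_le1 R N.
apply: (@test_function_disc _ 2 (Num.sqrt (4 - absc N ^+ 2 / 32))).
- exact: smooth_tiling.
- rewrite -(@ltr_pXn2r _ 2)// ?nnegrE ?sqrtr_ge0// sqr_sqrtr; lra.
- by move=> x /tiling_support gx; rewrite /enorm ler_sqrt//; lra.
Qed.

Lemma tiling_rim N n : tiling N (rim n) = 0.
Proof.
apply/eqP; apply: contrapT => /negP/tiling_support; rewrite dot_rim.
by have : 0 < absc N ^+ 2 :> R by [rewrite exprn_gt0// absc_gt0]; lra.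
Qed.

Lemma tile_node0 N m n : m != n -> (n < N)%N ->
  tile (tile_radius N) cup cup n (node m) = 0 :> R.
Proof.
move=> mn nN; apply: (tile_eq0 (tile_radius_gt0 N) localized_cup localized_cup); left.
have r0 := tile_radius_gt0 N; have rN := tile_radius_le N.
have hN := @absc_le R _ _ nN; rewrite abscS in hN.
have sn := @absc_le R _ _ (ltnW nN).
case: (ltngtP m n) mn => // [mn _|nm _].
  have h := @absc_lt R _ _ mn; rewrite ger0_norm /=; lra.
have h := @absc_lt R _ _ nm; rewrite ler0_norm /=; lra.
Qed.

Lemma tiling_node N n :
  tiling N (node n) = if (n < N)%N then (cup 0 ^+ 2)%:C else 0.
Proof.
rewrite /tiling /tiles mul1r; case: ifPn => [nN|]; last first.
  rewrite -leqNgt => Nn; rewrite big1// => i _; apply: tile_node0 => //.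
  by rewrite gtn_eqF// (leq_trans (ltn_ord i) Nn).
rewrite (bigD1 (Ordinal nN))//= big1 ?addr0; last first.
  by move=> i ni; apply: tile_node0 => //; rewrite eq_sym.
by rewrite /tile !subrr !mulr0 expr2.
Qed.

Lemma phi_tiling N : phi (fourier (tiling N)) = (N%:R * cup 0 ^+ 2)%:C.
Proof.
rewrite (@phi_fourier _ _ N); first last.
- by move=> n Nn; rewrite tiling_rim tiling_node ltnNge Nn.
- exact: test_function_schwartz (tiling_test N).
rewrite (eq_bigr (fun=> (cup 0 ^+ 2)%:C)); last first.
  by move=> n _; rewrite tiling_rim tiling_node ltn_ord subr0.
by rewrite sumr_const card_ord -rmorphMn /= mulr_natl.
Qed.

(* The [L^1] norm grows like the square root of the number of tiles, whereas
   [phi_tiling] grows linearly. *)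
Lemma fourier_tiling_L1 : exists2 Z, 0 <= Z & forall k, (0 < k)%N ->
  (\int[mu]_x (normc (fourier (tiling (k ^ 2)) x))%:E <= (k%:R * Z)%:E)%E.
Proof.
have [K [K0 cK dK]] := @cup_dcup_bounded R.
pose A : R := (2 * pi * K ^+ 2) ^+ 2.
exists (2^-1 * (1 + A)); first by rewrite mulr_ge0// addr_ge0// sqr_ge0.
move=> k k0; set N := (k ^ 2)%N; set r := tile_radius N.
have r0 : 0 < r := tile_radius_gt0 N.
have sg : schwartz (tiling N) := test_function_schwartz (tiling_test N).
have g1 : cpartial [:: false] (tiling N) = fun x => (tiles r N (1 * r^-1) dcup cup x)%:C.
  exact: (cpartial_tiles1 _ _ _ _ (@is_derive_cup R)).
have g2 : cpartial [:: true] (tiling N) = fun x => (tiles r N (1 * r^-1) cup dcup x)%:C.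
  exact: (cpartial_tiles2 _ _ _ _ (@is_derive_cup R)).
have g3 : cpartial [:: false] (cpartial [:: true] (tiling N)) =
    fun x => (tiles r N (1 * r^-1 * r^-1) dcup dcup x)%:C.
  by rewrite g2; exact: (cpartial_tiles1 _ _ _ _ (@is_derive_cup R)).
have sg1 := schwartz_cpartial false sg; have sg2 := schwartz_cpartial true sg.
have sg3 := schwartz_cpartial false sg2.
have cm (g : P -> R[i]) : schwartz g -> cmeas g.
  by move=> s; exact: cmeas_cinteg (schwartz_cinteg s).
have rN : 2 * r <= absc N := tile_radius_le N.
have lc := localized_cup; have ld := localized_dcup.
have q0 := sqnorm_tiles r0 rN (cm _ sg) lc lc cK cK.
have q1 : (sqnorm (cpartial [:: false] (tiling N)) <=
    (N%:R * (1 * r^-1 * (2 * pi * r * K ^+ 2)) ^+ 2)%:E)%E.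
  by move: (cm _ sg1); rewrite g1 => m; exact: sqnorm_tiles.
have q2 : (sqnorm (cpartial [:: true] (tiling N)) <=
    (N%:R * (1 * r^-1 * (2 * pi * r * K ^+ 2)) ^+ 2)%:E)%E.
  by move: (cm _ sg2); rewrite g2 => m; exact: sqnorm_tiles.
have q3 : (sqnorm (cpartial [:: false] (cpartial [:: true] (tiling N))) <=
    (N%:R * (1 * r^-1 * r^-1 * (2 * pi * r * K ^+ 2)) ^+ 2)%:E)%E.
  by move: (cm _ sg3); rewrite g3 => m; exact: sqnorm_tiles.
have kR : 0 < k%:R :> R by rewrite ltr0n.
(* This [l] balances the two terms of [fourier_L1_bound]. Each of the four energies, multiplied by
   its power of [r], is bounded by [N * A * r ^+ 2], so the powers of [r] cancel; as [N = k ^ 2],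
   both terms are multiples of [k]. *)
have l0 : 0 < 4 * r ^+ 2 * k%:R by rewrite mulr_gt0// mulr_gt0// exprn_gt0.
apply: le_trans (fourier_L1_bound sg r0 l0 q0 q1 q2 q3) _; rewrite lee_fin.
rewrite le_eqVlt; apply/orP; left; apply/eqP; rewrite /A /N natrX.
move: (pi : R) (k%:R : R) kR r r0 {l0 q0 q1 q2 q3 g1 g2 g3 rN} => p kk kk0 r r0.
by field; rewrite !lt0r_neq0.
Qed.

Theorem phi_no_bounded_symbol : ~ has_bounded_symbol (@phi R).
Proof.
move=> [psi [Lpsi Hpsi]]; have [M M0 HM] := cLpy_pairing Lpsi.
have [Z Z0 HZ] := fourier_tiling_L1.
have c0 : 0 < cup 0 ^+ 2 :> R.
  by rewrite exprn_gt0// /cup flat1_gt0// expr0n subr0.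
(* A tiling with [k ^ 2] tiles gives [k ^ 2 * cup 0 ^+ 2 <= M * (k * Z)]; dividing by [k] leaves a
   bound that fails for large [k]. *)
have H k : (0 < k)%N -> k%:R * cup 0 ^+ 2 <= M * Z.
  move=> k0; have kR : 0 < k%:R :> R by rewrite ltr0n.
  have sg : schwartz (tiling (k ^ 2)) := test_function_schwartz (tiling_test _).
  have E : cI mu (fun x => psi x * fourier (tiling (k ^ 2)) x) =
      ((k ^ 2)%:R * cup 0 ^+ 2)%:C.
    by rewrite -phi_tiling; exact: Hpsi (tiling_test _).
  have := HM _ (cinteg_fourier_schwartz sg).
  rewrite E normc_real ger0_norm; last by rewrite mulr_ge0 ?ler0n// ltW.
  move=> /le_trans /(_ (lee_wpmul2l _ (HZ k k0))) /=; rewrite lee_fin => /(_ M0).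
  rewrite -EFinM lee_fin natrX expr2 -mulrA mulrCA [X in _ <= X]mulrCA.
  by rewrite ler_pM2l.
have MZ : 0 <= M * Z / cup 0 ^+ 2 := divr_ge0 (mulr_ge0 M0 Z0) (ltW c0).
have := archi_boundP MZ; set k := Num.bound _ => hk.
have k0 : (0 < k)%N by rewrite -(ltr0n R); exact: le_lt_trans MZ hk.
by have := H k k0; rewrite leNgt -ltr_pdivrMr// hk.
Qed.

End no_bounded_symbol.

Theorem theorem1 (R : realType) :
  exists phi : (R * R -> R[i]) -> R[i],
    tempered phi /\ hankel_extends_bounded phi /\ ~ has_bounded_symbol phi.
Proof.
exists (@phi R); split; first exact: phi_tempered.
by split; [exact: phi_extends|exact: phi_no_bounded_symbol].
Qed.
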